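(* There is a polynomial-time $\frac{16}{11}$-approximation algorithm for unweighted $\mathrm{FGC}$: given any feasible instance, it outputs a feasible edge-set whose number of edges is at most $\frac{16}{11}$ times the minimum number of edges of a feasible edge-set.
   Context: An instance of unweighted $\mathrm{FGC}$ consists of an undirected connected graph $G=(V,E)$ (multiedges allowed, no self-loops) and a partition $E=\mathscr{S}\,\dot\cup\,\mathscr{U}$ into safe and unsafe edges. An edge-set $F\subseteq E$ (sub-multiset of $E$) is feasible if for every unsafe edge $e\in F\cap\mathscr{U}$ the graph $(V,F\setminus\{e\})$ is connected. The goal is to find a feasible $F$ minimizing $|F|$ (every edge has unit cost). *)

(* Defs.v *)
From mathcomp Require Import all_boot all_order all_algebra.

Set Implicit Arguments.
Unset Strict Implicit.
Unset Printing Implicit Defensive.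

(** * Random access machines

The cost model is the unit-cost RAM whose only arithmetic is addition and
truncated subtraction (Cook and Reckhow); it is polynomially equivalent to
Turing machines, since one step lengthens the largest stored number by at most
one bit.  Registers are addressed directly only, so a program uses finitely
many of them; memory is addressed only through registers. *)

Inductive instr : Type :=
| IConst of nat & nat        (* IConst d c : R[d] := c           *)
| IAdd of nat & nat & nat    (* IAdd d a b : R[d] := R[a] + R[b] *)
| ISub of nat & nat & nat    (* ISub d a b : R[d] := R[a] - R[b] *)
| ILoad of nat & nat         (* ILoad d a  : R[d] := M[R[a]]     *)
| IStore of nat & nat        (* IStore a b : M[R[a]] := R[b]     *)
| IJz of nat & nat.          (* IJz a l    : if R[a] = 0 goto l  *)

Definition program := seq instr.

Record config := Config { pc : nat; reg : nat -> nat; memory : nat -> nat }.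

Definition upd (f : nat -> nat) (x y : nat) : nat -> nat :=
  fun z => if z == x then y else f z.

Definition exec_instr (i : instr) (s : config) : config :=
  let: Config p r m := s in
  match i with
  | IConst d c => Config p.+1 (upd r d c) m
  | IAdd d a b => Config p.+1 (upd r d (r a + r b)) m
  | ISub d a b => Config p.+1 (upd r d (r a - r b)) m
  | ILoad d a => Config p.+1 (upd r d (m (r a))) m
  | IStore a b => Config p.+1 r (upd m (r a) (r b))
  | IJz a l => Config (if r a == 0 then l else p.+1) r m
  end.

(* A halted configuration is a fixed point of [step]. *)
Definition halted (P : program) (s : config) : bool := size P <= pc s.

Definition step (P : program) (s : config) : config :=
  if onth P (pc s) is Some i then exec_instr i s else s.

Definition initial (input : seq nat) : config :=
  Config 0 (fun=> 0) (nth 0 input).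

Definition run (P : program) (input : seq nat) (t : nat) : config :=
  iter t (step P) (initial input).

(** * Unweighted flexible graph connectivity *)

(* Edges are indexed, so that parallel edges are distinct elements and a
   sub-multiset of the edges is a set of indices.  The order of the two ends
   of an edge carries no meaning. *)
Record multigraph := Multigraph {
  nverts : nat;
  nedges : nat;
  ends : 'I_nedges -> 'I_nverts * 'I_nverts
}.

Definition adj (G : multigraph) (F : {set 'I_(nedges G)}) :
    rel 'I_(nverts G) :=
  fun u v => [exists e in F, (ends e == (u, v)) || (ends e == (v, u))].

Definition spans_connected (G : multigraph) (F : {set 'I_(nedges G)}) : bool :=
  [forall u, forall v, connect (adj F) u v].

Record fgc := FGC {
  graph :> multigraph;
  safe : {set 'I_(nedges graph)};
  nverts_gt0 : 0 < nverts graph;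
  loopless : forall e : 'I_(nedges graph), (ends e).1 != (ends e).2;
  graph_connected : spans_connected [set: 'I_(nedges graph)]
}.

Definition unsafe (I : fgc) : {set 'I_(nedges I)} := ~: safe I.

(* Connectivity of (V, F) itself is required explicitly: the condition on the
   unsafe edges of F is vacuous when F contains none. *)
Definition feasible (I : fgc) (F : {set 'I_(nedges I)}) : bool :=
  spans_connected F &&
  [forall e in F :&: unsafe I, spans_connected (F :\ e)].

Definition feasible_instance (I : fgc) : Prop :=
  exists F : {set 'I_(nedges I)}, feasible F.

(* The default value [nedges I] bounds every #|F|, so it never affects the
   minimum for a feasible instance. *)
Definition opt (I : fgc) : nat :=
  \big[minn/nedges I]_(F : {set 'I_(nedges I)} | feasible F) #|F|.

(* |V|, |E|, then for every edge its two ends and 1 or 0 according as it is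
   safe or unsafe.  All these numbers are at most |V| + |E|, and |V| <= |E| + 1
   by connectivity, so being polynomial in |V| + |E| and in the bit length of
   the instance are the same. *)
Definition encode (I : fgc) : seq nat :=
  [:: nverts I; nedges I] ++
  flatten [seq [:: nat_of_ord (ends e).1; nat_of_ord (ends e).2;
                   nat_of_bool (e \in safe I)]
          | e <- enum 'I_(nedges I)].

Definition instance_size (I : fgc) : nat := nverts I + nedges I.

(* The output is the characteristic vector held in memory cells 0 .. |E|-1. *)
Definition output_edges (I : fgc) (s : config) : {set 'I_(nedges I)} :=
  [set e : 'I_(nedges I) | memory s e != 0].

(* Main.v *)
Require Import Defs.
From mathcomp Require Import all_boot all_order all_algebra zify.

Set Implicit Arguments.
Unset Strict Implicit.
Unset Printing Implicit Defensive.

Import GRing.Theory Num.Theory.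

(** Feasibility is a condition on cuts: no nontrivial cut is empty or consists of
    one unsafe edge.  The algorithm is a local search on pairs (F, X), where F is
    feasible and X arises from F by splits, that is, by deleting two unsafe edges
    that form a cut.  It tries to exchange at most 20 edges of F for at most 20
    others; to delete an edge of X, add all edges joining different components
    of X and prune the latter; and to split X further.  Every successful move
    lowers a polynomially bounded potential.

    In a local optimum, a feasible O contains at least two edges parallel to each
    pair deleted by a split; let Q consist of two such edges for each pair.  Call
    two edges equivalent if they form a cut.  The nonbridges of X fall into
    classes for X, which have at least three elements as no split is possible,
    and into finer blocks for X + Q, which have at least two as pruning fails.
    Three lower bounds hold: |O| >= |V| - 1; |O \ Q| >= |X| minus the number of
    blocks; and |O \ Q| is at least the total size of the small blocks outside
    few frozen classes, since an edge of O crossing the cuts of two such blocks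
    would give an improving exchange.  Their sum with weights 10, 5 and 1 is
    16 |O| >= 11 |F|.

    The search is written in a language of bounded loops, whose running time is
    polynomial because of its syntax, and compiled to the machine. *)

(** The arguments are linear algebra over the field with two elements: the edges of a set that cross
    a symmetric difference of vertex sets are the symmetric difference of those crossing each. Cuts
    sharing edges combine into smaller ones, and ranks are compared by counting vertex sets in
    powers of two. Split pairs are harmless for the ratio, because [O] also pays two edges for each;
    what they leave behind has larger classes. The obstacle is that [F] and [O] may use different
    edges of one class of parallel edges, while inequivalence of edges is visible only in [Q].
    Exchanges therefore also replace the edges of [F] by those of [Q] in at most nine such classes;
    two edges in each of them and a deleted pair account for the bound 20. The potential counts
    bridges after edges, so an exchange of equal size that destroys a bridge is an improvement as
    well. This keeps the bridges of [X] bridges when [Q] is added, as the second lower bound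
    requires. *)

Ltac eqcases :=
  repeat match goal with
  | |- context [?x == ?x] => rewrite (eqxx x)
  | H : is_true (?x != ?y) |- context [?x == ?y] => rewrite (negbTE H)
  | H : is_true (?x != ?y) |- context [?y == ?x] => rewrite (eq_sym y x) (negbTE H)
  | |- context [?x == ?y] =>
      first [case: (eqVneq x y) => [->|?] | case: (eqVneq x y) => ?]
  end; rewrite ?orbT ?andbT ?orbF ?andbF //=.

(** Both sets are counted class by class, so only the classes meeting [A] have to be compared. *)
Lemma class_leq (I : finType) (r : rel I) (A B : {set I}) :
  reflexive r -> symmetric r -> transitive r ->
  (forall a, a \in A -> #|[set x in A | r a x]| <= #|[set x in B | r a x]|) ->
  #|A| <= #|B|.
Proof.
move=> rr rs rt h; pose cls a := [set x | r a x].
have clsE a b : (cls b == cls a) = r a b.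
  apply/eqP/idP => [/setP/(_ b)|ab]; first by rewrite !inE rr.
  apply/setP => x; rewrite !inE; apply/idP/idP; first exact: rt.
  by apply: rt; rewrite rs.
rewrite -!sum1_card !(partition_big cls xpredT) //=; apply: leq_sum => C _.
case: (pickP [pred a | (a \in A) && (cls a == C)]) => [a /andP[aA /eqP <-]|no].
  have := h _ aA; rewrite -!sum1_card.
  congr (_ <= _); apply: eq_bigl => x; rewrite !inE clsE //.
by rewrite big_pred0.
Qed.

Section Representatives.
Variables (I : finType) (r : rel I).
Hypotheses (rr : reflexive r) (rs : symmetric r) (rt : transitive r).

(** The choice by [pick] depends only on the class of [a], so equivalent elements get the same
    representative. *)
Definition rep a : I := odflt a [pick x | r a x].

Lemma rep_rel a : r a (rep a).
Proof. by rewrite /rep; case: pickP => //= /(_ a); rewrite rr. Qed.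

Lemma rel_eq a b x : r a b -> r a x = r b x.
Proof. by move=> ab; apply/idP/idP; apply: rt => //; rewrite rs. Qed.

Lemma rep_eq a b : r a b -> rep a = rep b.
Proof.
move=> ab; rewrite /rep (eq_pick (fun x => rel_eq x ab)).
by case: pickP => //= /(_ b); rewrite rr.
Qed.

Lemma repE a b : (rep a == rep b) = r a b.
Proof.
apply/eqP/idP => [eq|]; last exact: rep_eq.
by apply: rt (rep_rel a) _; rewrite eq rs rep_rel.
Qed.

Lemma repK a : rep (rep a) = rep a.
Proof. by apply/esym/rep_eq/rep_rel. Qed.

End Representatives.

(** * Cuts *)

Section Cuts.
Variables (V E : finType) (en : E -> V * V) (sf : {set E}).
Implicit Types (S T K U R W : {set V}) (X Y Z A B D F O Q : {set E}).
Implicit Types (e f g h a b d p q : E).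

Definition cr e S : bool := ((en e).1 \in S) (+) ((en e).2 \in S).

Definition sd (W : finType) (S T : {set W}) : {set W} :=
  [set x | (x \in S) (+) (x \in T)].

Definition dl X S : {set E} := [set e in X | cr e S].

Definition triv S : bool := (S == set0) || (S == setT).

Definition bad X S : bool := (#|dl X S| <= 1) && (dl X S \subset ~: sf).

Definition feas X : bool := [forall S, bad X S ==> triv S].

Lemma crD e S T : cr e (sd S T) = cr e S (+) cr e T.
Proof.
by rewrite /cr !inE; do 4!case: (_ \in _).
Qed.

Lemma crC e S : cr e (~: S) = cr e S.
Proof. by rewrite /cr !inE; do 2!case: (_ \in _). Qed.

Lemma sdxx (W : finType) (S : {set W}) : sd S S = set0.
Proof. by apply/setP => x; rewrite !inE addbb. Qed.

Lemma sdK (W : finType) (S T : {set W}) : sd (sd S T) T = S.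
Proof. by apply/setP => x; rewrite !inE -addbA addbb addbF. Qed.

Lemma dlD X S T : dl X (sd S T) = sd (dl X S) (dl X T).
Proof. by apply/setP => e; rewrite !inE crD; case: (e \in X). Qed.

Lemma dlC X S : dl X (~: S) = dl X S.
Proof. by apply/setP => e; rewrite !inE crC. Qed.

Lemma in_dl X S e : (e \in dl X S) = (e \in X) && cr e S.
Proof. by rewrite inE. Qed.

Lemma dl_cr X S A e : dl X S = A -> e \in X -> cr e S = (e \in A).
Proof. by move=> <- eX; rewrite inE eX. Qed.

Lemma dl_sub X S A : dl X S = A -> A \subset X.
Proof. by move=> <-; apply/subsetP => e; rewrite inE => /andP[]. Qed.

Lemma dl_crT X S A e : dl X S = A -> e \in A -> (e \in X) /\ cr e S.
Proof. by move=> <-; rewrite inE => /andP[]. Qed.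

Lemma dlI X Y S A : X \subset Y -> dl Y S = A -> dl X S = A :&: X.
Proof.
by move=> /subsetP s <-; apply/setP=> e; rewrite !inE andbC; case: (boolP (e \in X)) => [/s ->|]; rewrite ?andbT ?andbF.
Qed.

Lemma triv_cr S e : triv S -> cr e S = false.
Proof. by case/orP => /eqP ->; rewrite /cr !inE. Qed.

Lemma badP X S : reflect
  ((forall a b, a \in X -> b \in X -> cr a S -> cr b S -> a = b) /\
   (forall a, a \in X -> cr a S -> a \notin sf)) (bad X S).
Proof.
apply: (iffP andP) => [[/card_le1_eqP c1 /subsetP us]|[u1 us]]; split.
- by move=> a b aX bX ca cb; apply: c1; rewrite inE ?aX ?bX.
- by move=> a aX ca; have := us a; rewrite !inE aX ca; apply.
- apply/card_le1_eqP => a b; rewrite !inE => /andP[aX ca] /andP[bX cb].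
  exact: u1.
- by apply/subsetP => a; rewrite !inE => /andP[aX ca]; apply: us.
Qed.

Lemma bad0 X S : dl X S = set0 -> bad X S.
Proof. by rewrite /bad => ->; rewrite cards0 sub0set. Qed.

Lemma bad1 X S g : dl X S = [set g] -> g \notin sf -> bad X S.
Proof. by rewrite /bad => -> gs; rewrite cards1 sub1set inE gs. Qed.

Lemma badE X S : bad X S ->
  dl X S = set0 \/ exists2 g, g \notin sf & dl X S = [set g].
Proof.
case/andP; rewrite leq_eqVlt ltnS leqn0 cards_eq0 => /orP[/cards1P[g ->]|/eqP]; last by left.
by rewrite sub1set inE => ?; right; exists g.
Qed.

Lemma bad_sub X Y S : X \subset Y -> bad Y S -> bad X S.
Proof.
move=> /subsetP s /badP[u us]; apply/badP; split.
  by move=> a b /s aX /s bX; apply: u.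
by move=> a /s; apply: us.
Qed.

Lemma feasP X : reflect (forall S, bad X S -> triv S) (feas X).
Proof. by apply: (iffP forallP) => h S; apply/implyP/h. Qed.

Lemma feas_cr X S e : feas X -> bad X S -> cr e S = false.
Proof. by move=> /feasP h /h /triv_cr. Qed.

Lemma feas_sub X Y : X \subset Y -> feas X -> feas Y.
Proof. by move=> s /feasP h; apply/feasP => S /(bad_sub s)/h. Qed.

Lemma nfeasP X : ~~ feas X -> exists2 S, bad X S & ~~ triv S.
Proof.
by rewrite negb_forall => /existsP[S]; rewrite negb_imply => /andP[]; exists S.
Qed.

(** The symmetric difference of the two sets is crossed by no edge of [X], hence is trivial and
    crossed by no edge at all: in a feasible set the edges of a cut determine it up to
    complement. *)
Lemma feas_dl_inj X S T : feas X -> dl X S = dl X T -> forall h, cr h S = cr h T.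
Proof.
move=> fX eq h; have d : dl X (sd S T) = set0 by rewrite dlD eq sdxx.
by have := feas_cr h fX (bad0 d); rewrite crD; do 2!case: (cr h _).
Qed.

Lemma feas_dl_triv X S : feas X -> dl X S = set0 -> triv S.
Proof. by move=> /feasP h d0; apply/h/bad0. Qed.

(** A cut that is bad only after the deletion of [e] is crossed by [e] and by at most one further
    edge, which is unsafe; if there is none, [e] must be safe. *)
Lemma critical_cut X e : feas X -> ~~ feas (X :\ e) -> exists2 S, ~~ triv S &
  (dl X S = [set e] /\ e \in sf) \/
  (exists g, [/\ g != e, g \notin sf & dl X S = [set e; g]]).
Proof.
move=> fX /nfeasP[S bS ntS]; exists S => //.
have nb : ~~ bad X S by apply/negP => /(feasP _ fX); apply/negP.
have eX : (e \in X) && cr e S.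
  apply: contraR nb; rewrite negb_and => nb; rewrite (_ : bad X S = bad (X :\ e) S) //.
  rewrite /bad; have -> // : dl X S = dl (X :\ e) S.
  by apply/setP => z; rewrite !inE; case: eqP => [->|//]; case/orP: nb => /negbTE -> /=; rewrite ?andbF.
have Ed : dl X S = e |: dl (X :\ e) S.
  by apply/setP => z; rewrite !inE; case: eqP => [->|//]; rewrite eX.
case: (badE bS) => [d0|[g gs d1]].
  left; move: Ed; rewrite d0 setU0 => Ed; split => //.
  by apply: contraR nb => es; apply: bad1 Ed es.
right; exists g; split => //; last by rewrite Ed d1.
by have := dl_sub d1; rewrite sub1set !inE => /andP[].
Qed.

Definition bridge X e : bool := [exists S, dl X S == [set e]].
Definition nbridges X : nat := #|[set e | bridge X e]|.

Lemma bridgeP X e : reflect (exists S, dl X S = [set e]) (bridge X e).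
Proof. by apply: (iffP existsP) => -[S] /eqP; exists S => //; apply/eqP. Qed.

Lemma bridge_in X e : bridge X e -> e \in X.
Proof. by case/bridgeP => S /dl_sub; rewrite sub1set. Qed.

Lemma nbridges_le X : nbridges X <= #|X|.
Proof. by apply/subset_leq_card/subsetP => e; rewrite inE => /bridge_in. Qed.

(** The lexicographic order on the numbers of edges and of bridges in a single number, as there are
    at most [#|E|] bridges. *)
Definition mu X : nat := #|X| * #|E|.+1 + nbridges X.

Lemma mu_le X Y : mu X <= mu Y -> #|X| <= #|Y| /\ (#|X| = #|Y| -> nbridges X <= nbridges Y).
Proof.
rewrite /mu => h; split; last by move=> eq; move: h; rewrite eq leq_add2l.
have b1 := nbridges_le Y; have b2 : #|Y| <= #|E| by exact: max_card.
by case: (leqP #|X| #|Y|) => // lt; have := leq_mul lt (leqnn #|E|.+1); lia.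
Qed.

(** * Closed vertex sets, edges joining components, parallel edges *)

Definition closed X S := dl X S == set0.
Fact cross_key : unit. Proof. exact: tt. Qed.
(** Closed sets are the unions of components of [X], so these are the edges joining different
    components. The lock keeps [inE] from unfolding the definition. *)
Definition cross X : {set E} :=
  locked_with cross_key [set f | [exists S, closed X S && cr f S]].
(** Being parallel once the components of [X] are contracted; the edges inside components form one
    further class. *)
Definition par X f g : bool := [forall S, closed X S ==> (cr f S == cr g S)].

Lemma crossP X f : reflect (exists2 S, dl X S = set0 & cr f S) (f \in cross X).
Proof.
rewrite /cross locked_withE inE.
apply: (iffP existsP) => [[S /andP[/eqP]]|[S d c]]; exists S => //.
by rewrite /closed d eqxx.
Qed.

Lemma parP X f g : reflect (forall S, dl X S = set0 -> cr f S = cr g S) (par X f g).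
Proof.
apply: (iffP forallP) => [h S d|h S].
  by have /implyP := h S; rewrite /closed d eqxx => /(_ isT)/eqP.
by apply/implyP => /eqP/h ->.
Qed.

Lemma par_refl X f : par X f f.
Proof. exact/parP. Qed.

Lemma par_sym X f g : par X f g = par X g f.
Proof. by apply/parP/parP => h S /h. Qed.

Lemma par_trans X : transitive (par X).
Proof. by move=> b a c /parP ab /parP bc; apply/parP => S d; rewrite ab // bc. Qed.

Lemma par_eq X f g h : par X f g -> par X f h = par X g h.
Proof.
move=> fg; apply/idP/idP; last exact: par_trans.
by apply: par_trans; rewrite par_sym.
Qed.

Lemma par_cross X f g : par X f g -> (f \in cross X) = (g \in cross X).
Proof.
by move=> /parP fg; apply/crossP/crossP => -[S d c]; exists S => //; rewrite ?fg // -fg.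
Qed.

Lemma closed_cr X S e : dl X S = set0 -> e \in X -> cr e S = false.
Proof. by move=> d /(dl_cr d) ->; rewrite inE. Qed.

Lemma crossN X e : e \in X -> e \notin cross X.
Proof. by move=> eX; apply/crossP => -[S d]; rewrite (closed_cr d eX). Qed.

Lemma dlD0 X S K : dl X K = set0 -> dl X (sd S K) = dl X S.
Proof. by move=> d; rewrite dlD d; apply/setP => z; rewrite !inE addbF. Qed.

(** The existential says that the deletion separates the ends of [e1]. The last condition forbids
    new bridges and unsafe ones, so that [safe_bridges] is inherited. *)
Definition split_ok X e1 e2 : bool :=
  let X' := X :\: [set e1; e2] in
  [&& e1 != e2, e1 \in X, e2 \in X, e1 \notin sf, e2 \notin sf,
   [exists S, (dl X' S == set0) && cr e1 S] &
   [forall e, bridge X' e ==> ((e \in sf) && bridge X e)]].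

Definition swap_opt F := forall A D, #|A| <= 20 -> #|D| <= 20 ->
  feas ((F :|: A) :\: D) -> mu F <= mu ((F :|: A) :\: D).

(** What pruning yields in a local optimum: the deletion of a nonbridge cannot be repaired by edges
    joining components. *)
Definition paired X := forall e, e \in X -> ~~ bridge X e ->
  exists S g, [/\ g \in X, g != e, g \notin sf & dl (X :|: cross X) S = [set e; g]].

Inductive reach F : {set E} -> Prop :=
| reach0 : reach F F
| reachS X e1 e2 : reach F X -> split_ok X e1 e2 -> reach F (X :\: [set e1; e2]).

Definition safe_bridges X := forall S g, dl X S = [set g] -> g \in sf.

Lemma feas_safe_bridges X : feas X -> safe_bridges X.
Proof.
move=> fX S g d; apply/negPn/negP => gs.
have [_ ] : g \in X /\ cr g S by apply: dl_crT d _; rewrite inE.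
by rewrite (feas_cr _ fX (bad1 d gs)).
Qed.

Lemma safe_bridges_closed X S : safe_bridges X -> bad X S -> dl X S = set0.
Proof. by move=> l /badE[//|[g gs /l]]; rewrite (negbTE gs). Qed.

(* What splits of a swap-optimal [F] preserve: the edges joining different
   components of [X] fall into classes of parallel edges, each class is a full
   cut of the graph, and [F] contains exactly two edges of each class. *)
Record Inv F X : Prop := MkInv {
  inv_sub : X \subset F;
  inv_safe_bridges : safe_bridges X;
  inv_unsafe : forall f, f \in cross X -> f \notin sf;
  inv_two : forall f, f \in cross X -> #|[set g in F | par X f g]| = 2;
  inv_class_cut : forall f, f \in cross X -> exists T, forall e, cr e T = par X f e;
  inv_pair : forall S f g, f \in F -> f \in cross X -> dl F S = [set f; g] -> par X f g;
  inv_diff : forall f, f \in F -> f \notin X -> f \in cross X;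
  inv_card : exists2 k, #|[set S | closed X S]| = 2 ^ k.+1 & #|F| = #|X| + k.*2
}.

(** * Splits *)

Section Invariant.

Lemma dl_sd_pair X S T a b g : dl X S = [set a; b] -> dl X T = [set a; g] ->
  b != a -> g != a -> b != g -> dl X (sd S T) = [set b; g].
Proof.
move=> dS dT *; rewrite dlD dS dT; apply/setP => z; rewrite !inE; eqcases.
Qed.

Lemma dl_sd_single X S T a b : dl X S = [set a; b] -> dl X T = [set a] ->
  b != a -> dl X (sd S T) = [set b].
Proof.
move=> dS dT *; rewrite dlD dS dT; apply/setP => z; rewrite !inE; eqcases.
Qed.

Lemma card2 A : #|A| = 2 -> exists a b, a != b /\ A = [set a; b].
Proof. by move=> /eqP/cards2P[a [b [n ->]]]; exists a, b. Qed.

Lemma bad_rest X D Z S : X :\: D \subset Z -> bad Z S ->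
  (forall z, z \in X -> z \notin D -> cr z S = false) \/
  exists g, [/\ g \in X, g \notin D, g \notin sf, cr g S &
    forall z, z \in Z -> cr z S -> z = g].
Proof.
move=> /subsetP s /badP[u us].
case: (boolP [exists z, [&& z \in X, z \notin D & cr z S]]) => [/existsP[g /and3P[gX gD cg]]|].
  have gZ : g \in Z by apply: s; rewrite !inE gX gD.
  by right; exists g; split => // [|z zZ cz]; [apply: us|apply: u].
move=> /existsPn no; left => z zX zD; apply/negbTE.
by have := no z; rewrite zX zD.
Qed.

Lemma swap_hit X D S : ~~ bad X S -> bad (X :\: D) S ->
  exists d, [/\ d \in X, d \in D & cr d S].
Proof.
move=> nb bD; suff /existsP[d /and3P[]] : [exists d, [&& d \in X, d \in D & cr d S]].
  by exists d.
apply: contraR nb => /existsPn no.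
rewrite /bad; have -> // : dl X S = dl (X :\: D) S.
apply/setP => z; rewrite !inE; case: (boolP (z \in D)) => // zD /=.
by have := no z; rewrite zD; case: (z \in X) => //= /negbTE.
Qed.

(** A cut becomes bad only if a deleted edge crosses it, and then at most one kept edge does, which
    is unsafe and alone in [Z]. The exchanges of two edges are analysed through these cases. *)
Lemma swap_pair X a b Z S : a \in X -> b \in X ->
  X :\: [set a; b] \subset Z -> bad Z S -> ~~ bad X S ->
  (cr a S || cr b S) /\
  (dl X S = [set z | cr a S && (z == a) || cr b S && (z == b)] \/
   exists g, [/\ g \in X, (g != a) && (g != b), g \notin sf,
     dl X S = [set z | [|| z == g, cr a S && (z == a) | cr b S && (z == b)]] &
     forall z, z \in Z -> cr z S -> z = g]).
Proof.
move=> aX bX s bZ nb; split.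
  have [d [_ + cd]] := swap_hit nb (bad_sub s bZ).
  by rewrite !inE => /orP[]/eqP <-; rewrite cd ?orbT.
have [no|[g [gX gD gs cg u]]] := bad_rest s bZ.
  left; apply/setP => z; rewrite !inE.
  case: (eqVneq z a) => [->|za]; rewrite ?aX ?andbT /=.
    by case: (eqVneq a b) => [<-|_]; rewrite ?andbT ?orbb ?andbF ?orbF.
  case: (eqVneq z b) => [->|zb]; rewrite ?bX ?andbT ?andbF //=.
  by apply/negP => /andP[zX]; rewrite no // !inE negb_or za zb.
right; exists g; split => //; first by move: gD; rewrite !inE negb_or.
apply/setP => z; rewrite !inE.
case: (eqVneq z a) => [->|za]; rewrite ?aX ?andbT /=.
  have -> : (a == g) = false by apply/eqP => eq; move: gD; rewrite -eq !inE eqxx.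
  by case: (eqVneq a b) => [<-|_]; rewrite ?andbT ?orbb ?andbF ?orbF.
case: (eqVneq z b) => [->|zb]; rewrite ?bX ?andbT ?andbF //=.
  by have -> : (b == g) = false by apply/eqP => eq; move: gD; rewrite -eq !inE eqxx orbT.
rewrite orbF; apply/andP/eqP => [[zX cz]|->//]; apply: u => //.
by apply: (subsetP s); rewrite !inE negb_or za zb.
Qed.

Variable F : {set E}.
Hypothesis fF : feas F.
Hypothesis optF : swap_opt F.

Lemma swap_opt_minimal e : e \in F -> ~~ feas (F :\ e).
Proof.
move=> eF; apply/negP => f1.
have := @optF set0 [set e]; rewrite cards0 cards1 setU0 => /(_ isT isT f1)/mu_le[+ _].
by rewrite [X in X <= _](cardsD1 e) eF; clear; lia.
Qed.

Lemma swap_card A D : #|A| <= 20 -> #|D| <= 20 ->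
  feas ((F :|: A) :\: D) -> #|F| <= #|(F :|: A) :\: D|.
Proof. by move=> h1 h2 h3; have [] := mu_le (optF h1 h2 h3). Qed.

(** A feasible set is connected, so no edge joins different components and the conditions on classes
    are void. The closed sets are the two trivial ones, distinct because there is a vertex. *)
Lemma Inv0 : 0 < #|V| -> Inv F F.
Proof.
move=> V0.
have nc f : f \in cross F -> False.
  by case/crossP => S /(feas_dl_triv fF)/triv_cr->.
split => //; try by move=> f /nc.
- exact: feas_safe_bridges.
- by move=> S f g _ /nc.
- by move=> f ->.
exists 0; last by rewrite addn0.
have -> : [set S | closed F S] = [set set0; setT].
  apply/setP => S; rewrite !inE; apply/eqP/idP => [/(feas_dl_triv fF)//|].
  by move=> t; apply/setP => e; rewrite !inE (triv_cr _ t) andbF.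
rewrite cards2 eq_sym; case: eqP => // eq.
by move: V0; rewrite -cardsT eq cards0.
Qed.

Section Step.

Variables (X : {set E}) (e1 e2 : E).
Hypothesis iX : Inv F X.
Hypothesis ok : split_ok X e1 e2.
Let X' := X :\: [set e1; e2].

Let e12 : e1 != e2. Proof. by case/and5P: ok. Qed.
Let e1X : e1 \in X. Proof. by case/and5P: ok. Qed.
Let e2X : e2 \in X. Proof. by case/and5P: ok. Qed.
Let e1s : e1 \notin sf. Proof. by case/and5P: ok. Qed.
Let e2s : e2 \notin sf. Proof. by case/and5P: ok => _ _ _ _ /and3P[]. Qed.
Let e1F : e1 \in F. Proof. by have /subsetP := inv_sub iX; apply. Qed.
Let e2F : e2 \in F. Proof. by have /subsetP := inv_sub iX; apply. Qed.

Let split_bridge e : bridge X' e -> e \in sf /\ bridge X e.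
Proof. by case/and5P: ok => _ _ _ _ /and3P[_ _ /forallP/(_ e)/implyP] h /h/andP[]. Qed.

Let step_lf : safe_bridges X'.
Proof. by move=> S g d; have [] := @split_bridge g; first by apply/bridgeP; exists S. Qed.

Let nXcross g e : g \in F -> g \notin X -> e \in X -> par X g e = false.
Proof.
move=> gF gX eX; apply/negP => /par_cross; rewrite (inv_diff iX) // => /esym.
by apply/negP/crossN.
Qed.

Let pairX S e f g : (e, f) = (e1, e2) \/ (e, f) = (e2, e1) -> g != e ->
  dl X S = [set e; g] -> g = f.
Proof.
move=> ef ge d; apply/eqP/negPn/negP => gf.
have es : e \notin sf by case: ef => -[-> _].
have [/subsetP sX] := dl_sub d; have gX : g \in X by apply: sX; rewrite !inE eqxx orbT.
have d' : dl X' S = [set g].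
  rewrite (dlI _ d) ?subsetDl //; apply/setP => z; rewrite !inE.
  by case: ef => -[? ?]; subst e f; eqcases; rewrite gX.
have [_ /bridgeP[S' dS']] := split_bridge (introT (bridgeP _ _) (ex_intro _ S d')).
have := inv_safe_bridges iX (S := sd S S') (g := e); rewrite (negbTE es) => h.
suff : false by []; apply/h/(@dl_sd_single _ _ _ g) => //; last by rewrite eq_sym.
by rewrite setUC.
Qed.

Let pairF S e f g : (e, f) = (e1, e2) \/ (e, f) = (e2, e1) -> g != e ->
  dl F S = [set e; g] -> g = f.
Proof.
move=> ef ge d.
have eX : e \in X by case: ef => -[-> _].
have gF : g \in F by have := dl_sub d; rewrite subUset !sub1set => /andP[].
have gX : g \in X.
  apply/negPn/negP => gX; have := nXcross gF gX eX.
  by rewrite (inv_pair iX gF (inv_diff iX gF gX) (S := S)) // setUC.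
apply: (pairX (S := S) ef ge); rewrite (dlI (inv_sub iX) d).
by apply/setP => z; rewrite !inE; eqcases; rewrite ?eX ?gX.
Qed.

(** The split pair is a cut of [F] and not only of [X]: by minimality of [F] the unsafe edge [e1]
    has a partner in a cut of [F], and [pairF] identifies it. *)
Let split_cut : exists T, dl F T = [set e1; e2].
Proof.
have [S _ [[_ ]|[g [ge _ d]]]] := critical_cut fF (swap_opt_minimal e1F); first by rewrite (negbTE e1s).
by exists S; rewrite d (pairF (or_introl erefl) ge d).
Qed.

Section WithT.
Variable T : {set V}.
Hypothesis dT : dl F T = [set e1; e2].

Let dXT : dl X T = [set e1; e2].
Proof.
rewrite (dlI (inv_sub iX) dT); apply/setP => z; rewrite !inE; eqcases;
  by rewrite ?e1X ?e2X.
Qed.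

Let sameT S : dl F S = [set e1; e2] -> forall h, cr h S = cr h T.
Proof. by move=> d; apply: (feas_dl_inj fF); rewrite d dT. Qed.

Let no_triple_cut S g : g \notin sf -> g != e1 -> g != e2 ->
  dl F S = [set e1; e2; g] -> False.
Proof.
move=> gs g1 g2 d; have := feas_safe_bridges fF (S := sd S T) (g := g).
rewrite (negbTE gs) => h; suff : false by []; apply: h.
by rewrite dlD d dT; apply/setP => z; rewrite !inE; eqcases.
Qed.

Lemma exchange_nfeas h a b : a \in F -> b \in F -> a != b -> h \notin F ->
  ~~ feas (h |: F :\: [set a; b]).
Proof.
move=> aF bF ab hF; apply/negP => fZ.
have eqZ : (h |: F :\: [set a; b]) = (F :|: [set h]) :\: [set a; b].
  apply/setP => z; rewrite !inE; case: (eqVneq z h) => [->|_] /=; last by rewrite orbF.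
  by rewrite orbT andbT; apply/esym/negP => /orP[]/eqP eq; move: hF; rewrite eq ?aF ?bF.
rewrite eqZ in fZ; have := swap_card _ _ fZ; rewrite cards1 cards2 ab => /(_ isT isT).
rewrite -eqZ cardsU1 !inE (negbTE hF) andbF /=.
have -> : F :\: [set a; b] = F :\ a :\ b by apply/setP => z; rewrite !inE; eqcases.
by rewrite (cardsD1 a F) (cardsD1 b (F :\ a)) aF !inE eq_sym ab bF /=; clear; lia.
Qed.

Lemma crossT_F h : cr h T -> h \in F -> h = e1 \/ h = e2.
Proof.
by move=> ch hF; have := dl_cr dT hF; rewrite ch !inE => /esym/orP[]/eqP; [left|right].
Qed.

(* Otherwise exchanging [e1] and an edge of [F] parallel to [h] for [h] would
   keep [F] feasible and make it smaller. *)
Lemma crossT_nocross h : h \in cross X -> cr h T = false.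
Proof.
move=> hc; apply/negP => hT.
have hF : h \notin F.
  by apply/negP => /(crossT_F hT)[] he; move: hc; rewrite he; apply/negP/crossN.
have [g1 [g2 [g12 Fh]]] := card2 (inv_two iX hc).
have mem g : (g \in F) && par X h g = (g == g1) || (g == g2).
  by have := congr1 (fun A => g \in A) Fh; rewrite !inE.
have /andP[g1F hg1] : (g1 \in F) && par X h g1 by rewrite mem eqxx.
have g1c : g1 \in cross X by rewrite -(par_cross hg1).
have g1X : g1 \notin X by apply/negP => /(@crossN); rewrite g1c.
have g1s := inv_unsafe iX g1c.
have e1g : e1 != g1 by apply/eqP => eq; move: g1X; rewrite -eq e1X.
apply: (negP (exchange_nfeas e1F g1F e1g hF)).
apply/feasP => S bS; apply/negPn/negP => nt.
have nb : ~~ bad F S by apply: contra nt; apply: (feasP _ fF).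
have hZ : h \in h |: F :\: [set e1; g1] by rewrite !inE eqxx.
have hz z : z \in F -> h != z by move=> zF; apply: contraNneq hF => ->.
have e1n : par X g1 e1 = false by apply: nXcross.
have [+ H] := swap_pair e1F g1F (subsetUr _ _) bS nb.
case ce : (cr e1 S) H; case cg : (cr g1 S) => H // _.
(* If [e1] and [g1] both cross, a third edge has to be [e2]; adding [T] then leaves the unsafe edge
   [g1] alone in a cut of [F]. *)
- case: H => [d|[g [gF /andP[ge gg] gs d u]]].
    have {}d : dl F S = [set g1; e1] by rewrite d; apply/setP => z; rewrite !inE orbC.
    by have := inv_pair iX g1F g1c d; rewrite e1n.
  have {}d : dl F S = [set e1; g; g1].
    by rewrite d; apply/setP => z; rewrite !inE /= orbA [(z == e1) || _]orbC.
  have dX := dlI (inv_sub iX) d.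
  have gX : g \in X.
    apply/negPn/negP => gX; move/negP: e1s; apply; apply: (inv_safe_bridges iX (S := S)).
    rewrite dX; apply/setP => z; rewrite !inE; eqcases; by rewrite ?(negbTE gX) ?(negbTE g1X).
  have g2' : g = e2.
    apply: (pairX (S := S) (or_introl erefl)) => //; rewrite dX.
    by apply/setP => z; rewrite !inE; eqcases; rewrite ?gX ?e1X ?(negbTE g1X).
  apply: (@no_triple_cut S g1) => //; rewrite -?g2' ?d //; first by rewrite eq_sym.
  by rewrite eq_sym.
- case: H => [d|[g [gF /andP[ge gg] gs d u]]].
    move/negP: nb; apply; apply: (bad1 _ e1s); rewrite d.
    by apply/setP => z; rewrite !inE orbF.
  have {}d : dl F S = [set e1; g].
    by rewrite d; apply/setP => z; rewrite !inE /= orbF orbC.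
  have g2' := pairF (or_introl erefl) ge d.
  have := hz _ gF; rewrite (u h) ?eqxx //.
  by rewrite (@sameT S) // d g2'.
(* If only [g1] crosses, the second edge is the other member of the class in [F]; so this is the cut
   formed by the class, and [h] crosses it. *)
- case: H => [d|[g [gF /andP[ge gg] gs d u]]].
    move/negP: nb; apply; apply: (bad1 _ g1s); rewrite d.
    by apply/setP => z; rewrite !inE.
  have {}d : dl F S = [set g1; g].
    by rewrite d; apply/setP => z; rewrite !inE /= orbC.
  have pg := inv_pair iX g1F g1c d.
  have gg2 : g = g2.
    have : (g \in F) && par X h g by rewrite gF (par_eq _ hg1).
    by rewrite mem (negbTE gg) => /eqP.
  have [Th HTh] := inv_class_cut iX hc.
  have dTh : dl F Th = [set g1; g].
    by apply/setP => z; rewrite !inE HTh mem gg2.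
  have := hz _ gF; rewrite (u h) ?eqxx //.
  by rewrite (@feas_dl_inj _ S Th fF) ?d ?dTh // HTh par_refl.
Qed.

(** Exchanging the pair for a safe edge across [T] would keep [F] feasible: the only cut that could
    become bad is [T], up to complement, and the safe edge crosses it. *)
Lemma crossT_unsafe h : cr h T -> h \notin sf.
Proof.
move=> hT; apply/negP => hs.
have hF : h \notin F.
  by apply/negP => /(crossT_F hT)[] he; move: hs; rewrite he; apply/negP.
apply: (negP (exchange_nfeas e1F e2F e12 hF)).
apply/feasP => S bS; apply/negPn/negP => nt.
have nb : ~~ bad F S by apply: contra nt; apply: (feasP _ fF).
have hZ : h \in h |: F :\: [set e1; e2] by rewrite !inE eqxx.
have nh : cr h S = false.
  by apply/negP => ch; have [_ us] := badP _ _ bS; have := us _ hZ ch; rewrite hs.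
have nT : dl F S <> [set e1; e2] by move=> d; move: nh; rewrite (sameT d) hT.
have [+ H] := swap_pair e1F e2F (subsetUr _ _) bS nb.
case ce : (cr e1 S) H; case cg : (cr e2 S) => H // _.
- case: H => [d|[g [gF /andP[ge gg] gs d u]]].
    by apply: nT; rewrite d; apply/setP => z; rewrite !inE.
  apply: (@no_triple_cut S g) => //.
  by rewrite d; apply/setP => z; rewrite !inE /= orbC.
- case: H => [d|[g [gF /andP[ge gg] gs d u]]].
    move/negP: nb; apply; apply: (bad1 _ e1s); rewrite d.
    by apply/setP => z; rewrite !inE orbF.
  have {}d : dl F S = [set e1; g].
    by rewrite d; apply/setP => z; rewrite !inE /= orbF orbC.
  by move: gg; rewrite (pairF (or_introl erefl) ge d) eqxx.
- case: H => [d|[g [gF /andP[ge gg] gs d u]]].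
    move/negP: nb; apply; apply: (bad1 _ e2s); rewrite d.
    by apply/setP => z; rewrite !inE.
  have {}d : dl F S = [set e2; g].
    by rewrite d; apply/setP => z; rewrite !inE /= orbC.
  by move: ge; rewrite (pairF (or_intror erefl) gg d) eqxx.
Qed.

(** If both deleted edges cross [S], adding [T] removes them; if only one did, it would be an unsafe
    bridge of [X]. *)
Lemma closed_step S : dl X' S = set0 <-> dl X S = set0 \/ dl X (sd S T) = set0.
Proof.
split => [d|].
  case: (boolP (cr e1 S)) => c1; case: (boolP (cr e2 S)) => c2.
  - right; rewrite dlD dXT; apply/setP => z; rewrite !inE.
    have := congr1 (fun A : {set E} => z \in A) d; rewrite !inE.
    case: (eqVneq z e1) => [->|_] /=; first by rewrite c1 e1X.
    case: (eqVneq z e2) => [->|_] /=; first by rewrite c2 e2X.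
    by move=> ->.
  - have := inv_safe_bridges iX (S := S) (g := e1); rewrite (negbTE e1s) => hh.
    suff : false by []; apply: hh; apply/setP => z; rewrite !inE.
    have := congr1 (fun A : {set E} => z \in A) d; rewrite !inE.
    case: (eqVneq z e1) => [->|_] /=; first by rewrite c1 e1X.
    case: (eqVneq z e2) => [->|_] /=; first by rewrite (negbTE c2) andbF.
    by move=> ->.
  - have := inv_safe_bridges iX (S := S) (g := e2); rewrite (negbTE e2s) => hh.
    suff : false by []; apply: hh; apply/setP => z; rewrite !inE.
    have := congr1 (fun A : {set E} => z \in A) d; rewrite !inE.
    case: (eqVneq z e2) => [->|_] /=; first by rewrite c2 e2X.
    case: (eqVneq z e1) => [->|_] /=; first by rewrite (negbTE c1) andbF.
    by move=> ->.
  - left; apply/setP => z; rewrite !inE.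
    have := congr1 (fun A : {set E} => z \in A) d; rewrite !inE.
    case: (eqVneq z e1) => [->|_] /=; first by rewrite (negbTE c1) andbF.
    case: (eqVneq z e2) => [->|_] /=; first by rewrite (negbTE c2) andbF.
    by move=> ->.
case=> d; first by rewrite (dlI (subsetDl _ _) d) set0I.
rewrite -(sdK S T) (dlI (subsetDl X _) (_ : _ = [set e1; e2])).
  by apply/setP => z; rewrite !inE; case: (z == e1) => //; case: (z == e2).
by rewrite dlD d dXT; apply/setP => z; rewrite !inE.
Qed.

Lemma cross_step f : (f \in cross X') = (f \in cross X) || cr f T.
Proof.
apply/crossP/orP => [[S /closed_step[d c|d c]]|[/crossP[S d c]|c]].
- by left; apply/crossP; exists S.
- case: (boolP (cr f T)) => cT; [by right|left]; apply/crossP; exists (sd S T) => //.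
  by rewrite crD c (negbTE cT).
- by exists S => //; apply/closed_step; left.
- by exists T => //; apply/closed_step; right; rewrite sdxx; apply/setP => z; rewrite !inE /cr !inE andbF.
Qed.

Lemma par_step f g : par X' f g = par X f g && (cr f T == cr g T).
Proof.
apply/parP/andP => [h|[/parP h /eqP hT] S /closed_step[/h //|/h]].
  split; last first.
    by apply/eqP/h/closed_step; right; rewrite sdxx; apply/setP => z; rewrite !inE /cr !inE andbF.
  by apply/parP => S d; apply: h; apply/closed_step; left.
by rewrite !crD hT; do 3!case: (cr _ _).
Qed.

(** No member of an old class crosses [T], so a split leaves the old classes as they are and creates
    one new class, the edges crossing [T]. *)
Lemma par_old f g : f \in cross X -> par X' f g = par X f g.
Proof.
move=> fc; rewrite par_step; case: (boolP (par X f g)) => //= pf.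
by rewrite (crossT_nocross fc) crossT_nocross // -(par_cross pf).
Qed.

Lemma par_new f g : cr f T -> par X' f g = cr g T.
Proof.
move=> fT; rewrite par_step fT; case: (boolP (cr g T)) => gT; rewrite ?andbF ?andbT //=.
have nc h S : cr h T -> dl X S = set0 -> cr h S = false.
  move=> hT d; apply/negP => ch; suff : cr h T = false by rewrite hT.
  by apply: crossT_nocross; apply/crossP; exists S.
by apply/parP => S d; rewrite (nc f S) // (nc g S).
Qed.

Lemma Inv_step_T : Inv F X'.
Proof.
split.
- exact: subset_trans (subsetDl _ _) (inv_sub iX).
- exact: step_lf.
- by move=> f; rewrite cross_step => /orP[/(inv_unsafe iX)|/crossT_unsafe].
- move=> f; rewrite cross_step => /orP[fc|fT].
    rewrite -(inv_two iX fc); apply: eq_card => z.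
    by rewrite !inE par_old.
  suff -> : [set g in F | par X' f g] = [set e1; e2] by rewrite cards2 e12.
  by rewrite -dT; apply/setP => z; rewrite !inE par_new.
- move=> f; rewrite cross_step => /orP[fc|fT].
    by have [T' hT'] := inv_class_cut iX fc; exists T' => e; rewrite par_old.
  by exists T => e; rewrite par_new.
- move=> S f g fF'; rewrite cross_step => /orP[fc|fT] d.
    by rewrite par_old //; exact: (inv_pair iX fF' fc d).
  rewrite par_new //.
  have T1 : cr e1 T by rewrite (dl_cr dT e1F) !inE eqxx.
  have T2 : cr e2 T by rewrite (dl_cr dT e2F) !inE eqxx orbT.
  case: (eqVneq g f) => [->//|gf].
  have [fe|fe] := crossT_F fT fF'; subst f.
    by rewrite (pairF (or_introl erefl) gf d).
  by rewrite (pairF (or_intror erefl) gf d).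
- move=> f fF'; rewrite !inE negb_and negbK => /orP[/orP[]/eqP ->|fX].
  + by rewrite cross_step (dl_cr dT e1F) !inE eqxx orbT.
  + by rewrite cross_step (dl_cr dT e2F) !inE eqxx !orbT.
  + by rewrite cross_step (inv_diff iX).
(* The exponent is the number of components. The closed sets double: those of [X] and, disjoint from
   them, their sums with [T]. *)
have [k ck cF] := inv_card iX; exists k.+1; last first.
  rewrite cF (cardsD1 e1 X) (cardsD1 e2 (X :\ e1)) e1X !inE eq_sym e12 e2X /=.
  suff -> : X' = X :\ e1 :\ e2 by clear; lia.
  by apply/setP => z; rewrite !inE negb_or; case: (z == e1) => //=; rewrite andbF.
have -> : [set S | closed X' S] = [set S | closed X S] :|: [set sd S T | S in [set S | closed X S]].
  apply/setP => S; rewrite in_setU !inE /closed; apply/eqP/orP => [/closed_step[d|d]|[/eqP d|/imsetP[S' + ->]]].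
  - by left; rewrite d.
  - by right; apply/imsetP; exists (sd S T); rewrite ?sdK // inE /closed d.
  - by apply/closed_step; left.
  - by rewrite inE => /eqP d; apply/closed_step; right; rewrite sdK.
rewrite cardsU card_imset; last by move=> S S' /(congr1 (fun x => sd x T)); rewrite !sdK.
rewrite ck (_ : _ :&: _ = set0) ?cards0 ?subn0; first by rewrite addnn -mul2n -expnS.
apply/setP => S; rewrite in_setI [in RHS]inE; apply/negP => /andP[].
rewrite inE => /eqP d /imsetP[S']; rewrite inE => /eqP d' eqS.
have := d; rewrite eqS dlD d' dXT => /(congr1 (fun A : {set E} => e1 \in A)).
by rewrite !inE eqxx.
Qed.

End WithT.

Lemma Inv_step : Inv F X'.
Proof. by have [T dT] := split_cut; apply: Inv_step_T dT. Qed.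

End Step.

Lemma reach_Inv X : 0 < #|V| -> reach F X -> Inv F X.
Proof. by move=> V0; elim=> [|Y e1 e2 _ iY ok]; [apply: Inv0|apply: Inv_step]. Qed.

End Invariant.

(** * Pruning *)

Section Prune.

Variables (F X : {set E}).
Hypothesis fF : feas F.
Hypothesis optF : swap_opt F.
Hypothesis iX : Inv F X.

Lemma nbad_card_gt1 Y S : ~~ bad Y S -> (forall z, z \in dl Y S -> z \notin sf) -> 1 < #|dl Y S|.
Proof.
move=> nb us; rewrite ltnNge; apply: contra nb => c; rewrite /bad c.
by apply/subsetP => z /us; rewrite inE.
Qed.

(** The bridges of [X] being safe, a bad cut of [Y] is crossed by no edge of [X]. Some edge of [F]
    crosses it unless it is trivial, and then its whole class does, including two edges of [Y]. *)
Lemma feas_par Y : X \subset Y ->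
  (forall f, f \in F -> f \in cross X -> 1 < #|[set g in Y | par X f g]|) -> feas Y.
Proof.
move=> sXY two; apply/feasP => S bS; apply/negPn/negP => nt.
have d0 := safe_bridges_closed (inv_safe_bridges iX) (bad_sub sXY bS).
have [f fF' cf] : exists2 f, f \in F & cr f S.
  apply/exists_inP; apply: contraR nt => /exists_inPn no.
  apply: (feas_dl_triv fF); apply/setP => z; rewrite !inE.
  by apply/negP => /andP[/no/negbTE->].
have fc : f \in cross X by apply/crossP; exists S.
have /card_gt1P[a [b []]] := two _ fF' fc.
rewrite !inE => /andP[aY /parP fa] /andP[bY /parP fb] /eqP[]; have [u _] := badP _ _ bS.
by apply: u => //; rewrite -?fa -?fb.
Qed.

(** * A minimal repair uses at most two edges of each class *)

Section Class.

Variables (e : E) (Y : {set E}).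
Hypothesis eX : e \in X.
Hypothesis nbr : ~~ bridge X e.
Hypothesis XY : X :\ e \subset Y.
Hypothesis fY : feas Y.
Hypothesis critY : forall f, f \in Y -> f \in cross X -> ~~ feas (Y :\ f).
Variable f : E.
Hypothesis fc : f \in cross X.

Let XeY z : z \in X -> z \in e |: Y.
Proof.
move=> zX; rewrite !inE; case: (eqVneq z e) => //= ze.
by apply: (subsetP XY); rewrite !inE ze.
Qed.

(** One of the two sides of the cut formed by the class of [f]. *)
Let side U := forall z, cr z U = par X f z.
Definition ins A U : {set E} := [set z in A | ((en z).1 \in U) && ((en z).2 \in U)].

Let side_X U z : side U -> z \in X -> cr z U = false.
Proof.
move=> sU zX; rewrite sU; apply/negP => /par_cross; rewrite fc => /esym.
exact/negP/crossN.
Qed.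

Let ins_cr U R z A : R \subset U -> z \in A -> cr z R -> cr z U = false -> z \in ins A U.
Proof.
move=> /subsetP s zA; rewrite inE zA /cr /=.
case h1: (_ \in R); case h2: (_ \in R) => // _; first by rewrite (s _ h1) /= => /negbFE ->.
by rewrite (s _ h2) addbT => /negbFE ->.
Qed.

Let insN U z A : z \in ins A U -> cr z U = false.
Proof. by rewrite inE /cr => /andP[_ /andP[-> ->]]. Qed.

Let nbad_side_core U R : side U -> R \subset U -> R != set0 -> R != U ->
  dl X R = set0 -> cr f R = false -> bad (ins Y U) R -> False.
Proof.
move=> sU sR R0 RU d cf bR.
have : triv R.
  apply: (feasP _ fY); apply: contraTT bR => nb; apply: contra nb.
  move=> /badP[u us]; apply/badP.
  have h z : z \in Y -> cr z R -> z \in ins Y U.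
    move=> zY cz; apply: (ins_cr sR zY cz); rewrite sU; apply/negP => /parP/(_ R d).
    by rewrite cf cz.
  split=> [a b aY bY ca cb|a aY ca]; first by apply: u => //; apply: h.
  by apply: us => //; apply: h.
case/orP => [/eqP eq|/eqP eq]; first by rewrite eq eqxx in R0.
by move: sR RU; rewrite eq subTset => /eqP ->; rewrite eqxx.
Qed.

(** Each side is feasible by itself. A bad part [R] would be crossed by no edge of [X], hence by the
    whole class of [f] or by none of it; in the former case [U :\: R] is not crossed by the class.
    Either way [Y] would have a bad cut. *)
Lemma nbad_side U R : side U -> R \subset U -> R != set0 -> R != U ->
  ~~ bad (ins (e |: Y) U) R.
Proof.
move=> sU sR R0 RU; apply/negP => bR.
have d : dl X R = set0.
  apply: (safe_bridges_closed (inv_safe_bridges iX)); have [u us] := badP _ _ bR; apply/badP.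
  have h z : z \in X -> cr z R -> z \in ins (e |: Y) U.
    by move=> zX cz; apply: ins_cr sR (XeY zX) cz _; apply: side_X.
  split=> [a b aY bY ca cb|a aY ca]; first by apply: u => //; apply: h.
  by apply: us => //; apply: h.
have bY : bad (ins Y U) R.
  by apply: bad_sub bR; apply/subsetP => z; rewrite !inE => /andP[-> ->]; rewrite orbT.
case cf : (cr f R); last exact: (nbad_side_core sU sR R0 RU d cf bY).
have RD : U :\: R = sd U R.
  by apply/setP => z; rewrite !inE; case: (boolP (z \in R)) => [/(subsetP sR) ->|_] //=; rewrite addbF.
have dU : dl X U = set0.
  by apply/setP => z; rewrite !inE; apply/negP => /andP[/(side_X sU)->].
apply: (@nbad_side_core U (U :\: R)) => //.
- exact: subsetDl.
- by rewrite setD_eq0; apply: contra RU => s; rewrite eqEsubset sR.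
- apply: contra R0 => /eqP/setP eq; apply/eqP/setP => z; have := eq z; rewrite !inE.
  by case: (boolP (z \in R)) => // /(subsetP sR) ->.
- by rewrite RD dlD dU d sdxx.
- by rewrite RD crD cf sU par_refl.
apply: contraTT bY => nb; apply: contra nb => /badP[u us]; apply/badP.
split=> [a b aY bY ca cb|a aY ca].
  move: ca cb; rewrite RD !crD (insN aY) (insN bY); exact: u.
by move: ca; rewrite RD crD (insN aY); exact: us.
Qed.

Variable U : {set V}.
Hypothesis sU : side U.
Hypothesis e1U : (en e).1 \notin U.
Hypothesis e2U : (en e).2 \notin U.
Let W := ~: U.
Let sW : side W. Proof. by move=> z; rewrite crC. Qed.

(** If no edge of [Y] inside [W] left [R], the only edge of [X] across [R] could be [e]; so [e]
    would be a bridge of [X], or [R] bad in [W]. *)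
Lemma side_connected R : R \subset W -> R != set0 -> R != W -> exists2 z, z \in ins Y W & cr z R.
Proof.
move=> sR R0 RW; apply/exists_inP; rewrite -[X in is_true X]negbK.
apply/negP => /exists_inPn no; move/negP: (nbad_side sW sR R0 RW); apply.
have h z : z \in X -> cr z R -> z = e.
  move=> zX cz; have := ins_cr sR (XeY zX) cz (side_X sW zX).
  rewrite !inE => /andP[/orP[/eqP//|zY] i].
  by have := no z; rewrite !inE zY i cz => /(_ isT).
case ce : (cr e R).
  case/negP: nbr; apply/bridgeP; exists R; apply/setP => z; rewrite !inE.
  by apply/andP/eqP => [[]|->]; [exact: h|].
apply: bad0; apply/setP => z; rewrite in_dl [RHS]inE; apply/negP => /andP[].
rewrite !inE => /andP[/orP[/eqP ->|zY] i cz]; first by rewrite ce in cz.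
by have := no z; rewrite !inE zY i cz => /(_ isT).
Qed.

(** The cut that prevents the deletion of [h] from [Y], taken on the side containing [U]. *)
Let tight h S g := [/\ g != h, g \notin sf, dl Y S = [set h; g] & U \subset S].

(** A critical cut of [h] cannot divide [U]: as [h] crosses [U] and [e] lies outside it, at most the
    unsafe partner of [h] would cross inside [U]. *)
Lemma tight_ex h : h \in Y -> par X f h -> exists S g, tight h S g.
Proof.
move=> hY ph; have hc : h \in cross X by rewrite -(par_cross ph).
have [S nt [[_ hs]|[g [gh gs d]]]] := critical_cut fY (critY hY hc).
  by move: (inv_unsafe iX hc); rewrite hs.
have hU : cr h U by rewrite sU.
suff [E0|EU] : S :&: U = set0 \/ S :&: U = U.
- exists (~: S), g; split => //; first by rewrite dlC.
  by rewrite -disjoints_subset disjoint_sym -setI_eq0 E0.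
- by exists S, g; split => //; apply/setIidPr.
case: (eqVneq (S :&: U) set0) => [|n0]; [by left|right]; apply/eqP/negPn/negP => nU.
move/negP: (nbad_side sU (subsetIr S U) n0 nU); apply.
have h' z : z \in ins (e |: Y) U -> cr z (S :&: U) -> z = g.
  move=> zi cz; have nz := insN zi; move: zi cz; rewrite !inE => /andP[zY /andP[i1 i2]].
  rewrite /cr !inE i1 i2 !andbT -/(cr z S) => cz.
  case/orP: zY => [/eqP ze|zY]; first by move: e1U; rewrite -ze i1.
  have := dl_cr d zY; rewrite cz !inE => /esym/orP[/eqP zh|/eqP//].
  by rewrite zh hU in nz.
apply/badP; split => [a b ai bi ca cb|a ai ca]; last by rewrite (h' _ ai ca).
by rewrite (h' _ ai ca) (h' _ bi cb).
Qed.

Lemma dl_submod A S T : #|dl A (S :&: T)| + #|dl A (S :|: T)| <= #|dl A S| + #|dl A T|.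
Proof.
have h R : #|dl A R| = \sum_(z in A) cr z R.
  by rewrite -sum1_card big_mkcond [RHS]big_mkcond; apply: eq_bigr => z _; rewrite !inE; case: (z \in A); case: cr.
rewrite !h -!big_split; apply: leq_sum => z _; rewrite /cr !inE.
by do 4!case: (_ \in _).
Qed.

Let crI h S T : cr h U -> U \subset S -> U \subset T -> cr h S -> cr h (S :&: T).
Proof.
move=> + /subsetP s /subsetP t; rewrite /cr !inE.
case h1: (_ \in U); case h2: (_ \in U) => // _; rewrite ?(s _ h1) ?(t _ h1) ?(s _ h2) ?(t _ h2) /=.
  by case: (_ \in S).
by case: (_ \in S).
Qed.

(** Otherwise intersection and union are nontrivial cuts of unsafe edges, with at least two edges
    each; by submodularity only [f1] and [f2] cross the intersection. As [f3] does not, the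
    intersection reaches beyond [U], but no edge of [Y] within [W] leaves that part. *)
Lemma tight_pair f1 f2 f3 S1 S2 g1 g2 :
  [/\ f1 \in Y, f2 \in Y & f3 \in Y] -> [/\ par X f f1, par X f f2 & par X f f3] ->
  [/\ f1 != f2, f2 != f3 & f3 != f1] ->
  tight f1 S1 g1 -> tight f2 S2 g2 -> S1 :|: S2 = setT.
Proof.
move=> [Y1 Y2 Y3] [p1 p2 p3] [n12 n23 n31] [n1 s1 d1 U1] [n2 s2 d2 U2].
apply/eqP/negPn/negP => nT.
have us1 z : z \in dl Y S1 -> z \notin sf.
  rewrite d1 !inE => /orP[]/eqP-> //; apply: (inv_unsafe iX); by rewrite -(par_cross p1).
have us2 z : z \in dl Y S2 -> z \notin sf.
  rewrite d2 !inE => /orP[]/eqP-> //; apply: (inv_unsafe iX); by rewrite -(par_cross p2).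
have c1 : cr f1 S1 by have [] := dl_crT d1 (set21 _ _).
have c2 : cr f2 S2 by have [] := dl_crT d2 (set21 _ _).
have ci1 : cr f1 (S1 :&: S2) by apply: crI => //; rewrite sU.
have ci2 : cr f2 (S1 :&: S2) by rewrite setIC; apply: crI => //; rewrite sU.
have ntI : ~~ triv (S1 :&: S2) by apply: contraTN ci1 => /triv_cr ->.
have ntU : ~~ triv (S1 :|: S2).
  rewrite /triv negb_or nT andbT setU_eq0; apply: contraTN c1 => /andP[/eqP -> _].
  by rewrite /cr !inE.
have unI z : z \in dl Y (S1 :&: S2) -> z \notin sf.
  move=> zi; have [/us1//|/us2//] : z \in dl Y S1 \/ z \in dl Y S2.
  move: zi; rewrite !inE /cr !inE; case: (z \in Y) => //=.
  by do 4!case: (_ \in _) => //=; tauto.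
have unU z : z \in dl Y (S1 :|: S2) -> z \notin sf.
  move=> zi; have [/us1//|/us2//] : z \in dl Y S1 \/ z \in dl Y S2.
  move: zi; rewrite !inE /cr !inE; case: (z \in Y) => //=.
  by do 4!case: (_ \in _) => //=; tauto.
have kI : 1 < #|dl Y (S1 :&: S2)|.
  by apply: nbad_card_gt1 unI; apply: contra ntI; apply: (feasP _ fY).
have kU : 1 < #|dl Y (S1 :|: S2)|.
  by apply: nbad_card_gt1 unU; apply: contra ntU; apply: (feasP _ fY).
have kE : #|dl Y (S1 :&: S2)| = 2.
  have := dl_submod Y S1 S2; rewrite d1 d2 !cards2 (eq_sym f1) n1 (eq_sym f2) n2.
  by move: kI kU; clear; lia.
have dE : [set f1; f2] = dl Y (S1 :&: S2).
  apply/eqP; rewrite eqEcard kE cards2 n12 leqnn andbT.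
  by rewrite subUset !sub1set !inE Y1 Y2 ci1 ci2.
have c3 : cr f3 (S1 :&: S2) = false.
  by rewrite (dl_cr (esym dE) Y3) !inE (negbTE n31) eq_sym (negbTE n23).
have [||| z] := @side_connected ((S1 :&: S2) :\: U).
- by apply/subsetP => x; rewrite !inE => /andP[].
- apply/set0Pn; have : cr f3 U by rewrite sU.
  move: c3; rewrite /cr; case h1 : (_ \in U); case h2: (_ \in U) => //.
    have -> : (en f3).1 \in S1 :&: S2 by rewrite inE (subsetP U1 _ h1) (subsetP U2 _ h1).
    by move=> /negbFE i _; exists (en f3).2; rewrite inE h2 i.
  have -> : (en f3).2 \in S1 :&: S2 by rewrite inE (subsetP U1 _ h2) (subsetP U2 _ h2).
  by rewrite addbT => /negbFE i _; exists (en f3).1; rewrite inE h1 i.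
- apply/negP => /eqP/setP eq; have cU : cr f1 U by rewrite sU.
  move: c1 cU; rewrite /cr; case h1 : (_ \in U); case h2: (_ \in U) => //.
    have := eq (en f1).2; rewrite !inE h2 /=; rewrite (subsetP U1 _ h1).
    by case: (_ \in S1).
  have := eq (en f1).1; rewrite !inE h1 /=; rewrite (subsetP U1 _ h2).
  by case: (_ \in S1).
rewrite !inE => /andP[zY /andP[i1 i2]] cz.
have : cr z (S1 :&: S2).
  by move: cz; rewrite /cr !inE (negbTE i1) (negbTE i2).
rewrite (dl_cr (esym dE) zY) !inE => /orP[]/eqP eq.
  by have : cr f1 U; [rewrite sU|rewrite -eq /cr (negbTE i1) (negbTE i2)].
by have : cr f2 U; [rewrite sU|rewrite -eq /cr (negbTE i1) (negbTE i2)].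
Qed.

(** The complement of [S] is a proper part of [W], since a vertex outside [S'] lies in [S]. If [e]
    did not cross it, only [g] could cross it within [W], making it bad there. *)
Lemma tight_e h S g h' S' g' : h \in Y -> par X f h -> tight h S g ->
  h' \in Y -> par X f h' -> tight h' S' g' -> S :|: S' = setT -> cr e S.
Proof.
move=> hY ph [gh gs d US] hY' ph' [_ _ d' US'] SS; apply/negPn/negP => ce.
have nf z : cr z S -> ~: S != set0.
  move=> cz; apply: contraTneq cz => /(congr1 (@setC _)); rewrite setCK setC0 => ->.
  by rewrite /cr !inE.
have nf' z : cr z S' -> ~: S' != set0.
  move=> cz; apply: contraTneq cz => /(congr1 (@setC _)); rewrite setCK setC0 => ->.
  by rewrite /cr !inE.
have cS : cr h S by have [] := dl_crT d (set21 _ _).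
have cS' : cr h' S' by have [] := dl_crT d' (set21 _ _).
have sR : ~: S \subset W by rewrite setCS.
have RW : ~: S != W.
  apply/negP => /eqP/setP eq; have /set0Pn[x] := nf' _ cS'; rewrite inE => xS'.
  have := eq x; rewrite !inE; have : x \in S :|: S' by rewrite SS.
  by rewrite inE (negbTE xS') orbF => ->; case: (boolP (x \in U)) xS' => // /(subsetP US') ->.
move/negP: (nbad_side sW sR (nf _ cS) RW); apply.
have h2 z : z \in ins (e |: Y) W -> cr z (~: S) -> z = g.
  move=> zi; have nz := insN zi; rewrite crC in nz *.
  move: zi; rewrite !inE => /andP[/orP[/eqP ->|zY] _]; first by rewrite (negbTE ce).
  rewrite (dl_cr d zY) !inE => /orP[/eqP zh|/eqP//].
  by move: nz; rewrite zh sW ph.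
apply/badP; split => [a b ai bi ca cb|a ai ca]; last by rewrite (h2 _ ai ca).
by rewrite (h2 _ ai ca) (h2 _ bi cb).
Qed.

(** Three edges of the class would give three tight sets with pairwise disjoint complements, all
    crossed by [e], which has only two ends. *)
Lemma class_two_side : #|[set g in Y | par X f g]| <= 2.
Proof.
rewrite leqNgt; apply/negP => /card_gt2P[f1 [f2 [f3 []]]] [].
rewrite !inE => /andP[Y1 p1] /andP[Y2 p2] /andP[Y3 p3] [n12 n23 n31].
have [S1 [g1 t1]] := tight_ex Y1 p1.
have [S2 [g2 t2]] := tight_ex Y2 p2.
have [S3 [g3 t3]] := tight_ex Y3 p3.
have q12 : S1 :|: S2 = setT by apply: (@tight_pair f1 f2 f3) t1 t2.
have q23 : S2 :|: S3 = setT by apply: (@tight_pair f2 f3 f1) t2 t3.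
have q31 : S3 :|: S1 = setT by apply: (@tight_pair f3 f1 f2) t3 t1.
have c1 := tight_e Y1 p1 t1 Y2 p2 t2 q12.
have c2 := tight_e Y2 p2 t2 Y3 p3 t3 q23.
have c3 := tight_e Y3 p3 t3 Y1 p1 t1 q31.
move: c1 c2 c3.
have k x : [&& (x \in S1) || (x \in S2), (x \in S2) || (x \in S3) & (x \in S3) || (x \in S1)].
  by move/setP/(_ x): q12; move/setP/(_ x): q23; move/setP/(_ x): q31; rewrite !inE => -> -> ->.
have := k (en e).1; have := k (en e).2; rewrite /cr.
by do 6!case: (_ \in _).
Qed.

End Class.

Lemma class_two e Y f : e \in X -> ~~ bridge X e -> X :\ e \subset Y -> feas Y ->
  (forall f, f \in Y -> f \in cross X -> ~~ feas (Y :\ f)) -> f \in cross X ->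
  #|[set g in Y | par X f g]| <= 2.
Proof.
move=> eX nb s fY cY fc; have [T sT] := inv_class_cut iX fc.
have : cr e T = false.
  by rewrite sT; apply/negP => /par_cross; rewrite fc => /esym; apply/negP/crossN.
rewrite /cr => i12.
case: (boolP ((en e).1 \in T)) => i1.
  have i2 : (en e).2 \in T by move: i12; rewrite i1; case: (_ \in T).
  apply: (@class_two_side e Y _ _ _ _ _ _ _ (~: T)) => //; rewrite ?inE ?i1 ?i2 //.
  by move=> z; rewrite crC.
have i2 : (en e).2 \notin T by move: i12; rewrite (negbTE i1); case: (_ \in T).
by apply: (@class_two_side e Y _ _ _ _ _ _ _ T).
Qed.

(** In each class [Y] has at most two edges and [F] exactly two, and among the edges of [X] it lacks
    [e]. *)
Lemma prune_card e Y : e \in X -> ~~ bridge X e -> X :\ e \subset Y ->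
  Y \subset (X :\ e) :|: cross X -> feas Y ->
  (forall f, f \in Y -> f \in cross X -> ~~ feas (Y :\ f)) -> #|Y| < #|F|.
Proof.
move=> eX nb s sY fY cY.
have h : #|Y :&: cross X| <= #|F :&: cross X|.
  apply: (@class_leq _ (par X)); [exact: par_refl|exact: par_sym|exact: par_trans|].
  move=> a; rewrite !inE => /andP[aY ac].
  have -> : [set x in F :&: cross X | par X a x] = [set x in F | par X a x].
    by apply/setP => x; rewrite !inE; case pa: (par X a x); rewrite ?andbF // -(par_cross pa) ac !andbT.
  rewrite (inv_two iX ac); apply: leq_trans (class_two eX nb s fY cY ac).
  by apply/subset_leq_card/subsetP => x; rewrite !inE => /andP[/andP[-> _] ->].
have EF : F = X :|: (F :&: cross X).
  apply/setP => z; rewrite !inE; case zX: (z \in X); first by rewrite (subsetP (inv_sub iX) _ zX).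
  by case zF: (z \in F) => //=; apply/esym/(inv_diff iX); rewrite ?zX.
have cF : #|F| = #|X| + #|F :&: cross X|.
  rewrite [in LHS]EF cardsU (_ : X :&: _ = set0) ?cards0 ?subn0 //.
  apply/setP => z; rewrite !inE; case zX: (z \in X) => //=.
  by rewrite (negbTE (crossN zX)) andbF.
have cY' : #|Y| <= #|X :\ e| + #|Y :&: cross X|.
  rewrite -[in X in X <= _](_ : (X :\ e) :|: (Y :&: cross X) = Y) ?leq_card_setU //.
  apply/setP => z; rewrite inE [z \in _ :&: _]inE; apply/idP/idP.
    by case/orP => [/(subsetP s)//|/andP[]].
  by move=> zY; have := subsetP sY _ zY; rewrite inE zY /=.
by move: cY' h; rewrite cF (cardsD1 e X) eX; clear; lia.
Qed.

(** By minimality of [F], [b] is alone in a cut of [F] or has an unsafe partner there. A partner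
    outside [X] would be parallel to [b]; one in [X] would be an unsafe bridge of [X]. *)
Lemma bridge_F b : bridge X b -> exists S, dl F S = [set b].
Proof.
move=> bb; have bX := bridge_in bb; have bF := subsetP (inv_sub iX) _ bX.
have [S nt [[d _]|[g [gb gs d]]]] := critical_cut fF (swap_opt_minimal optF bF); first by exists S.
have gF : g \in F by have := dl_sub d; rewrite subUset !sub1set => /andP[].
case: (boolP (g \in X)) => gX; last first.
  have gc := inv_diff iX gF gX; have := inv_pair iX gF gc (S := S) (g := b).
  by rewrite setUC => /(_ d)/par_cross; rewrite gc => /esym; rewrite (negbTE (crossN bX)).
have [S' d'] := bridgeP _ _ bb.
have dX : dl X S = [set b; g].
  by rewrite (dlI (inv_sub iX) d); apply/setP => z; rewrite !inE; eqcases; rewrite ?bX ?gX.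
by have := inv_safe_bridges iX (dl_sd_single dX d' gb); rewrite (negbTE gs).
Qed.

(** If an edge [h] joining components crossed the cut of [b] in [F], exchanging a member of its
    class for [h] would keep size and feasibility and destroy the bridge [b]. This is what the
    bridges in [mu] are counted for. *)
Lemma bridge_cross b : bridge X b -> exists S, dl (X :|: cross X) S = [set b].
Proof.
move=> bb; have bX := bridge_in bb; have bF := subsetP (inv_sub iX) _ bX.
have [S d] := bridge_F bb.
case: (boolP [exists h in cross X, cr h S]) => [/exists_inP[h hc ch]|/exists_inPn no]; last first.
  exists S; apply/setP => z; rewrite !inE; case: (boolP (z \in cross X)) => zc.
  - by rewrite (negbTE (no _ zc)) andbF; apply/esym/negP => /eqP zb; move: zc; rewrite zb (negbTE (crossN bX)).
  - rewrite orbF; have := congr1 (fun A : {set E} => z \in A) d; rewrite !inE => <-.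
    case: (boolP (z \in X)) => zX; first by rewrite (subsetP (inv_sub iX) _ zX).
    by case: (boolP (z \in F)) => // zF; rewrite (inv_diff iX zF zX) in zc.
have hF : h \notin F.
  apply/negP => hF; have := dl_cr d hF; rewrite ch inE => /esym/eqP hb.
  by move: hc; rewrite hb (negbTE (crossN bX)).
have [g1 [g2 [g12 Fh]]] := card2 (inv_two iX hc).
have mem g : (g \in F) && par X h g = (g == g1) || (g == g2).
  by have := congr1 (fun A : {set E} => g \in A) Fh; rewrite !inE.
have /andP[g1F hg1] : (g1 \in F) && par X h g1 by rewrite mem eqxx.
have /andP[g2F hg2] : (g2 \in F) && par X h g2 by rewrite mem eqxx orbT.
have g1c : g1 \in cross X by rewrite -(par_cross hg1).
have hg : h != g1 by apply: contraNneq hF => ->.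
pose F' := (F :|: [set h]) :\: [set g1].
have inF z : z \in F' = (z != g1) && ((z \in F) || (z == h)) by rewrite !inE.
have fF' : feas F'.
  apply: feas_par.
    apply/subsetP => z zX; rewrite inF (subsetP (inv_sub iX) _ zX) andbT.
    by apply: contraTneq zX => ->; apply/negP => /(crossN); rewrite g1c.
  move=> f fF' fc; case: (boolP (par X h f)) => hf.
    apply/card_gt1P; exists g2, h; rewrite !inE -!(par_eq _ hf) hg2 par_refl.
    rewrite g2F eqxx hg eq_sym g12 orbT /=; split => //.
    by apply: contraNneq hF => <-.
  rewrite -(inv_two iX fc); apply/subset_leq_card/subsetP => z; rewrite !inE => /andP[zF pz].
  rewrite zF pz !andbT /=; apply: contra hf => /eqP zg; rewrite zg in pz.
  by rewrite (par_eq _ hg1) par_sym.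
have := optF (A := [set h]) (D := [set g1]); rewrite !cards1 => /(_ isT isT fF')/mu_le[_ le].
have cF : #|F'| = #|F|.
  have g1' : g1 \in F :|: [set h] by rewrite !inE g1F.
  have := cardsD1 g1 (F :|: [set h]); rewrite -/F' g1' setUC cardsU1 hF /=.
  by clear; lia.
suff lt : nbridges F' < nbridges F by move: (le (esym cF)); rewrite leqNgt lt.
apply: proper_card.
(* The exchange creates no bridge: if [g1] crossed the cut, [{g1, a}] would be a cut of [F] and [a]
   parallel to [g1], hence unsafe, whereas a bridge of a feasible set is safe. *)
have brF a S' : dl F' S' = [set a] -> dl F S' = [set a].
  move=> da; have as_ := feas_safe_bridges fF' da.
  have aF' : a \in F' by have := dl_sub da; rewrite sub1set.
  have ah : a != h by apply: contraTneq as_ => ->; apply: inv_unsafe iX _ hc.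
  have aF : a \in F by move: aF'; rewrite inF (negbTE ah) orbF => /andP[].
  have ag : a != g1 by move: aF'; rewrite inF => /andP[].
  case cg : (cr g1 S').
    have := inv_pair iX g1F g1c (S := S') (g := a).
    have -> : dl F S' = [set g1; a].
      apply/setP => z; rewrite !inE; case: (eqVneq z g1) => [->|zg] /=; first by rewrite g1F cg.
      have := congr1 (fun A : {set E} => z \in A) da; rewrite in_dl inF zg inE => <-.
      case: (boolP (z \in F)) => zF //=; case: (eqVneq z h) => [zh|//] /=.
      by rewrite zh; have := congr1 (fun A : {set E} => h \in A) da; rewrite in_dl inF eqxx hg orbT inE eq_sym (negbTE ah).
    move=> /(_ erefl)/par_cross; rewrite g1c => /esym/(inv_unsafe iX).
    by rewrite as_.
  apply/setP => z; rewrite !inE; case: (eqVneq z g1) => [->|zg] /=.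
    by rewrite cg andbF eq_sym (negbTE ag).
  have := congr1 (fun A : {set E} => z \in A) da; rewrite in_dl inF zg inE => <-.
  case: (boolP (z \in F)) => zF //=; case: (eqVneq z h) => [zh|//] /=.
  by rewrite zh; have := congr1 (fun A : {set E} => h \in A) da; rewrite in_dl inF eqxx hg orbT inE eq_sym (negbTE ah).
apply/properP; split.
  by apply/subsetP => a; rewrite !inE => /bridgeP[S' /brF da]; apply/bridgeP; exists S'.
exists b; rewrite inE; first by apply/bridgeP; exists S.
apply/bridgeP => -[S' db].
have ch' : cr h S' by rewrite (feas_dl_inj fF (T := S)) ?(brF _ _ db) ?d.
have := congr1 (fun A : {set E} => h \in A) db; rewrite in_dl inF eqxx hg orbT ch' inE => /esym/eqP hb.
by move: hF; rewrite hb bF.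
Qed.

End Prune.

(** * Two-edge cuts of local optima *)

Section Counting.

(** Crossing the edges of [R] gives functionals on the family [P], independent because of the dual
    cuts; requiring one of them to vanish halves the family. *)
Lemma dual_cuts_count (P : pred {set V}) (R : {set E}) :
  (forall S T, P S -> P T -> P (sd S T)) ->
  (forall e, e \in R -> exists2 S, P S & forall a, a \in R -> cr a S = (a == e)) ->
  2 ^ #|R| * #|[set S | P S && (dl R S == set0)]| <= #|[set S | P S]|.
Proof.
move=> Psd; have [n] := ubnP #|R|; elim: n R => // n IH R ltn dual.
case: (set_0Vmem R) => [->|[e eR]].
  rewrite cards0 mul1n; apply/subset_leq_card/subsetP => S.
  by rewrite !inE => /andP[].
have cR : #|R| = #|R :\ e|.+1 by rewrite (cardsD1 e R) eR.
have lt' : #|R :\ e| < n by move: ltn; rewrite cR; clear; lia.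
apply: leq_trans (IH (R :\ e) lt' _); last first.
  move=> a; rewrite !inE => /andP[ae aR]; have [S PS h] := dual _ aR.
  by exists S => // b; rewrite !inE => /andP[_ bR]; apply: h.
rewrite cR expnS mulnAC mulnC leq_mul2l mul2n -addnn; apply/orP; right.
have [Se PSe he] := dual _ eR.
pose A := [set S | P S && (dl R S == set0)].
have cA : #|[set sd S Se | S in A]| = #|A|.
  by apply: card_imset => S S' /(congr1 (fun x => sd x Se)); rewrite !sdK.
have cre S : S \in A -> cr e S = false.
  by rewrite !inE => /andP[_ /eqP d]; apply: closed_cr d eR.
rewrite -/A -[X in _ + X <= _]cA -[X in X <= _]subn0.
rewrite -(cards0 {set V}) -(_ : A :&: [set sd S Se | S in A] = set0) -?cardsU.
  apply/subset_leq_card/subsetP => S; rewrite in_setU => /orP[|/imsetP[S' S'A ->]].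
    rewrite !inE => /andP[-> /eqP d]; rewrite /=; apply/eqP/setP => z; rewrite !inE.
    by apply/negP => /andP[/andP[_ zR]]; rewrite (closed_cr d zR).
  move: S'A; rewrite !inE => /andP[PS' /eqP d]; rewrite Psd //=.
  apply/eqP/setP => z; rewrite !inE crD; apply/negP => /andP[/andP[ze zR]].
  by rewrite (closed_cr d zR) he // (negbTE ze).
apply/setP => S; rewrite !in_setI [in RHS]inE; apply/negP => /andP[SA /imsetP[S' S'A eq]].
by have := cre _ SA; rewrite eq crD (cre _ S'A) he // eqxx.
Qed.

(** A set not crossed by [Q] is determined by the edges of [O :\: Q] across it and the side of [v0],
    as a feasible set determines cuts up to complement. *)
Lemma cut_count O Q (v0 : V) : feas O ->
  #|[set S | dl Q S == set0]| <= 2 ^ #|O :\: Q|.+1.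
Proof.
move=> fO; pose h S := (dl (O :\: Q) S, v0 \in S).
have inj : {in [set S | dl Q S == set0] &, injective h}.
  move=> S T; rewrite !inE => /eqP dS /eqP dT [eq ev].
  have d : dl O (sd S T) = set0.
    apply/setP => z; rewrite !inE crD; apply/negP => /andP[zO].
    case: (boolP (z \in Q)) => zQ; first by rewrite (closed_cr dS zQ) (closed_cr dT zQ).
    have := congr1 (fun A : {set E} => z \in A) eq; rewrite !inE zQ zO /= => ->.
    by rewrite addbb.
  have v : v0 \notin sd S T by rewrite inE ev addbb.
  case/orP: (feas_dl_triv fO d) => /eqP eq0; last by rewrite eq0 inE in v.
  by apply/setP => x; have := congr1 (fun A : {set V} => x \in A) eq0; rewrite !inE; do 2!case: (x \in _).
rewrite -(card_in_imset inj).
apply: (@leq_trans #|setX (powerset (O :\: Q)) [set: bool]|).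
  apply/subset_leq_card/subsetP => y /imsetP[S _ ->]; rewrite !inE andbT.
  by apply/subsetP => z; rewrite inE => /andP[].
by rewrite cardsX card_powerset cardsT card_bool expnSr.
Qed.

(** The case [e == g] makes this an equivalence relation on all edges, also outside [A]. *)
Definition sim A e g : bool := (e == g) || [exists S, dl A S == [set e; g]].

Lemma simP A e g : reflect (e = g \/ exists S, dl A S = [set e; g]) (sim A e g).
Proof.
apply: (iffP orP) => [[/eqP->|/existsP[S /eqP d]]|[->|[S d]]]; first by left.
- by right; exists S.
- by left.
- by right; apply/existsP; exists S; rewrite d.
Qed.

Lemma sim_refl A : reflexive (sim A).
Proof. by move=> e; rewrite /sim eqxx. Qed.

Lemma sim_sym A : symmetric (sim A).
Proof. by move=> e g; rewrite /sim eq_sym setUC. Qed.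

Lemma sim_trans A : transitive (sim A).
Proof.
move=> b a c /simP[->//|[S dS]] /simP[<-|[T dT]]; apply/simP; first by right; exists S.
case: (eqVneq a c) => [|ac]; [by left|right].
case: (eqVneq a b) => [->|ab]; first by exists T.
case: (eqVneq b c) => [<-|bc]; first by exists S.
by exists (sd S T); apply: (@dl_sd_pair A _ _ b); rewrite // 1?setUC // eq_sym.
Qed.

Lemma sim_in A e g : sim A e g -> e != g -> (e \in A) && (g \in A).
Proof.
by case/simP => [->|[S /dl_sub]]; rewrite ?eqxx // subUset !sub1set.
Qed.

Lemma sim_cut A e g : sim A e g -> e != g -> exists S, dl A S = [set e; g].
Proof. by case/simP => [->|//]; rewrite eqxx. Qed.

Lemma sim_bridge A e g : sim A e g -> bridge A e = bridge A g.
Proof.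
suff h a b : sim A a b -> bridge A a -> bridge A b.
  by move=> s; apply/idP/idP; apply: h; rewrite // sim_sym.
case/simP => [->//|[S d]] /bridgeP[T dT].
case: (eqVneq b a) => [->|ba]; first by apply/bridgeP; exists T.
by apply/bridgeP; exists (sd S T); apply: dl_sd_single d dT ba.
Qed.

(** * Consequences of local optimality *)

Variables (F X O : {set E}).
Hypothesis fF : feas F.
Hypothesis iX : Inv F X.
Hypothesis H1 : forall e, e \in X -> exists Y,
  [/\ X :\ e \subset Y, Y \subset (X :\ e) :|: cross X,
      feas ((X :\ e) :|: cross X) -> feas Y,
      forall f, f \in Y -> f \in cross X -> ~~ feas (Y :\ f) &
      feas Y -> mu F <= mu Y].
Hypothesis H2 : forall e1 e2, ~~ split_ok X e1 e2.
Hypothesis fO : feas O.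

Lemma subF : F \subset X :|: cross X.
Proof.
apply/subsetP => z zF; rewrite inE; case zX: (z \in X) => //=.
by apply: (inv_diff iX) => //; rewrite zX.
Qed.

(** If [e] could be deleted after adding all edges joining components, pruning would produce a
    feasible set smaller than [F]. The critical cut that forbids this has a second edge in [X], as
    otherwise [e] would be a bridge. *)
Lemma local_opt_paired : paired X.
Proof.
move=> e.
move=> eX nb; have [Y [s1 s2 s3 s4 s5]] := H1 eX.
have nf : ~~ feas ((X :|: cross X) :\ e).
  have -> : (X :|: cross X) :\ e = (X :\ e) :|: cross X.
    apply/setP => z; rewrite !inE; case: (eqVneq z e) => //= ->.
    by rewrite (negbTE (crossN eX)).
  apply/negP => /s3 fY; have [+ _] := mu_le (s5 fY).
  by rewrite leqNgt (prune_card iX eX nb s1 s2 fY s4).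
have [S nt [[d _]|[g [ge gs d]]]] := critical_cut (feas_sub subF fF) nf.
  case/negP: nb; apply/bridgeP; exists S; rewrite (dlI (subsetUl _ _) d).
  by apply/setP => z; rewrite !inE; eqcases; rewrite eX.
exists S, g; split => //; apply/negPn/negP => gX.
case/negP: nb; apply/bridgeP; exists S; rewrite (dlI (subsetUl _ _) d).
by apply/setP => z; rewrite !inE; eqcases; rewrite ?eX ?(negbTE gX).
Qed.

(** A class is a full cut made of unsafe edges, so [O] contains at least two of them; [Q] is
    inclusion-minimal with this property. *)
Lemma class_pairs_ex : exists Q, [/\ Q \subset O, Q \subset cross X &
  forall f, f \in cross X -> #|[set g in Q | par X f g]| = 2].
Proof.
pose P (Q : {set E}) := [forall f in cross X, 1 < #|[set g in Q | par X f g]|].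
have PO : P (O :&: cross X).
  apply/forall_inP => f fc; have [T hT] := inv_class_cut iX fc.
  have nt : ~~ triv T by apply/negP => /(triv_cr f); rewrite hT par_refl.
  have -> : [set g in O :&: cross X | par X f g] = dl O T.
    apply/setP => z; rewrite !inE hT; case pz: (par X f z); rewrite ?andbF // !andbT.
    by rewrite -(par_cross pz) fc andbT.
  apply: (@nbad_card_gt1); first by apply: contra nt; apply: (feasP _ fO).
  by move=> z; rewrite in_dl hT => /andP[_ /par_cross]; rewrite fc => /esym/(inv_unsafe iX).
have [Q /minsetP[/forall_inP PQ minQ] sQ] := minset_exists PO.
exists Q; split.
- exact: subset_trans sQ (subsetIl _ _).
- exact: subset_trans sQ (subsetIr _ _).
move=> f fc; apply/eqP; rewrite eqn_leq PQ // andbT leqNgt; apply/negP => gt2.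
have /card_gt0P[q] : 0 < #|[set g in Q | par X f g]| by apply: leq_trans gt2.
rewrite inE => /andP[qQ pq].
suff /minQ : P (Q :\ q) by move=> /(_ (subD1set _ _))/setP/(_ q); rewrite !inE eqxx qQ.
apply/forall_inP => h hc; case: (boolP (par X f h)) => ph.
  have := cardsD1 q [set g in Q | par X f g]; rewrite inE qQ pq /= => eq.
  have -> : [set g in Q :\ q | par X h g] = [set g in Q | par X f g] :\ q.
    by apply/setP => z; rewrite !inE andbA (par_eq _ ph).
  by move: gt2; rewrite eq; clear; lia.
have -> : [set g in Q :\ q | par X h g] = [set g in Q | par X h g].
  apply/setP => z; rewrite !inE; case: (eqVneq z q) => //= ->.
  rewrite qQ /=; apply/esym/negP => hq; case/negP: ph; rewrite (par_eq _ pq).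
  by rewrite par_sym.
exact: PQ.
Qed.

(** Every nonbridge has an unsafe partner in its class. In a class of two both are thus unsafe, and
    the split is allowed: a new bridge would form a cut with one of the two and so belong to the
    class. *)
Lemma class3 e : e \in X -> ~~ bridge X e -> 2 < #|[set g | sim X e g]|.
Proof.
move=> eX nb; rewrite ltnNge; apply/negP => le2.
have cutX a b S : a \in X -> b \in X -> dl (X :|: cross X) S = [set a; b] -> dl X S = [set a; b].
  move=> aX bX d; rewrite (dlI (subsetUl _ _) d); apply/setP => z; rewrite !inE; eqcases;
  by rewrite ?aX ?bX.
have [S [g [gX ge gs d]]] := local_opt_paired eX nb; have {}d := cutX _ _ _ eX gX d.
have seg : sim X e g by apply/simP; right; exists S.
have ng : ~~ bridge X g by rewrite -(sim_bridge seg).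
have two z : sim X e z -> z = e \/ z = g.
  move=> sz; have : [set e; g] == [set g | sim X e g].
    rewrite eqEcard cards2 eq_sym ge le2 andbT; apply/subsetP => x; rewrite !inE.
    by case/orP => /eqP -> //; apply: sim_refl.
  by move/eqP/setP/(_ z); rewrite !inE sz => /orP[]/eqP; tauto.
have es : e \notin sf.
  have [S' [g' [g'X g'g g's d']]] := local_opt_paired gX ng; have {}d' := cutX _ _ _ gX g'X d'.
  have sg : sim X g g' by apply/simP; right; exists S'.
  by have [<-//|eq] := two _ (sim_trans seg sg); rewrite eq eqxx in g'g.
case/negP: (H2 e g); apply/and5P; split => //; rewrite 1?eq_sym //.
apply/and3P; split => //.
  apply/existsP; exists S; rewrite (dlI (subsetDl _ _) d).
  have [_ -> //] := dl_crT d (set21 _ _); rewrite andbT.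
  by apply/eqP/setP => z; rewrite !inE; case: (z == e); case: (z == g).
apply/forallP => a; apply/implyP => /bridgeP[T dT].
have aX' : a \in X :\: [set e; g] by have := dl_sub dT; rewrite sub1set.
move: (aX'); rewrite !inE negb_or => /andP[/andP[ae ag] aX].
suff ba : bridge X a.
  rewrite ba andbT; have [T' dT'] := bridgeP _ _ ba; exact: inv_safe_bridges iX _ _ dT'.
have nsim T' : dl X T' = [set a; e] \/ dl X T' = [set a; g] -> False.
  move=> h; suff [] : a = e \/ a = g by apply/eqP.
  apply: two; case: h => d'.
    by apply/simP; right; exists T'; rewrite setUC.
  by apply: (sim_trans seg); apply/simP; right; exists T'; rewrite setUC.
have mem z : z \in X -> z != e -> z != g -> cr z T = (z == a).
  by move=> zX ze zg; rewrite (dl_cr dT) ?inE // negb_or ze zg zX.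
have dXT : dl X T = [set z | [|| z == a, cr e T && (z == e) | cr g T && (z == g)]].
  apply/setP => z; rewrite !inE; case: (eqVneq z e) => [->|ze] /=.
    by rewrite eX andbT eq_sym (negbTE ae) eq_sym (negbTE ge) andbF orbF.
  case: (eqVneq z g) => [->|zg] /=; first by rewrite gX andbT andbF eq_sym (negbTE ag).
  rewrite !andbF !orbF; case: (boolP (z \in X)) => zX; first by rewrite mem.
  by apply/esym/negP => /eqP za; rewrite -za (negbTE zX) in aX.
case ce : (cr e T) dXT; case cg : (cr g T) => dXT.
- apply/bridgeP; exists (sd T S); rewrite dlD dXT d; apply/setP => z; rewrite !inE /=.
  by eqcases.
- by case: (@nsim T); left; rewrite dXT; apply/setP => z; rewrite !inE /= orbF.
- by case: (@nsim T); right; rewrite dXT; apply/setP => z; rewrite !inE /=.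
- by apply/bridgeP; exists T; rewrite dXT; apply/setP => z; rewrite !inE /= orbF.
Qed.

End Counting.

(** * Exchanges *)

Section Swaps.
Variables (F X Q : {set E}).
Hypothesis fF : feas F.
Hypothesis optF : swap_opt F.
Hypothesis iX : Inv F X.
Hypothesis nb_cut : paired X.
Hypothesis Qc : Q \subset cross X.
Hypothesis Q2 : forall f, f \in cross X -> #|[set g in Q | par X f g]| = 2.
Let Fs := X :|: Q.

Lemma FsX : X \subset Fs. Proof. exact: subsetUl. Qed.

Lemma QX z : z \in Q -> z \notin X.
Proof. by move=> /(subsetP Qc) zc; apply: contraTN zc => /(crossN). Qed.

Lemma cross_X z g : z \in cross X -> g \in X -> z != g.
Proof. by move=> zc gX; apply: contraTneq zc => ->; apply: crossN. Qed.

Lemma XF z : z \in X -> z \in F. Proof. exact: (subsetP (inv_sub iX)). Qed.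

Lemma feasFs : feas Fs.
Proof.
apply: (feas_par fF iX); first exact: subsetUl.
move=> f _ fc; rewrite -(Q2 fc); apply/subset_leq_card/subsetP => z.
by rewrite !inE => /andP[-> ->]; rewrite orbT.
Qed.

Lemma cutFs_X S e g : e \in X -> g \in X -> dl Fs S = [set e; g] -> dl X S = [set e; g].
Proof.
move=> eX gX d; rewrite (dlI FsX d); apply/setP => z; rewrite !inE; eqcases;
by rewrite ?eX ?gX.
Qed.

(** If the second edge of the cut were in [Q], then [e] would be alone in [X] across it. Hence
    blocks refine classes. *)
Lemma simFs_sub e g : e \in X -> ~~ bridge X e -> sim Fs e g -> sim X e g && (g \in X).
Proof.
move=> eX nb; case: (eqVneq e g) => [<-|eg] s; first by rewrite sim_refl eX.
have [S d] := sim_cut s eg.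
have gX : g \in X.
  apply/negPn/negP => gX; case/negP: nb; apply/bridgeP; exists S; rewrite (dlI FsX d).
  by apply/setP => z; rewrite !inE; eqcases; rewrite ?eX ?(negbTE gX).
by rewrite gX andbT; apply/simP; right; exists S; apply: cutFs_X.
Qed.

Lemma sim_X e g : e \in X -> sim X e g -> g \in X.
Proof. by move=> eX s; case: (eqVneq e g) => [<-//|/(sim_in s)/andP[]]. Qed.

Lemma nb_simFs e : e \in X -> ~~ bridge X e ->
  exists g, [/\ g != e, g \notin sf, g \in X & sim Fs e g].
Proof.
move=> eX nb; have [S [g [gX ge gs d]]] := nb_cut eX nb; exists g; split => //.
apply/simP; right; exists S.
have s : Fs \subset X :|: cross X by apply: setUS.
rewrite (dlI s d); apply/setP => z; rewrite !inE; eqcases; by rewrite ?eX ?gX.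
Qed.

Lemma blk_ge2 e : e \in X -> ~~ bridge X e -> 1 < #|[set g | sim Fs e g]|.
Proof.
move=> eX nb; have [g [ge _ _ s]] := nb_simFs eX nb.
by apply/card_gt1P; exists e, g; rewrite !inE sim_refl s eq_sym.
Qed.

(** Each nonbridge has an unsafe partner in its block, and in a block of two [e] is the partner of
    its partner. *)
Lemma blk2_unsafe e : e \in X -> ~~ bridge X e -> #|[set g | sim Fs e g]| = 2 -> e \notin sf.
Proof.
move=> eX nb c2; have [g [ge gs gX s]] := nb_simFs eX nb.
have ng : ~~ bridge X g.
  by have /andP[sX _] := simFs_sub eX nb s; rewrite -(sim_bridge sX).
have [g' [g'g g's _ s']] := nb_simFs gX ng.
have : [set e; g] == [set g | sim Fs e g].
  rewrite eqEcard cards2 eq_sym ge c2 andbT; apply/subsetP => x; rewrite !inE.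
  by case/orP => /eqP -> //; apply: sim_refl.
move/eqP/setP/(_ g'); rewrite !inE (sim_trans s s') (negbTE g'g) orbF => /eqP <-.
by [].
Qed.

(** Evidence in [Q] that [d] and [g] lie in different blocks. Since [q] and [q'] are parallel, the
    parity of their crossings is the same for all cuts [{d, g}] of [X]. *)
Definition witness d g q : bool := (q \in Q) && [exists q', [&& q' \in Q, par X q q' &
  [forall S, (dl X S == [set d; g]) ==> (cr q S (+) cr q' S)]]].

(* Take the cut crossed by fewest edges of [Q]: if it were crossed by both edges
   of a parallel pair, adding the cut formed by their class would undo this. *)
Lemma witness_ex d g : sim X d g -> d != g -> ~~ sim Fs d g -> exists q, witness d g q.
Proof.
move=> s dg ns; have [S0 /eqP d0] := sim_cut s dg.
case: (@arg_minnP _ S0 (fun S => dl X S == [set d; g]) (fun S => #|dl Q S|) d0) => S /eqP dS minS.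
have [q] : exists q, q \in dl Q S.
  apply/set0Pn; apply: contra ns => /eqP dQ; apply/simP; right; exists S.
  apply/setP => z; have := congr1 (fun A : {set E} => z \in A) dS.
  have := congr1 (fun A : {set E} => z \in A) dQ; rewrite !inE.
  by case: (z \in X); case: (z \in Q) => //= ->.
rewrite inE => /andP[qQ cq]; have qc := subsetP Qc _ qQ.
have [q' [q'Q pq nq]] : exists q', [/\ q' \in Q, par X q q' & q' != q].
  have /card_gt1P[a [b []]] : 1 < #|[set g in Q | par X q g]| by rewrite Q2.
  rewrite !inE => /andP[aQ pa] /andP[bQ pb] ab.
  by case: (eqVneq a q) => [aq|aq]; [exists b|exists a]; split; rewrite // -aq eq_sym.
have two z : z \in Q -> par X q z = (z == q) || (z == q').
  move=> zQ; have : [set q; q'] == [set g in Q | par X q g].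
    rewrite eqEcard cards2 Q2 // eq_sym nq andbT; apply/subsetP => x; rewrite !inE.
    by case/orP => /eqP ->; rewrite ?qQ ?q'Q ?par_refl.
  by move/eqP/setP/(_ z); rewrite !inE zQ /=.
have nq' : cr q' S = false.
  apply/negP => cq'; have [T hT] := inv_class_cut iX qc.
  have TX : dl X T = set0.
    apply/setP => z; rewrite !inE hT; apply/negP => /andP[zX /par_cross].
    by rewrite qc => /esym; rewrite (negbTE (crossN zX)).
  have := minS (sd S T); rewrite dlD0 // dS eqxx => /(_ isT); rewrite leqNgt => /negP; apply.
  apply: proper_card; apply/properP; split.
    apply/subsetP => z; rewrite !inE crD hT => /andP[zQ]; rewrite zQ two //=.
    by case: (eqVneq z q) => [->|_]; rewrite ?cq //; case: (eqVneq z q') => [->|_] /=; rewrite ?cq' ?addbF.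
  by exists q; rewrite inE ?qQ ?cq // crD hT par_refl cq andbF.
exists q; rewrite /witness qQ; apply/existsP; exists q'; rewrite q'Q pq; apply/forallP => S'.
apply/implyP => /eqP dS'.
have K : dl X (sd S S') = set0 by rewrite dlD dS dS' sdxx.
have /parP/(_ _ K) := pq; rewrite !crD cq nq'.
by do 2!case: (cr _ S').
Qed.

Lemma witness_set d : exists W0 : {set E}, [/\ W0 \subset cross X,
  #|W0| <= #|[set g | sim X d g] :\: [set g | sim Fs d g]| &
  forall g, sim X d g -> ~~ sim Fs d g -> exists2 q, q \in W0 & witness d g q].
Proof.
pose A := [set g | sim X d g] :\: [set g | sim Fs d g].
have ex g : g \in A -> exists q, witness d g q.
  rewrite !inE => /andP[ns s]; apply: witness_ex => //.
  by apply: contraNneq ns => ->; apply: sim_refl.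
exists [set odflt d [pick q | witness d g q] | g in A]; split.
- apply/subsetP => x /imsetP[g /ex[q hq] ->]; case: pickP => [q' /= |/(_ q)]; last by rewrite hq.
  by case/andP => /(subsetP Qc).
- exact: leq_imset_card.
move=> g s ns; exists (odflt d [pick q | witness d g q]).
  by apply/imsetP; exists g; rewrite // !inE ns.
have [q hq] : exists q, witness d g q by apply: ex; rewrite !inE ns.
by case: pickP => [//|/(_ q)]; rewrite hq.
Qed.

Section WithU.
Variable W0 : {set E}.
Hypothesis W0c : W0 \subset cross X.

Definition Ucl : {set E} := [set f | [exists w in W0, par X w f]].
(** In the classes of [W0] the two edges of [F] give way to the two of [Q], so that the witnesses
    are present after the exchange. *)
Definition rerouted : {set E} := (F :\: Ucl) :|: (Q :&: Ucl).

Lemma Ucl_par f g : par X f g -> (f \in Ucl) = (g \in Ucl).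
Proof.
move=> fg; rewrite !inE; apply/exists_inP/exists_inP => -[w wW pw]; exists w => //.
  by apply: par_trans pw fg.
by apply: (par_trans pw); rewrite par_sym.
Qed.

Lemma Ucl_cross f : f \in Ucl -> f \in cross X.
Proof. by rewrite inE => /exists_inP[w /(subsetP W0c) wc /par_cross <-]. Qed.

Lemma Ucl_W w : w \in W0 -> w \in Ucl.
Proof. by move=> wW; rewrite inE; apply/exists_inP; exists w => //; apply: par_refl. Qed.

Lemma X_rerouted : X \subset rerouted.
Proof.
apply/subsetP => z zX; rewrite !in_setU in_setD (XF zX) andbT.
by apply/orP; left; apply: contraL zX => /Ucl_cross zc; apply: contraTN zc => /(crossN).
Qed.

Lemma rerouted_feas : feas rerouted.
Proof.
apply: (feas_par fF iX X_rerouted) => f fF' fc; case: (boolP (f \in Ucl)) => fU.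
  rewrite -(Q2 fc); apply/subset_leq_card/subsetP => z; rewrite inE => /andP[zQ pz].
  by rewrite inE pz !in_setU in_setI zQ -(Ucl_par pz) fU orbT.
rewrite -(inv_two iX fc); apply/subset_leq_card/subsetP => z; rewrite inE => /andP[zF pz].
by rewrite inE pz !in_setU in_setD zF -(Ucl_par pz) fU.
Qed.

Lemma class_restr A f : A \subset cross X -> f \in Ucl ->
  [set x in A :&: Ucl | par X f x] = [set x in A | par X f x].
Proof.
move=> sA fU; apply/setP => x; rewrite inE in_setI [RHS]inE.
by case px : (par X f x); rewrite ?andbF // -(Ucl_par px) fU !andbT.
Qed.

Lemma card_QU : #|Q :&: Ucl| <= #|F :&: Ucl|.
Proof.
apply: (@class_leq _ (par X)); [exact: par_refl|exact: par_sym|exact: par_trans|].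
move=> a; rewrite inE => /andP[aQ aU]; rewrite class_restr //.
rewrite Q2 ?(subsetP Qc) // -(inv_two iX (Ucl_cross aU)).
apply/subset_leq_card/subsetP => z; rewrite !inE => /andP[zF pz]; rewrite zF pz andbT.
by have := aU; rewrite (Ucl_par pz) inE.
Qed.

Lemma card_U A : (forall f, f \in cross X -> #|[set g in A | par X f g]| = 2) ->
  #|A :&: Ucl| <= #|W0| * 2.
Proof.
move=> A2; have -> : A :&: Ucl = cover [set [set g in A | par X w g] | w in W0].
  apply/setP => z; rewrite in_setI; apply/andP/bigcupP => [[zA]|[C /imsetP[w wW ->]]].
    rewrite inE => /exists_inP[w wW pw]; exists [set g in A | par X w g]; last by rewrite inE zA.
    by apply/imsetP; exists w.
  by rewrite !inE => /andP[zA pz]; split=> //; apply/exists_inP; exists w.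
apply: leq_trans (leq_card_cover _) _.
apply: (@leq_trans (\sum_(C in [set [set g in A | par X w g] | w in W0]) 2)).
  by apply: leq_sum => C /imsetP[w wW ->]; rewrite A2 // (subsetP W0c).
by rewrite sum_nat_const leq_mul2r leq_imset_card.
Qed.

Variables (d d' p : E).
Hypothesis dX : d \in X.
Hypothesis dX' : d' \in X.
Hypothesis dd : d != d'.
Hypothesis pX : p \notin X.
Hypothesis cW : #|W0| <= 9.
Let Z := (p |: rerouted) :\: [set d; d'].

(** Rerouting does not enlarge [F], and then two edges leave while at most one enters. At most 1 +
    18 edges are added and 2 + 18 deleted, within the bound 20. *)
Lemma reroute_nfeas : ~~ feas Z.
Proof.
(* [p] and edges of [Q] may already belong to [F], so they are kept out of the rerouted part of
   [D]. *)
pose A := p |: (Q :&: Ucl); pose D := [set d; d'] :|: ((F :&: Ucl) :\: (p |: Q)).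
have XU z : z \in X -> z \notin Ucl.
  by move=> zX; apply: contraL zX => /Ucl_cross zc; apply: contraTN zc => /(crossN).
have EZ : Z = (F :|: A) :\: D.
  apply/setP => z; rewrite /Z /A /D /rerouted !(in_setU, in_setD, in_setI, in_set1).
  case: (eqVneq z d) => //= zd; case: (eqVneq z d') => //= zd'.
  case: (eqVneq z p) => //= [->|zp]; first by rewrite !orbT.
  by case: (z \in Ucl); case: (z \in F); case: (z \in Q).
have cQU := card_U Q2; have cFU := card_U (inv_two iX).
have cA : #|A| <= 20.
  rewrite (leq_trans (leq_card_setU _ _)) // cards1.
  by move: cQU cW; clear; lia.
have cD : #|D| <= 20.
  rewrite (leq_trans (leq_card_setU _ _)) // cards2 dd.
  have : #|(F :&: Ucl) :\: (p |: Q)| <= #|F :&: Ucl| by apply/subset_leq_card/subsetDl.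
  by move: cFU cW; clear; lia.
apply/negP; rewrite EZ => fZ; have := swap_card optF cA cD fZ; rewrite -EZ.
have cZ : #|Z| < #|F|; last by rewrite leqNgt cZ.
have dn : d \in p |: rerouted by rewrite in_setU (subsetP X_rerouted _ dX) orbT.
have dn' : d' \in (p |: rerouted) :\ d by rewrite in_setD1 eq_sym dd in_setU (subsetP X_rerouted _ dX') orbT.
have c1 := cardsD1 d (p |: rerouted); have c2 := cardsD1 d' ((p |: rerouted) :\ d).
rewrite dn in c1; rewrite dn' in c2.
have E2 : Z = (p |: rerouted) :\ d :\ d'.
  by apply/setP => z; rewrite /Z !in_setD !in_set1 in_set2 negb_or andbCA andbA.
have c3 : #|p |: rerouted| <= 1 + #|rerouted| by rewrite (leq_trans (leq_card_setU _ _)) // cards1.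
have c4 : #|rerouted| <= #|F :\: Ucl| + #|Q :&: Ucl| by apply: leq_card_setU.
have c5 := cardsID Ucl F; have c6 := card_QU.
by move: c1 c2 c3 c4 c5 c6; rewrite -E2; clear; lia.
Qed.

(** Deleting [a] alone does no harm: cuts within its block are met by [p], the other cuts of its
    class by one edge of a witnessing pair. *)
Definition reducible a := forall g, sim X a g -> g != a ->
  (sim Fs a g -> forall S, dl Fs S = [set a; g] -> cr p S) /\
  (~~ sim Fs a g -> exists2 q, q \in Ucl & witness a g q).

Hypothesis pU : p \in cross X -> p \in Ucl.
Hypothesis nbd : ~~ bridge X d.
Hypothesis nbd' : ~~ bridge X d'.
Hypothesis gd : reducible d.
Hypothesis gd' : reducible d'.

Let QU q : q \in Q -> q \in Ucl -> q \in Z.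
Proof.
move=> qQ qU; have qc := subsetP Qc _ qQ.
by rewrite in_setD in_set2 !in_setU in_setI qQ qU !orbT andbT negb_or !(cross_X qc).
Qed.

(** If [p] misses [S] but crosses another cut [{a, g}], the sum of the two is closed and crossed by
    [p]; an edge of [Q] parallel to [p] then crosses [S]. For this the class of [p] has to be
    rerouted as well. *)
Lemma reducible_nbad a S g : a \in X -> reducible a -> g \in X -> g != a -> dl X S = [set a; g] ->
  (forall z, z \in Z -> cr z S -> z = g) -> False.
Proof.
move=> aX ga gX gna dS u.
have pZ : p \in Z.
  rewrite in_setD in_set2 in_setU1 eqxx andbT negb_or.
  by apply/andP; split; apply: contraNneq pX => ->.
have sX : sim X a g by apply/simP; right; exists S.
have [h1 h2] := ga _ sX gna.
case: (boolP (sim Fs a g)) => [s|ns].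
  have [S1 d1] : exists S, dl Fs S = [set a; g] by apply: sim_cut; rewrite // eq_sym.
  have c1 := h1 s _ d1.
  have np : cr p S = false.
    by apply/negP => cp; move: pX; rewrite (u _ pZ cp) gX.
  have K : dl X (sd S S1) = set0 by rewrite dlD dS (cutFs_X aX gX d1) sdxx.
  have pc : p \in cross X by apply/crossP; exists (sd S S1); rewrite // crD np c1.
  have /card_gt0P[q] : 0 < #|[set g in Q | par X p g]| by rewrite Q2.
  rewrite inE => /andP[qQ pq]; have qc := subsetP Qc _ qQ.
  have : cr q (sd S S1) by have /parP/(_ _ K) := pq; rewrite crD np c1.
  have -> : cr q (sd S S1) = cr q S.
    have qFs : q \in Fs by rewrite in_setU qQ orbT.
    rewrite crD (dl_cr d1 qFs) in_set2.
    by rewrite (negbTE (cross_X qc aX)) (negbTE (cross_X qc gX)) addbF.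
  move=> cq; have : q = g by apply: u => //; apply: QU => //; rewrite -(Ucl_par pq) pU.
  by apply/eqP/cross_X.
have [q qU /andP[qQ /existsP[q' /and3P[q'Q pq /forallP/(_ S)]]]] := h2 ns.
rewrite dS eqxx /=; have q'U : q' \in Ucl by rewrite -(Ucl_par pq).
have nq z : z \in Q -> z \in Ucl -> cr z S = false.
  move=> zQ zU; apply/negP => cz; have : z = g by apply: u => //; apply: QU.
  by apply/eqP/cross_X => //; apply: (subsetP Qc).
by rewrite !nq.
Qed.

(** The exchange makes some cut bad although neither deletion does so alone. Hence [d] and [d'] both
    cross it, with at most one further edge of [X]. *)
Lemma reroute_cut : exists2 S, bad Z S &
  dl X S = [set d; d'] \/
  exists g, [/\ g \in X, g \notin sf, (g != d) && (g != d') & dl X S = [set g; d; d']].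
Proof.
have [S bS nt] := nfeasP reroute_nfeas; exists S => //.
have nb : ~~ bad rerouted S by apply: contra nt; apply: (feasP _ rerouted_feas).
have sZ : rerouted :\: [set d; d'] \subset Z by apply: setSD; apply: subsetUr.
have [+ H] := swap_pair (subsetP X_rerouted _ dX) (subsetP X_rerouted _ dX') sZ bS nb.
have one a : a \in X -> ~~ bridge X a -> dl X S <> [set a].
  by move=> _ na dS; case/negP: na; apply/bridgeP; exists S.
case c1 : (cr d S) H; case c2 : (cr d' S) => H // _.
- case: H => [dF|[g [gF /andP[gnd gnd'] gs dF u]]].
    left; rewrite (dlI X_rerouted dF); apply/setP => z; rewrite !inE /=; eqcases;
    by rewrite ?dX ?dX'.
  case: (boolP (g \in X)) => gX; [right; exists g; split => //|left];
    rewrite ?gnd ?gnd' // (dlI X_rerouted dF); apply/setP => z; rewrite !inE /=; eqcases;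
    by rewrite ?dX ?dX' ?gX ?(negbTE gX).
- exfalso; case: H => [dF|[g [gF /andP[gnd gnd'] gs dF u]]].
    apply: (one d) => //; rewrite (dlI X_rerouted dF); apply/setP => z; rewrite !inE /=; eqcases;
    by rewrite ?dX.
  case: (boolP (g \in X)) => gX; last first.
    apply: (one d) => //; rewrite (dlI X_rerouted dF); apply/setP => z; rewrite !inE /=; eqcases;
    by rewrite ?dX ?(negbTE gX).
  apply: (@reducible_nbad d S g) => //.
  rewrite (dlI X_rerouted dF); apply/setP => z; rewrite !inE /=; eqcases;
  by rewrite ?dX ?gX.
- exfalso; case: H => [dF|[g [gF /andP[gnd gnd'] gs dF u]]].
    apply: (one d') => //; rewrite (dlI X_rerouted dF); apply/setP => z; rewrite !inE /=; eqcases;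
    by rewrite ?dX'.
  case: (boolP (g \in X)) => gX; last first.
    apply: (one d') => //; rewrite (dlI X_rerouted dF); apply/setP => z; rewrite !inE /=; eqcases;
    by rewrite ?dX' ?(negbTE gX).
  apply: (@reducible_nbad d' S g) => //.
  rewrite (dlI X_rerouted dF); apply/setP => z; rewrite !inE /=; eqcases;
  by rewrite ?dX' ?gX.
Qed.

End WithU.
End Swaps.

(** * Nested two-edge cuts *)

Section Chain.

Variables (X : {set E}) (e p : E) (W : {set V}).
Hypothesis eX : e \in X.
Hypothesis nb : ~~ bridge X e.
Hypothesis pc : p \in cross X.
Hypothesis sW : forall z, cr z W = par X p z.
Hypothesis e1W : (en e).1 \in W.
Let a := (en e).1.
Let b := (en e).2.

Let WX z : z \in X -> cr z W = false.
Proof.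
move=> zX; rewrite sW; apply/negP => /par_cross; rewrite pc => /esym.
by rewrite (negbTE (crossN zX)).
Qed.

Let e2W : b \in W.
Proof. by have := WX eX; rewrite /cr e1W; case: (_ \in W). Qed.

(** Meaningful for the class of [p], whose members have exactly one end in [W]. *)
Definition inner_end q : V := if (en q).1 \in W then (en q).1 else (en q).2.

Lemma inner_endE q (A : {set V}) : par X p q -> A \subset W -> cr q A = (inner_end q \in A).
Proof.
rewrite -sW /cr /inner_end => + /subsetP s.
have s' x : (x \in A) ==> (x \in W) by apply/implyP/s.
have := s' (en q).1; have := s' (en q).2.
case: ((en q).1 \in W) => /=; case: ((en q).2 \in W) => //=;
  by do 2!case: (_ \in A).
Qed.

Lemma cut_in_side S g : g != e -> dl X S = [set e; g] -> exists A : {set V},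
  [/\ A \subset W, a \in A, b \notin A, dl X A = [set e; g] &
   forall q q', par X p q -> par X p q' ->
     (inner_end q \in A) (+) (inner_end q' \in A) = cr q S (+) cr q' S].
Proof.
move=> ge.
wlog aS : S / a \in S => [hw d|d].
  case: (boolP (a \in S)) => aS; first exact: (hw S).
  have [|A [h1 h2 h3 h4 h5]] := hw (~: S) _ (etrans (dlC _ _) d); first by rewrite inE.
  by exists A; split => // q q' pq pq'; rewrite h5 // !crC.
have ce : cr e S by have [] := dl_crT d (set21 _ _).
have bS : b \notin S by move: ce; rewrite /cr aS; case: (_ \in S).
pose A := S :&: W; pose K := S :\: W.
have sAW : A \subset W by apply: subsetIr.
have crA z : cr z W = false -> cr z A = cr z S && ((en z).1 \in W).
  rewrite /cr !inE; case: ((en z).1 \in W); case: ((en z).2 \in W) => //= _.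
    by rewrite !andbT.
  by rewrite !andbF.
have crK z : cr z S = cr z A (+) cr z K.
  by rewrite /cr !inE; do 4!case: (_ \in _).
have dA : dl X A = [set e; g].
  have mem z : z \in X -> cr z A = ((z == e) || (z == g)) && ((en z).1 \in W).
    by move=> zX; rewrite crA ?WX // (dl_cr d zX) !inE.
  have gX : g \in X by have := dl_sub d; rewrite subUset !sub1set => /andP[].
  have gW : (en g).1 \in W.
    apply/negPn/negP => gW; case/negP: nb; apply/bridgeP; exists A.
    apply/setP => z; rewrite in_dl in_set1; case: (boolP (z \in X)) => zX /=; last first.
      by apply/esym; apply: contraNF zX => /eqP ->.
    by rewrite mem //; eqcases; rewrite ?(negbTE gW) // ?e1W.
  apply/setP => z; rewrite in_dl in_set2; case: (boolP (z \in X)) => zX /=; last first.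
    by apply/esym; apply: contraNF zX => /orP[]/eqP ->.
  by rewrite mem //; eqcases; rewrite ?gW ?e1W.
have dK : dl X K = set0.
  apply/setP => z; rewrite in_dl [RHS]inE; apply/negP => /andP[zX].
  have := crK z; rewrite (dl_cr d zX) (dl_cr dA zX).
  by case: (z \in _); case: (cr z K).
exists A; split => //.
- by rewrite inE aS e1W.
- by rewrite inE negb_and bS.
move=> q q' pq pq'; rewrite -!inner_endE // !crK.
have -> : cr q K = cr q' K.
  by move/parP: pq => <- //; move/parP: pq' => <-.
by do 3!case: (cr _ _).
Qed.

(** Intersection and union are both crossed by the nonbridge [e], so by submodularity the
    intersection has exactly two edges. The second is [g] or [g'], and the corresponding difference
    is then closed. *)
Lemma cuts_nested (A A' : {set V}) g g' : g != e -> g' != e -> g != g' ->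
  A \subset W -> a \in A -> b \notin A -> dl X A = [set e; g] ->
  A' \subset W -> a \in A' -> b \notin A' -> dl X A' = [set e; g'] ->
  dl X (A :\: A') = set0 \/ dl X (A' :\: A) = set0.
Proof.
move=> ge ge' gg sA aA bA dA sA' aA' bA' dA'.
have cI : cr e (A :&: A') by rewrite /cr !inE aA aA' (negbTE bA).
have cU : cr e (A :|: A') by rewrite /cr !inE aA (negbTE bA) (negbTE bA').
have two S : cr e S -> 1 < #|dl X S|.
  move=> ce; rewrite ltnNge; apply: contra nb => le1; apply/bridgeP; exists S.
  by apply/esym/eqP; rewrite eqEcard cards1 le1 andbT sub1set in_dl eX ce.
have := dl_submod X A A'; rewrite dA dA' !cards2 (eq_sym e) ge (eq_sym e) ge' => sm.
have c2 : #|dl X (A :&: A')| = 2.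
  by have := two _ cI; have := two _ cU; move: sm; clear; lia.
have [x xI] : exists2 x, dl X (A :&: A') = [set e; x] & x != e.
  have := cardsD1 e (dl X (A :&: A')); rewrite in_dl eX cI c2 => -[] /esym/eqP/cards1P[x hx].
  exists x; last by have := set11 x; rewrite -hx in_setD1 => /andP[].
  apply/setP => z; rewrite in_set2; case: (eqVneq z e) => [->|ze]; first by rewrite in_dl eX cI.
  by have := congr1 (fun B : {set E} => z \in B) hx; rewrite in_setD1 ze in_set1.
move=> xe; have : (x == g) || (x == g').
  have [xX cx] : x \in X /\ cr x (A :&: A') by apply: dl_crT xI _; rewrite in_set2 eqxx orbT.
  have : cr x A || cr x A' by move: cx; rewrite /cr !inE; do 4!case: (_ \in _).
  by rewrite (dl_cr dA xX) (dl_cr dA' xX) !inE (negbTE xe).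
have D (B C : {set V}) : B :\: C = sd B (B :&: C).
  by apply/setP => y; rewrite !inE; do 2!case: (_ \in _).
case/orP => /eqP eq; [left|right].
  by rewrite D dlD dA xI eq sdxx.
by rewrite D setIC dlD dA' xI eq sdxx.
Qed.

(** The three cuts, pushed into [W], isolate each of the inner ends of [p], [q1], [q2] once. By
    nestedness one difference of any two of them contains all or none of these ends, so their traces
    form a chain; but a chain on three points has at most two proper parts. *)
Lemma chain_contra q1 q2 f e' f' Sf S1 S2 :
  par X p q1 -> par X p q2 -> [/\ f != e, e' != e & f' != e] ->
  [/\ f != e', f != f' & e' != f'] ->
  dl X Sf = [set e; f] -> dl X S1 = [set e; e'] -> dl X S2 = [set e; f'] ->
  [/\ cr q1 Sf = false, cr q2 Sf = false & cr p Sf] ->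
  [/\ cr q2 S1 = ~~ cr q1 S1 & cr p S1 = false] ->
  [/\ cr q1 S2 = cr q1 S1, cr q2 S2 = cr q2 S1 & cr p S2] -> False.
Proof.
move=> p1 p2 [n1 n2 n3] [m1 m2 m3] df d1 d2 [vf1 vf2 vf3] [v12 v13] [v21 v22 v23].
have pp := par_refl X p.
have [A [sA aA bA dA hA]] := cut_in_side n1 df.
have [B [sB aB bB dB hB]] := cut_in_side n2 d1.
have [C [sC aC bC dC hC]] := cut_in_side n3 d2.
pose k (P R : {set V}) q := (inner_end q \in P) && (inner_end q \notin R).
have nest (P R : {set V}) g g' : g != e -> g' != e -> g != g' ->
    P \subset W -> a \in P -> b \notin P -> dl X P = [set e; g] ->
    R \subset W -> a \in R -> b \notin R -> dl X R = [set e; g'] ->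
    (k P R q1 == k P R p) && (k P R q2 == k P R p) ||
    (k R P q1 == k R P p) && (k R P q2 == k R P p).
  move=> h1 h2 h3 h4 h5 h6 h7 h8 h9 h10 h11.
  have [c|c] := cuts_nested h1 h2 h3 h4 h5 h6 h7 h8 h9 h10 h11; apply/orP; [left|right].
    have s : P :\: R \subset W by apply: subset_trans (subsetDl _ _) h4.
    have kE q : par X p q -> k P R q = cr p (P :\: R).
      by move=> pq; move/parP: (pq) => -> //; rewrite inner_endE // !inE andbC.
    by rewrite !kE // !eqxx.
  have s : R :\: P \subset W by apply: subset_trans (subsetDl _ _) h8.
  have kE q : par X p q -> k R P q = cr p (R :\: P).
    by move=> pq; move/parP: (pq) => -> //; rewrite inner_endE // !inE andbC.
  by rewrite !kE // !eqxx.
have n12 := nest A B f e' n1 n2 m1 sA aA bA dA sB aB bB dB.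
have n13 := nest A C f f' n1 n3 m2 sA aA bA dA sC aC bC dC.
have n23 := nest B C e' f' n2 n3 m3 sB aB bB dB sC aC bC dC.
move: n12 n13 n23 (hA _ _ p1 pp) (hA _ _ p2 pp) (hB _ _ p1 pp) (hB _ _ p2 pp) (hC _ _ p1 pp) (hC _ _ p2 pp).
rewrite /k vf1 vf2 vf3 v12 v13 v21 v22 v23 v12 /=; case: (cr q1 S1) => /=; clear;
case: (inner_end p \in A); case: (inner_end p \in B); case: (inner_end p \in C);
case: (inner_end q1 \in A) => //=; case: (inner_end q2 \in A) => //=;
case: (inner_end q1 \in B) => //=; case: (inner_end q2 \in B) => //=;
case: (inner_end q1 \in C) => //=; by case: (inner_end q2 \in C).
Qed.

End Chain.

(** * Units *)

Section Units.
Variables (F X O Q : {set E}).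
Hypothesis fF : feas F.
Hypothesis optF : swap_opt F.
Hypothesis iX : Inv F X.
Hypothesis nb_cut : paired X.
Hypothesis fO : feas O.
Hypothesis Qc : Q \subset cross X.
Hypothesis Q2 : forall f, f \in cross X -> #|[set g in Q | par X f g]| = 2.
Let Fs := X :|: Q.
Local Notation cls e := [set g | sim X e g].
Local Notation blk e := [set g | sim Fs e g].
Local Notation nonb e := ((e \in X) && ~~ bridge X e).

Lemma nonb_sim e g : nonb e -> sim X e g -> nonb g.
Proof. by move=> /andP[eX nb] s; rewrite (sim_X eX s) -(sim_bridge s). Qed.

Lemma nonb_simFs e g : nonb e -> sim Fs e g -> sim X e g.
Proof. by move=> /andP[eX nb] /(simFs_sub eX nb)/andP[]. Qed.

Lemma nonb_blk e g : nonb e -> sim Fs e g -> nonb g.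
Proof. by move=> ne s; apply: nonb_sim ne (nonb_simFs ne s). Qed.

Lemma blk_eq e g : sim Fs e g -> blk g = blk e.
Proof. by move=> s; apply/setP => z; rewrite !inE -(rel_eq (@sim_sym Fs) (@sim_trans Fs) _ s). Qed.

Lemma cls_eq e g : sim X e g -> cls g = cls e.
Proof. by move=> s; apply/setP => z; rewrite !inE -(rel_eq (@sim_sym X) (@sim_trans X) _ s). Qed.

Lemma blk_cls e : nonb e -> blk e \subset cls e.
Proof. by move=> ne; apply/subsetP => g; rewrite !inE; apply: nonb_simFs. Qed.

(** Blocks have at least two elements, so a class of three cannot be divided. *)
Lemma cls3_blk e : nonb e -> #|cls e| = 3 -> blk e = cls e.
Proof.
move=> ne c3; apply/eqP; rewrite eqEsubset blk_cls //; apply/subsetP => g; rewrite !inE => sg.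
apply/negPn/negP => ns; have ng := nonb_sim ne sg.
have /andP[eX nbe] := ne; have /andP[gX nbg] := ng.
have b1 : 1 < #|blk e| := blk_ge2 nb_cut Qc eX nbe.
have b2 : 1 < #|blk g| := blk_ge2 nb_cut Qc gX nbg.
have dis : blk e :&: blk g = set0.
  apply/setP => z; rewrite !inE; apply/negP => /andP[h1 h2]; case/negP: ns.
  by apply: (sim_trans h1); rewrite sim_sym.
have : #|blk e :|: blk g| <= #|cls e|.
  by apply/subset_leq_card; rewrite subUset blk_cls // -(cls_eq sg) blk_cls.
by rewrite cardsU dis cards0 c3; move: b1 b2; clear; lia.
Qed.

(* The blocks on which [O] is shown to spend at least [#|blk e|] private edges. *)
Definition small e : bool := (#|cls e| == 3) || ((#|blk e| == 2) && (#|cls e| <= 6)).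

Lemma small_blk e : nonb e -> small e -> #|blk e| <= 3.
Proof.
by move=> ne /orP[/eqP c3|/andP[/eqP-> //]]; rewrite cls3_blk // c3.
Qed.

Lemma small_cls_blk e d : nonb e -> small e -> sim Fs e d -> #|cls d :\: blk d| <= 4.
Proof.
move=> ne ue s; rewrite (blk_eq s) (cls_eq (nonb_simFs ne s)).
case/orP: ue => [/eqP c3|/andP[/eqP b2 c6]]; first by rewrite cls3_blk // setDv cards0.
by rewrite cardsD (setIidPr (blk_cls ne)) b2; move: c6; clear; lia.
Qed.

(** The edges of [O] charged to the block of [e]. *)
Definition crossers e : {set E} := [set p in O :\: Q | [exists x, exists y, exists S,
  [&& x != y, sim Fs e x, sim Fs e y, dl Fs S == [set x; y] & cr p S]]].

Lemma crossersP e p : reflect [/\ p \in O, p \notin Q & exists x y S,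
  [/\ x != y, sim Fs e x, sim Fs e y, dl Fs S = [set x; y] & cr p S]] (p \in crossers e).
Proof.
rewrite inE in_setD; apply: (iffP andP) => [[/andP[pQ pO]]|[pO pQ [x [y [S [h1 h2 h3 h4 h5]]]]]].
  case/existsP => x /existsP[y /existsP[S /and5P[h1 h2 h3 /eqP h4 h5]]].
  by split => //; exists x, y, S.
split; first by rewrite pQ.
by apply/existsP; exists x; apply/existsP; exists y; apply/existsP; exists S; rewrite h1 h2 h3 h4 eqxx.
Qed.

Lemma Fs_inj S T : dl Fs S = dl Fs T -> forall h, cr h S = cr h T.
Proof. exact: feas_dl_inj (feasFs fF iX Q2). Qed.

Definition crosses_all p d := forall g, sim Fs d g -> g != d ->
  forall S, dl Fs S = [set d; g] -> cr p S.

(** The three cuts within a block of three add up to zero, so [p] crosses exactly two of them, and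
    these share a member; a block of two has one cut only. *)
Lemma crosses_all_ex e p : nonb e -> #|blk e| <= 3 -> p \in crossers e ->
  exists2 d, sim Fs e d & crosses_all p d.
Proof.
move=> ne b3 /crossersP[_ _ [x [y [S [xy sx sy dS cp]]]]].
have exy : sim Fs x y by rewrite sim_sym in sx; apply: sim_trans sx sy.
case: (boolP [forall g, sim Fs x g && (g != x) ==>
    [forall S, (dl Fs S == [set x; g]) ==> cr p S]]) => [/forallP h|].
  exists x => // g sg gx T dT; have := h g; rewrite sg gx => /forallP/(_ T).
  by rewrite dT eqxx.
case/forallPn => g; rewrite negb_imply => /andP[/andP[sg gx] /forallPn[T]].
rewrite negb_imply => /andP[/eqP dT npT].
have gy : g != y.
  by apply: contraNneq npT => gy; rewrite (@Fs_inj T S) // dT dS gy.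
exists y => // h sh hy T' dT'.
have : (h == x) || (h == g).
  have eq : [set x; y; g] == blk e.
    rewrite eqEcard; apply/andP; split.
      apply/subsetP => z; rewrite !inE => /orP[/orP[]|] /eqP-> //.
      exact: sim_trans sx sg.
    rewrite (leq_trans b3) // -setUA cardsU1 cards2 !inE negb_or xy eq_sym gx eq_sym gy /=.
    by [].
  have : h \in blk e by rewrite inE; apply: sim_trans sy sh.
  by rewrite -(eqP eq) !inE (negbTE hy) orbF.
case/orP => /eqP hE; subst h.
  by rewrite (@Fs_inj T' S) // dT' dS setUC.
have -> : cr p T' = cr p (sd S T).
  apply: Fs_inj; rewrite dT'; apply/esym; apply: (@dl_sd_pair _ _ _ x) => //; rewrite eq_sym //.
by rewrite crD cp (negbTE npT).
Qed.

(* The outcome of exchanging [d], [d'] for [p] after rerouting every class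
   that witnesses the inequivalence of [d] or [d'] to a member of its class. *)
Lemma exchange_cut d d' p : nonb d -> nonb d' -> d != d' -> p \notin X -> p \notin Q ->
  #|cls d :\: blk d| <= 4 -> #|cls d' :\: blk d'| <= 4 -> crosses_all p d -> crosses_all p d' ->
  exists S, [/\ dl X S = [set d; d'] \/
    exists g, [/\ g \in X, g \notin sf, (g != d) && (g != d') & dl X S = [set g; d; d']],
    forall q q', q \in Q -> q' \in Q -> par X p q -> par X p q' -> cr q S -> cr q' S -> q = q',
    p \in sf -> cr p S = false &
    dl X S = [set d; d'] -> ~~ sim Fs d d' -> cr p S = false].
Proof.
move=> /andP[dX nd] /andP[dX' nd'] dd pX pQ m1 m2 c1 c2.
have := witness_set iX Qc Q2 d'; have := witness_set iX Qc Q2 d; rewrite -/Fs.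
move=> [W1 [W1c W1n W1w]] [W2 [W2c W2n W2w]].
(* The class of [p] is rerouted too if [p] joins components; with at most four witnesses for each
   deleted edge this makes nine classes. *)
pose Wp := [set z in cross X | z == p].
pose W0 := W1 :|: W2 :|: Wp.
have Wpc : Wp \subset cross X by apply/subsetP => z; rewrite inE => /andP[].
have W0c : W0 \subset cross X by rewrite !subUset W1c W2c Wpc.
have cW : #|W0| <= 9.
  have cp : #|Wp| <= 1 by rewrite -(cards1 p); apply/subset_leq_card/subsetP => z; rewrite !inE => /andP[_].
  have h1 : #|W0| <= #|W1 :|: W2| + #|Wp| by apply: leq_card_setU.
  have h2 : #|W1 :|: W2| <= #|W1| + #|W2| by apply: leq_card_setU.
  by move: cp W1n W2n m1 m2 h1 h2; clear; lia.
have pU : p \in cross X -> p \in Ucl X W0.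
  by move=> pc; apply: Ucl_W; rewrite !in_setU inE pc eqxx orbT.
have g1 : reducible X Q W0 p d.
  move=> g sg gd; split => [s S dS|ns]; first exact: c1 dS.
  have [q qW hq] := W1w _ sg ns; exists q => //.
  by apply: Ucl_W; rewrite !in_setU qW.
have g2 : reducible X Q W0 p d'.
  move=> g sg gd; split => [s S dS|ns]; first exact: c2 dS.
  have [q qW hq] := W2w _ sg ns; exists q => //.
  by apply: Ucl_W; rewrite !in_setU qW orbT.
have [S bS H] := reroute_cut fF optF iX Qc Q2 W0c dX dX' dd pX cW pU nd nd' g1 g2.
have [u us] := badP _ _ bS.
have QZ q : q \in Q -> q \in Ucl X W0 -> q \in (p |: rerouted F X Q W0) :\: [set d; d'].
  move=> qQ qU; have qc := subsetP Qc _ qQ.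
  by rewrite in_setD in_set2 !in_setU in_setI qQ qU !orbT andbT negb_or !(cross_X qc).
have pZ : p \in (p |: rerouted F X Q W0) :\: [set d; d'].
  rewrite in_setD in_set2 in_setU1 eqxx andbT negb_or.
  by apply/andP; split; apply: contraNneq pX => ->.
have pq q : q \in Q -> par X p q -> q \in Ucl X W0.
  move=> qQ ppq; rewrite -(Ucl_par _ ppq); apply: pU.
  by rewrite (par_cross ppq) (subsetP Qc).
exists S; split => //.
- by move=> q q' qQ qQ' h h' cq cq'; apply: u => //; apply: QZ => //; apply: pq.
- by move=> ps; apply/negP => cp; have := us _ pZ cp; rewrite ps.
move=> dS ns; apply/negP => cp.
have sX : sim X d d' by apply/simP; right; exists S.
have [q qW /andP[qQ /existsP[q' /and3P[q'Q pqq /forallP/(_ S)]]]] := W1w _ sX ns.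
have qU : q \in Ucl X W0 by apply: Ucl_W; rewrite !in_setU qW.
have qU' : q' \in Ucl X W0 by rewrite -(Ucl_par _ pqq).
rewrite dS eqxx /=.
have nq z : z \in Q -> z \in Ucl X W0 -> cr z S = false.
  move=> zQ zU; apply/negP => cz; case/negP: pQ.
  by rewrite (u _ _ pZ (QZ _ zQ zU) cp cz).
by rewrite !nq.
Qed.

Lemma no_triple d d' g S T : dl X S = [set g; d; d'] -> dl X T = [set d; d'] ->
  g != d -> g != d' -> g \in sf.
Proof.
move=> dS dT gd gd'; apply: (inv_safe_bridges iX (S := sd S T)).
by rewrite dlD dS dT; apply/setP => z; rewrite !inE; eqcases.
Qed.

Lemma dl_crossers e x y S : x != y -> sim Fs e x -> sim Fs e y -> dl Fs S = [set x; y] ->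
  nonb e -> dl O S \subset crossers e.
Proof.
move=> xy sx sy dS ne; apply/subsetP => p; rewrite in_dl => /andP[pO cp].
apply/crossersP; split => //; last by exists x, y, S.
apply/negP => pQ; have pc := subsetP Qc _ pQ.
have pFs : p \in Fs by rewrite in_setU pQ orbT.
have := dl_cr dS pFs; rewrite cp in_set2.
have /andP[xX _] := nonb_blk ne sx; have /andP[yX _] := nonb_blk ne sy.
by rewrite (negbTE (cross_X pc xX)) (negbTE (cross_X pc yX)).
Qed.

Lemma cut_ntriv S x y : dl Fs S = [set x; y] -> ~~ triv S.
Proof.
move=> dS; apply/negP => /(triv_cr x); have [_ ->] : x \in Fs /\ cr x S by apply: dl_crT dS (set21 _ _).
by [].
Qed.

(** The block is an unsafe pair, and [O] crosses its cut twice unless a safe edge [p] crosses it.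
    The exchange of the pair for such a [p] fails only at a cut of the pair that [p] misses; adding
    both cuts, [p] joins components of [X], but such edges are unsafe. *)
Lemma crossers_gt1 e : nonb e -> #|blk e| = 2 -> #|cls e| <= 6 -> 1 < #|crossers e|.
Proof.
move=> ne b2 c6; have ue : small e by rewrite /small b2 c6 orbT.
have /andP[eX nbe] := ne.
have [f [fe fs fX sf']] := nb_simFs nb_cut Qc eX nbe.
have ef : e != f by rewrite eq_sym.
have [S dS] := sim_cut sf' ef.
have nf := nonb_blk ne sf'.
have sub := dl_crossers ef (sim_refl Fs e) sf' dS ne.
apply: leq_trans (subset_leq_card sub); apply: (@nbad_card_gt1).
  by apply: contra (cut_ntriv dS); apply: (feasP _ fO).
move=> p; rewrite in_dl => /andP[pO cp]; apply/negP => psf.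
have /crossersP[_ pQ _] : p \in crossers e by apply: (subsetP sub); rewrite in_dl pO.
have us x : sim Fs e x -> x \notin sf.
  move=> sx; have /andP[xX nx] := nonb_blk ne sx.
  by apply: (blk2_unsafe nb_cut Qc xX nx); rewrite -/Fs (blk_eq sx).
have pX : p \notin X.
  apply/negP => pX; have pFs : p \in Fs by rewrite in_setU pX.
  have := dl_cr dS pFs; rewrite cp in_set2 => /esym/orP[]/eqP pe; move: psf; rewrite pe; apply/negP; apply: us => //.
  exact: sim_refl.
have blkE z : sim Fs e z -> (z == e) || (z == f).
  move=> sz; have : [set e; f] == blk e.
    rewrite eqEcard cards2 ef b2 andbT; apply/subsetP => x; rewrite !inE.
    by case/orP => /eqP-> //; apply: sim_refl.
  by move/eqP/setP/(_ z); rewrite !inE sz.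
have ca d : sim Fs e d -> crosses_all p d.
  move=> sd_ g sg gd T dT; rewrite (@Fs_inj T S) // dT dS.
  have h1 := blkE _ sd_; have h2 := blkE _ (sim_trans sd_ sg).
  apply/setP => z; rewrite !inE; case/orP: h1 gd => /eqP->; case/orP: h2 => /eqP->; rewrite ?eqxx // orbC.
  by [].
have [T [H _ psf' _]] := exchange_cut ne nf ef pX pQ (small_cls_blk ne ue (sim_refl Fs e)) (small_cls_blk ne ue sf') (ca _ (sim_refl Fs e)) (ca _ sf').
have dSX := cutFs_X eX fX dS.
case: H => [dT|[g [gX gs /andP[ge gf] dT]]]; last first.
  by have := no_triple dT dSX ge gf; rewrite (negbTE gs).
have K : dl X (sd T S) = set0 by rewrite dlD dT dSX sdxx.
have pc : p \in cross X by apply/crossP; exists (sd T S); rewrite // crD psf' // cp.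
by have := inv_unsafe iX pc; rewrite psf.
Qed.

(** The cuts within the block add up to zero, so every edge misses one of them. With at most two
    charged edges, a missed cut is crossed by the other one alone, which is therefore safe. Hence
    both are safe, and exchanging the three edges of the block for them would be feasible and
    smaller. *)
Lemma crossers_gt2 e : nonb e -> #|cls e| = 3 -> 2 < #|crossers e|.
Proof.
move=> ne c3; have bE := cls3_blk ne c3; rewrite ltnNge; apply/negP => le2.
have /card_gt2P[a [b [c [[]]]]] : 2 < #|blk e| by rewrite bE c3.
rewrite !inE => sa sb sc [ab bc ca].
have b3 : [set a; b; c] = blk e.
  apply/eqP; rewrite eqEcard bE c3 -setUA cardsU1 cards2 !inE negb_or ab bc eq_sym ca /=.
  by rewrite andbT; apply/subsetP => z; rewrite -bE !inE => /orP[|/orP[]]/eqP->.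
have simab x y : sim Fs e x -> sim Fs e y -> sim Fs x y.
  by move=> sx sy; rewrite sim_sym in sx; apply: sim_trans sx sy.
have cutE x y : sim Fs e x -> sim Fs e y -> x != y ->
    exists S, [/\ dl Fs S = [set x; y], dl X S = [set x; y] & ~~ bad O S].
  move=> sx sy xy; have [S dS] := sim_cut (simab _ _ sx sy) xy; exists S; split => //.
    have /andP[xX _] := nonb_blk ne sx; have /andP[yX _] := nonb_blk ne sy.
    exact: cutFs_X xX yX dS.
  by apply: contra (cut_ntriv dS); apply: (feasP _ fO).
have [Sab [dab xab oab]] := cutE _ _ sa sb ab.
have [Sbc [dbc xbc obc]] := cutE _ _ sb sc bc.
have [Sca [dca xca oca]] := cutE _ _ sc sa ca.
have sum0 p : cr p Sca = cr p Sab (+) cr p Sbc.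
  rewrite -crD; apply: Fs_inj; rewrite dca dlD dab dbc; apply/setP => z; rewrite !inE.
  by eqcases.
have Cs x y S p : sim Fs e x -> sim Fs e y -> x != y -> dl Fs S = [set x; y] ->
    p \in O -> cr p S -> p \in crossers e.
  move=> sx sy xy dS pO cp; apply: (subsetP (dl_crossers xy sx sy dS ne)).
  by rewrite in_dl pO.
(* If [p] misses a cut, the other crossing edge carries it alone, so is safe. *)
have safe_other p x y S : p \in crossers e -> sim Fs e x -> sim Fs e y -> x != y ->
    dl Fs S = [set x; y] -> ~~ bad O S -> cr p S = false ->
    exists2 q, q \in crossers e & (q != p) && (q \in sf).
  move=> pC sx sy xy dS nb cp; apply/exists_inP; apply: contraR nb => /exists_inPn no.
  have one z : z \in O -> cr z S -> z \in crossers e /\ z != p.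
    move=> zO cz; split; first exact: Cs dS zO cz.
    by apply: contraTneq cz => ->; rewrite cp.
  have /card_le1_eqP h1 : #|crossers e :\ p| <= 1.
    by move: le2; rewrite (cardsD1 p) pC; clear; lia.
  apply/badP; split => [z z' zO zO' cz cz'|z zO cz].
    have [zC zp] := one _ zO cz; have [zC' zp'] := one _ zO' cz'.
    by apply: h1; rewrite !in_setD1 ?zC ?zC' ?zp ?zp'.
  have [zC zp] := one _ zO cz; have := no _ zC; rewrite zp /=.
  by [].
have miss p : p \in crossers e -> exists2 q, q \in crossers e & (q != p) && (q \in sf).
  move=> pC; case cab : (cr p Sab); last exact: (safe_other p a b Sab).
  case cbc : (cr p Sbc); last exact: (safe_other p b c Sbc).
  by apply: (safe_other p c a Sca) => //; rewrite sum0 cab cbc.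
have allsafe p : p \in crossers e -> p \in sf.
  move=> pC; have [q qC /andP[qp qs]] := miss _ pC.
  have [r rC /andP[rq rs]] := miss _ qC.
  suff <- : r = p by [].
  have /card_le1_eqP h1 : #|crossers e :\ q| <= 1.
    by move: le2; rewrite (cardsD1 q) qC; clear; lia.
  by apply: h1; rewrite !in_setD1 ?rC ?pC ?rq // eq_sym qp.
(* Members of the block may be charged edges themselves; these are kept. *)
pose A := crossers e; pose D := blk e :\: A; pose Z := (F :|: A) :\: D.
have BX x : sim Fs e x -> x \in X by move=> sx; have /andP[] := nonb_blk ne sx.
have inA p : p \in A -> p \in Z by move=> pA; rewrite !in_setD in_setU pA orbT.
have cZ : #|Z| < #|F|.
  have sBF : blk e \subset F by apply/subsetP => x; rewrite inE => /BX/(subsetP (inv_sub iX)).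
  have k1 : #|F :\: blk e| = #|F| - 3 by rewrite cardsD (setIidPr sBF) bE c3.
  have k2 : #|(F :\: blk e) :|: A| <= #|F :\: blk e| + #|A| by apply: leq_card_setU.
  have k3 : #|Z| <= #|(F :\: blk e) :|: A|.
    apply/subset_leq_card/subsetP => z; rewrite !(in_setD, in_setU).
    by case: (z \in A); case: (z \in blk e); case: (z \in F).
  have k4 : 3 <= #|F| by rewrite -c3 -bE; apply: subset_leq_card.
  by move: le2 k1 k2 k3 k4; rewrite -/A; clear; lia.
have A20 : #|A| <= 20 by apply: leq_trans le2 _.
have D20 : #|D| <= 20.
  by apply: (@leq_trans #|blk e|); [apply/subset_leq_card/subsetDl|rewrite bE c3].
suff fZ : feas Z by have := swap_card optF A20 D20 fZ; rewrite leqNgt cZ.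
apply/feasP => S bS; have [u us] := badP _ _ bS.
have inZF z : z \in F -> z \notin blk e -> z \in Z.
  by move=> zF zB; rewrite !in_setD in_setU zF (negbTE zB) andbF.
have inZ z : z \in X -> z \notin blk e -> z \in Z.
  by move=> zX zB; apply: inZF => //; apply: (subsetP (inv_sub iX)).
(* An odd number of block members across [S] is reduced to one by adding a block cut. At most one
   edge [g] of the rest of [X] crosses as well, so [{x}] or [{x, g}] would be a cut of [X], but [x]
   is no bridge and [g] is outside the class. *)
have odd1 x T : sim Fs e x -> (forall z, z \in X -> z \notin blk e -> cr z T = cr z S) ->
    (forall z, sim Fs e z -> cr z T = (z == x)) -> False.
  move=> sx hT hB; have /andP[xX nx] := nonb_blk ne sx.
  have cx : cr x T by rewrite hB ?eqxx.
  case: (pickP [pred g | [&& g \in X, g \notin blk e & cr g S]]) => [g /and3P[gX gB cg]|no].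
    have dT : dl X T = [set x; g].
      apply/setP => z; rewrite in_dl in_set2; case: (boolP (z \in X)) => zX /=; last first.
        by apply/esym; apply: contraNF zX => /orP[]/eqP->.
      case: (boolP (z \in blk e)) => zB.
        rewrite hB; last by rewrite inE in zB.
        by case: (z =P g) => [zg|_]; rewrite ?orbF //; rewrite -zg zB in gB.
      rewrite hT //; have -> : (z == x) = false by apply: contraNF zB => /eqP->; rewrite inE.
      by apply/idP/eqP => [cz|->//]; apply: u => //; apply: inZ.
    case/negP: gB; rewrite bE inE; apply: (sim_trans (nonb_simFs ne sx)).
    by apply/simP; right; exists T.
  case/negP: nx; apply/bridgeP; exists T; apply/setP => z; rewrite in_dl in_set1.
  case: (boolP (z \in X)) => zX /=; last by apply/esym; apply: contraNF zX => /eqP->.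
  case: (boolP (z \in blk e)) => zB; first by rewrite hB //; rewrite inE in zB.
  rewrite hT //; have /= := no z; rewrite zX zB /= => ->.
  by apply/esym; apply: contraNF zB => /eqP->; rewrite inE.
(* For two members across [S], adding their cut [T] gives a closed set. A charged edge crosses [T];
   being safe, it misses the bad cut [S], so it joins components, where all edges are unsafe. *)
have even2 x y T : sim Fs e x -> sim Fs e y -> x != y -> dl Fs T = [set x; y] ->
    dl X T = [set x; y] -> ~~ bad O T -> 
    (forall z, sim Fs e z -> cr z S = (z == x) || (z == y)) -> False.
  move=> sx sy xy dT dXT nT hB.
  have K : dl X (sd S T) = set0.
    apply: (safe_bridges_closed (inv_safe_bridges iX)); apply/badP.
    have h z : z \in X -> cr z (sd S T) -> [/\ z \in Z & cr z S].
      move=> zX; rewrite crD (dl_cr dXT zX) in_set2.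
      case: (boolP (z \in blk e)) => zB; first by rewrite hB ?addbb //; rewrite inE in zB.
      have -> : (z == x) || (z == y) = false.
        by apply/negP => /orP[]/eqP zx; move: zB; rewrite zx inE ?sx ?sy.
      by rewrite addbF; split => //; apply: inZ.
    split=> [z z' zX zX' /(h _ zX)[zZ cz] /(h _ zX')[zZ' cz']|z zX /(h _ zX)[zZ cz]]; first exact: u.
    exact: us.
  have [p pO cp] : exists2 p, p \in O & cr p T.
    apply/exists_inP; apply: contraR nT => /exists_inPn no; apply: bad0; apply/setP => z.
    by rewrite !inE; apply/negP => /andP[/no/negbTE->].
  have pC : p \in crossers e by apply: Cs dT pO cp.
  have ps := allsafe _ pC.
  have np : cr p S = false.
    by apply/negP => cpS; have := us _ (inA _ pC) cpS; rewrite ps.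
  have pc : p \in cross X by apply/crossP; exists (sd S T); rewrite // crD np cp.
  by have := inv_unsafe iX pc; rewrite ps.
have mem z : sim Fs e z -> [\/ z = a, z = b | z = c].
  move=> sz; have : z \in blk e by rewrite inE.
  by rewrite -b3 !inE -orbA => /or3P[]/eqP->; [constructor 1|constructor 2|constructor 3].
have nab := negbTE ab; have nbc := negbTE bc; have nca := negbTE ca.
have nba : (b == a) = false by rewrite eq_sym.
have ncb : (c == b) = false by rewrite eq_sym.
have nac : (a == c) = false by rewrite eq_sym.
case ea : (cr a S); case eb : (cr b S); case ec : (cr c S).
- exfalso; apply: (@odd1 c (sd S Sab)) => // z.
    move=> zX zB; rewrite crD (dl_cr xab zX) in_set2.
    have -> : (z == a) || (z == b) = false.
      by apply/negP => /orP[]/eqP zx; move: zB; rewrite zx inE ?sa ?sb.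
    by rewrite addbF.
  move=> sz; rewrite crD (dl_cr xab (BX _ sz)) in_set2.
  by case: (mem _ sz) => ->; rewrite ?ea ?eb ?ec ?eqxx ?nab ?nbc ?nca ?nba ?ncb ?nac.
- exfalso; apply: (@even2 a b Sab) => // z sz.
  by case: (mem _ sz) => ->; rewrite ?ea ?eb ?ec ?eqxx ?nab ?nbc ?nca ?nba ?ncb ?nac.
- exfalso; apply: (@even2 c a Sca) => // z sz.
  by case: (mem _ sz) => ->; rewrite ?ea ?eb ?ec ?eqxx ?nab ?nbc ?nca ?nba ?ncb ?nac.
- exfalso; apply: (@odd1 a S) => // z sz.
  by case: (mem _ sz) => ->; rewrite ?ea ?eb ?ec ?eqxx ?nab ?nbc ?nca ?nba ?ncb ?nac.
- exfalso; apply: (@even2 b c Sbc) => // z sz.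
  by case: (mem _ sz) => ->; rewrite ?ea ?eb ?ec ?eqxx ?nab ?nbc ?nca ?nba ?ncb ?nac.
- exfalso; apply: (@odd1 b S) => // z sz.
  by case: (mem _ sz) => ->; rewrite ?ea ?eb ?ec ?eqxx ?nab ?nbc ?nca ?nba ?ncb ?nac.
- exfalso; apply: (@odd1 c S) => // z sz.
  by case: (mem _ sz) => ->; rewrite ?ea ?eb ?ec ?eqxx ?nab ?nbc ?nca ?nba ?ncb ?nac.
(* No member of the block crosses, so the cut is bad for [F] already. *)
apply: (feasP _ fF); apply/badP.
have h z : z \in F -> cr z S -> z \in Z.
  move=> zF cz; apply: inZF => //; apply: contraTN cz; rewrite inE => sz.
  by case: (mem _ sz) => ->; rewrite ?ea ?eb ?ec.
split=> [z z' zX zX' cz cz'|z zX cz]; first by apply: u => //; apply: h.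
by apply: us => //; apply: h.
Qed.

Lemma crossers_ge_blk e : nonb e -> small e -> #|blk e| <= #|crossers e|.
Proof.
move=> ne /orP[/eqP c3|/andP[/eqP b2 c6]]; last by rewrite b2; apply: crossers_gt1.
by rewrite cls3_blk // c3; apply: crossers_gt2.
Qed.

(* Two inequivalent blocks inside one class: one of two exchanges works, as
   otherwise three two-edge cuts through [e] would violate nestedness. *)
Lemma crossers_disj_same e e' p : nonb e -> nonb e' -> small e -> small e' ->
  p \in crossers e -> p \in crossers e' -> p \notin X -> sim X e e' -> ~~ sim Fs e e' -> False.
Proof.
move=> ne ne' ue ue' pC pC' pX se ns.
have blk2 x y : nonb x -> small x -> sim X x y -> ~~ sim Fs x y -> #|blk x| = 2.
  move=> nx /orP[/eqP c3|/andP[/eqP //]] sxy; have : y \in cls x by rewrite inE.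
  by rewrite -cls3_blk // inE => ->.
have b2 := blk2 _ _ ne ue se ns.
have b2' : #|blk e'| = 2 by apply: (blk2 e' e) => //; rewrite sim_sym.
have par2 x : nonb x -> #|blk x| = 2 -> p \in crossers x -> exists f S,
    [/\ f != x, sim Fs x f, dl Fs S = [set x; f], cr p S & forall d, sim Fs x d -> crosses_all p d].
  move=> nx bx /crossersP[_ _ [y [z [S [yz sy sz dS cp]]]]].
  have bE : [set y; z] = blk x.
    apply/eqP; rewrite eqEcard cards2 yz bx andbT; apply/subsetP => w; rewrite !inE.
    by case/orP => /eqP->.
  have ca d : sim Fs x d -> crosses_all p d.
    move=> sd_ g sg gd T dT; rewrite (@Fs_inj T S) // dT dS.
    have : d \in blk x by rewrite inE.
    have : g \in blk x by rewrite inE; apply: sim_trans sg.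
    rewrite -bE !inE; case/orP => /eqP gE; case/orP => /eqP dE; move: gd; rewrite gE dE ?eqxx // => _.
    by rewrite setUC.
  have : x \in blk x by rewrite inE sim_refl.
  rewrite -bE !inE => /orP[]/eqP xE.
    by subst y; exists z, S; split; rewrite // eq_sym.
  by subst z; exists y, S; split; rewrite // setUC.
have [f [SB [fe sf' dB cpB ca]]] := par2 _ ne b2 pC.
have [f' [SB' [fe' sf'' dB' cpB' ca']]] := par2 _ ne' b2' pC'.
have pQ : p \notin Q by case/crossersP: pC.
have nf := nonb_blk ne sf'; have nf' := nonb_blk ne' sf''.
have nsd d : sim Fs e d -> ~~ sim Fs d e'.
  by move=> sd_; apply: contra ns; apply: sim_trans.
have nsd' d g : sim Fs e d -> sim Fs e' g -> d != g.
  move=> h1 h2; apply: contraNneq ns => dg; apply: (sim_trans h1); rewrite dg sim_sym.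
  exact: h2.
have claim d : sim Fs e d -> exists S, [/\ dl X S = [set d; e'],
    forall q q', q \in Q -> q' \in Q -> par X p q -> par X p q' -> cr q S -> cr q' S -> q = q' &
    cr p S = false].
  move=> sd_; have nd := nonb_blk ne sd_.
  have de : d != e' by apply: nsd' => //; apply: sim_refl.
  have [S [H h1 _ h2]] := exchange_cut nd ne' de pX pQ (small_cls_blk ne ue sd_) (small_cls_blk ne' ue' (sim_refl Fs e')) (ca _ sd_) (ca' _ (sim_refl Fs e')).
  have dS : dl X S = [set d; e'].
    case: H => [//|[g [gX gs /andP[gd ge] dS]]].
    have sde : sim X d e'.
      by apply: sim_trans se; rewrite sim_sym; apply: nonb_simFs.
    have [T dT] := sim_cut sde de.
    by have := no_triple dS dT gd ge; rewrite (negbTE gs).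
  by exists S; split => //; apply: h2 => //; apply: nsd.
have [S [dS uS npS]] := claim e (sim_refl Fs e).
have [S' [dS' uS' npS']] := claim f sf'.
have /andP[eX nbe] := ne; have /andP[fX _] := nf.
have /andP[eX' _] := ne'; have /andP[fX' _] := nf'.
have dBX := cutFs_X eX fX dB; have dBX' := cutFs_X eX' fX' dB'.
(* The pairs [{e, e'}], [{f, e'}], [{e, f}] cancel, so [K] is closed, while [p] crosses it through
   [SB] only. Hence [p] joins components, and [Q] has two edges parallel to it. *)
pose K := sd (sd S S') SB.
have ne1 : e != e' by apply: nsd' => //; apply: sim_refl.
have ne2 : f != e' by apply: nsd' => //; apply: sim_refl.
have K0 : dl X K = set0.
  rewrite !dlD dS dS' dBX; apply/setP => z; rewrite !inE.
  by eqcases.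
have cK : cr p K by rewrite !crD npS npS' cpB.
have pc : p \in cross X by apply/crossP; exists K.
have [q1 [q2 [q12 EQ]]] := card2 (Q2 pc).
have /andP[q1Q pq1] : (q1 \in Q) && par X p q1.
  by have := set21 q1 q2; rewrite -EQ inE.
have /andP[q2Q pq2] : (q2 \in Q) && par X p q2.
  by have := set22 q1 q2; rewrite -EQ inE.
have nB q : q \in Q -> cr q SB = false /\ cr q SB' = false.
  move=> qQ; have qc := subsetP Qc _ qQ; have qFs : q \in Fs by rewrite in_setU qQ orbT.
  rewrite (dl_cr dB qFs) (dl_cr dB' qFs) !in_set2.
  by rewrite !(negbTE (cross_X qc _)).
have ck q : q \in Q -> par X p q -> cr q S' = ~~ cr q S.
  move=> qQ pq; have : cr q K by move/parP: pq => <-.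
  by rewrite !crD (nB _ qQ).1; case: (cr q S); case: (cr q S').
(* Each of [q1], [q2] crosses exactly one of [S], [S'], and neither cut is crossed by both. *)
have c21 : cr q2 S = ~~ cr q1 S.
  case h1 : (cr q1 S); case h2 : (cr q2 S) => //.
    by have := uS _ _ q1Q q2Q pq1 pq2 h1 h2 => eq; rewrite eq eqxx in q12.
  have h1' : cr q1 S' by rewrite ck // h1.
  have h2' : cr q2 S' by rewrite ck // h2.
  by have := uS' _ _ q1Q q2Q pq1 pq2 h1' h2' => eq; rewrite eq eqxx in q12.
have [T hT] := inv_class_cut iX pc.
have [W [sW eW]] : exists W, (forall z, cr z W = par X p z) /\ (en e).1 \in W.
  case: (boolP ((en e).1 \in T)) => i; first by exists T.
  by exists (~: T); split; [move=> z; rewrite crC|rewrite inE].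
have d2 : dl X (sd S SB') = [set e; f'].
  apply: (@dl_sd_pair X S SB' e' e f'); rewrite // 1?setUC //.
  by apply: nsd' => //; apply: sim_refl.
apply: (@chain_contra X e p W eX nbe pc sW eW q1 q2 f e' f' SB S (sd S SB')) => //.
- by split; rewrite // eq_sym //; apply: nsd' => //; apply: sim_refl.
- by split; [|apply: nsd'|rewrite eq_sym].
- by rewrite (nB _ q1Q).1 (nB _ q2Q).1 cpB.
- by rewrite !crD (nB _ q1Q).2 (nB _ q2Q).2 cpB' npS !addbF.
Qed.

(** If [p] is in [X], it belongs to both blocks. Otherwise it could replace one member of each,
    unless these two form a cut of [X], which puts them in one class, or do so with a third edge,
    which the last hypothesis excludes for different classes. *)
Lemma crossers_disj e e' p : nonb e -> nonb e' -> small e -> small e' ->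
  p \in crossers e -> p \in crossers e' ->
  (~~ sim X e e' -> forall d d' g S, sim X e d -> sim X e' d' -> g \in X ->
     (g != d) && (g != d') -> dl X S <> [set g; d; d']) ->
  sim Fs e e'.
Proof.
move=> ne ne' ue ue' pC pC' nofro; apply/negPn/negP => ns.
have inB x : nonb x -> p \in crossers x -> p \in X -> sim Fs x p.
  move=> nx /crossersP[_ _ [y [z [S [yz sy sz dS cp]]]]] pX.
  have pFs : p \in Fs by rewrite in_setU pX.
  by have := dl_cr dS pFs; rewrite cp in_set2 => /esym/orP[]/eqP->.
have pX : p \notin X.
  apply/negP => pX; case/negP: ns; have h1 := inB _ ne pC pX; have h2 := inB _ ne' pC' pX.
  by rewrite sim_sym in h2; apply: sim_trans h1 h2.
case: (boolP (sim X e e')) => se; first exact: (@crossers_disj_same e e' p).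
have pQ : p \notin Q by case/crossersP: pC.
have [d sd_ cd] := crosses_all_ex ne (small_blk ne ue) pC.
have [d' sd' cd'] := crosses_all_ex ne' (small_blk ne' ue') pC'.
have nd := nonb_blk ne sd_; have nd' := nonb_blk ne' sd'.
have sX := nonb_simFs ne sd_; have sX' := nonb_simFs ne' sd'.
have dd : d != d'.
  apply: contraNneq se => dd; apply: (sim_trans sX); rewrite sim_sym dd.
  exact: sX'.
have [S [H _ _ _]] := exchange_cut nd nd' dd pX pQ (small_cls_blk ne ue sd_) (small_cls_blk ne' ue' sd') cd cd'.
case: H => [dS|[g [gX _ gd dS]]]; last exact: (nofro se d d' g S).
case/negP: se; apply: (sim_trans sX); apply: (@sim_trans _ d').
  by apply/simP; right; exists S.
by rewrite sim_sym.
Qed.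

End Units.

(** * The ratio of local optima *)

Section Ratio.
Variables (F X O Q : {set E}) (v0 : V).
Hypothesis fF : feas F.
Hypothesis optF : swap_opt F.
Hypothesis iX : Inv F X.
Hypothesis nb_cut : paired X.
Hypothesis fO : feas O.
Hypothesis QO : Q \subset O.
Hypothesis Qc : Q \subset cross X.
Hypothesis Q2 : forall f, f \in cross X -> #|[set g in Q | par X f g]| = 2.
Let Fs := X :|: Q.
Local Notation cls e := [set g | sim X e g].
Local Notation blk e := [set g | sim Fs e g].
Local Notation nonb e := ((e \in X) && ~~ bridge X e).
Local Notation small := (small X Q).
Local Notation crossers := (crossers X O Q).
Hypothesis br_cut : forall b, bridge X b -> exists S, dl (X :|: cross X) S = [set b].
Hypothesis class3 : forall e, e \in X -> ~~ bridge X e -> 2 < #|cls e|.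

Let sX_refl := @sim_refl X.
Let sX_sym := @sim_sym X.
Let sX_trans := @sim_trans X.
Let sF_refl := @sim_refl Fs.
Let sF_sym := @sim_sym Fs.
Let sF_trans := @sim_trans Fs.
Let nsim := @nonb_sim X.
Let nblk := @nonb_blk X Q.
Let nsimFs := @nonb_simFs X Q.

Definition cls_rep := rep (sim X).
Definition blk_rep := rep (sim Fs).
Definition nonbridges : {set E} := [set e | nonb e].
Definition cls_reps : {set E} := [set cls_rep e | e in nonbridges].
Definition blk_reps : {set E} := [set blk_rep e | e in nonbridges].
(** A forest: a bridge has its own cut, and the cut formed by a nonbridge and the representative of
    its class contains no other edge of [rest]. *)
Definition rest : {set E} := X :\: cls_reps.

Let simrp e : sim X e (cls_rep e). Proof. exact: rep_rel. Qed.
Let simrq e : sim Fs e (blk_rep e). Proof. exact: rep_rel. Qed.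

Lemma in_nonbridges e : (e \in nonbridges) = nonb e. Proof. by rewrite inE. Qed.

Lemma cls_repsP m : m \in cls_reps -> m \in nonbridges /\ cls_rep m = m.
Proof.
case/imsetP => e; rewrite in_nonbridges => ne ->; rewrite in_nonbridges (nsim ne (simrp e)); split => //.
exact: repK.
Qed.

Lemma blk_repsP m : m \in blk_reps -> m \in nonbridges /\ blk_rep m = m.
Proof.
case/imsetP => e; rewrite in_nonbridges => ne ->; rewrite in_nonbridges (nblk ne (simrq e)); split => //.
exact: repK.
Qed.

Lemma cls_reps_X : cls_reps \subset X.
Proof. by apply/subsetP => m /cls_repsP[]; rewrite in_nonbridges => /andP[]. Qed.

Lemma blk_reps_X : blk_reps \subset X.
Proof. by apply/subsetP => m /blk_repsP[]; rewrite in_nonbridges => /andP[]. Qed.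

Lemma rest_dual e : e \in rest -> exists2 S, xpredT S & forall a, a \in rest -> cr a S = (a == e).
Proof.
rewrite in_setD => /andP[eM eX]; case: (boolP (bridge X e)) => [/bridgeP[S dS]|nb].
  by exists S => // a; rewrite in_setD => /andP[_ aX]; rewrite (dl_cr dS aX) in_set1.
have eN : e \in nonbridges by rewrite in_nonbridges eX.
have rM : cls_rep e \in cls_reps by apply: imset_f.
have er : e != cls_rep e by apply: contraNneq eM => ->.
have [S dS] := sim_cut (simrp e) er.
exists S => // a; rewrite in_setD => /andP[aM aX]; rewrite (dl_cr dS aX) in_set2.
by have -> : (a == cls_rep e) = false by [apply: contraNF aM => /eqP->]; rewrite orbF.
Qed.

(** [X] has [k.+1] components, hence rank [#|V| - k.+1]. The edges of [rest] and [Y] together are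
    independent, as [Y] has dual cuts not crossed by [rest]. *)
Lemma rank_bound k Y : #|[set S | closed X S]| = 2 ^ k.+1 -> Y \subset cls_reps ->
  (forall y, y \in Y -> exists2 S, dl rest S = set0 & dl Y S = [set y]) ->
  #|rest| + #|Y| + k.+1 <= #|V|.
Proof.
move=> ck YM dualY.
have h1 := @dual_cuts_count xpredT rest (fun _ _ _ _ => isT) rest_dual.
have Psd S T : dl rest S == set0 -> dl rest T == set0 -> dl rest (sd S T) == set0.
  by move=> /eqP h /eqP h'; rewrite dlD h h' sdxx.
have h2 := @dual_cuts_count (fun S => dl rest S == set0) Y Psd.
have {}h2 := h2 _; have h2' : forall e, e \in Y -> exists2 S, dl rest S == set0 & forall a, a \in Y -> cr a S = (a == e).
  move=> y /dualY[S dS dY]; exists S; first by rewrite dS.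
  by move=> a aY; rewrite (dl_cr dY aY) in_set1.
have {h2'}h2 := h2 h2'.
have h3 : 2 ^ k.+1 <= #|[set S | (dl rest S == set0) && (dl Y S == set0)]|.
  rewrite -ck; apply/subset_leq_card/subsetP => S; rewrite !inE => /eqP d.
  by rewrite (dlI (subsetDl X cls_reps) d) (dlI (subset_trans YM cls_reps_X) d) !set0I eqxx.
have h4 : #|[set S : {set V} | xpredT S]| = 2 ^ #|V|.
  have -> : [set S : {set V} | xpredT S] = powerset [set: V].
    by apply/setP => S; rewrite !inE subsetT.
  by rewrite card_powerset cardsT.
rewrite h4 in h1; rewrite -(@leq_exp2l 2) // !expnD; apply: leq_trans h1.
rewrite -mulnA leq_mul2l; apply/orP; right; apply: leq_trans h2.
by rewrite leq_mul2l h3 orbT.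
Qed.

(** In terms of cuts: [B] spans [G] once the edges of [rest] are contracted. *)
Definition hits (G B : {set E}) : bool :=
  [forall S, (dl rest S == set0) && (dl G S != set0) ==> (dl B S != set0)].

Lemma hitsP G B S : hits G B -> dl rest S = set0 -> dl G S != set0 -> exists2 y, y \in B & cr y S.
Proof.
move=> /forallP/(_ S)/implyP h d0 dG; have /set0Pn[y] := h (introT andP (conj (introT eqP d0) dG)).
by rewrite in_dl => /andP[yB cy]; exists y.
Qed.

(** A minimal spanning set is independent: what is lost by removing [y] is a cut that only [y]
    meets. *)
Lemma min_hits G B0 : hits G B0 -> exists Y, [/\ Y \subset B0, hits G Y &
  forall y, y \in Y -> exists2 S, dl rest S = set0 & dl Y S = [set y]].
Proof.
move=> hB; have [Y /minsetP[hY minY] sY] := minset_exists hB; exists Y; split => // y yY.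
have nh : ~~ hits G (Y :\ y).
  by apply/negP => /minY/(_ (subD1set _ _))/setP/(_ y); rewrite !inE eqxx yY.
case/forallPn: nh => S; rewrite negb_imply => /andP[/andP[/eqP d0 dG] /negbNE/eqP dY].
exists S => //; have [z zY cz] := hitsP hY d0 dG.
have e z' : z' \in Y -> cr z' S -> z' = y.
  move=> zY' cz'; apply/eqP; apply: contraTT isT => ne.
  by have := closed_cr dY (_ : z' \in Y :\ y); rewrite !inE ne zY' cz' => /(_ isT).
apply/setP => x; rewrite in_dl in_set1; apply/andP/eqP => [[]|->]; first exact: e.
by rewrite -{2}(e _ zY cz).
Qed.

Lemma cls_reps_hit : hits X cls_reps.
Proof.
apply/forallP => S; apply/implyP => /andP[/eqP d0 /set0Pn[x]]; rewrite in_dl => /andP[xX cx].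
apply/set0Pn; exists x; rewrite in_dl cx andbT; apply/negPn/negP => xM.
by have := closed_cr d0 (_ : x \in rest); rewrite in_setD xM xX cx => /(_ isT).
Qed.

Section Frozen.
(* The classes represented in [Y1] or [Y2] are frozen.  A three-edge cut of [X]
   through two other classes would meet only one of these disjoint hitting sets. *)
Variables (Y1 Y2 : {set E}).
Hypothesis Y2s : Y2 \subset cls_reps :\: Y1.
Hypothesis hY1 : hits X Y1.
Hypothesis hY2 : hits (cls_reps :\: Y1) Y2.
Hypothesis Y1s : Y1 \subset cls_reps.

(** Adding the cut formed by [x] and its representative exchanges one for the other. *)
Let to_rep x y z S : x \in nonbridges -> y \in X -> z \in X -> ~~ sim X x y -> ~~ sim X x z ->
  dl X S = [set x; y; z] -> exists S, dl X S = [set cls_rep x; y; z].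
Proof.
move=> xN yX zX xy xz dS; case: (eqVneq x (cls_rep x)) => [<-|xr]; first by exists S.
have [T dT] := sim_cut (simrp x) xr; exists (sd S T).
have ny : cls_rep x != y by apply: contraNneq xy => <-; apply: simrp.
have nz : cls_rep x != z by apply: contraNneq xz => <-; apply: simrp.
have nxy : x != y by apply: contraNneq xy => <-; apply: sX_refl.
have nxz : x != z by apply: contraNneq xz => <-; apply: sX_refl.
by rewrite dlD dS dT; apply/setP => w; rewrite !inE; eqcases.
Qed.

(** Passing to representatives gives a cut avoiding [rest], in which only the representative of [g]
    can belong to [Y1] or [Y2]. Both must meet it, the second because the representative of [d] is
    outside [Y1]; but they are disjoint. *)
Lemma no_frozen d d' g S : d \in nonbridges -> d' \in nonbridges -> ~~ sim X d d' ->
  cls_rep d \notin Y1 :|: Y2 -> cls_rep d' \notin Y1 :|: Y2 -> g \in X ->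
  (g != d) && (g != d') -> dl X S <> [set g; d; d'].
Proof.
move=> dN dN' ns fd fd' gX /andP[gd gd'] dS.
have dd : d != d' by apply: contraNneq ns => ->; apply: sX_refl.
have /andP[dX nd] : nonb d by rewrite -in_nonbridges.
have /andP[dX' nd'] : nonb d' by rewrite -in_nonbridges.
have nb : ~~ bridge X g.
  apply/negP => /bridgeP[T dT]; case/negP: ns; apply/simP; right; exists (sd S T).
  by rewrite dlD dS dT; apply/setP => w; rewrite !inE; eqcases.
have gN : g \in nonbridges by rewrite in_nonbridges gX.
have ngd : ~~ sim X g d.
  apply/negP => s; have [T dT] := sim_cut s gd; case/negP: nd'; apply/bridgeP; exists (sd S T).
  by rewrite dlD dS dT; apply/setP => w; rewrite !inE; eqcases.
have ngd' : ~~ sim X g d'.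
  apply/negP => s; have [T dT] := sim_cut s gd'; case/negP: nd; apply/bridgeP; exists (sd S T).
  by rewrite dlD dS dT; apply/setP => w; rewrite !inE; eqcases.
have rX x : x \in nonbridges -> cls_rep x \in X.
  by rewrite in_nonbridges => nx; have /andP[] := nsim nx (simrp x).
have nr x y : ~~ sim X x y -> ~~ sim X x (cls_rep y).
  by apply: contra => h; apply: (sX_trans h); rewrite sX_sym; apply: simrp.
have [S1 d1] := to_rep gN dX dX' ngd ngd' dS.
have ns' : ~~ sim X d' d by rewrite sX_sym.
have ngd2 : ~~ sim X d (cls_rep g) by apply: nr; rewrite sX_sym.
have ngd2' : ~~ sim X d' (cls_rep g) by apply: nr; rewrite sX_sym.
have d1' : dl X S1 = [set d; d'; cls_rep g] by rewrite d1; apply/setP => w; rewrite !inE; do 3!case: (w == _).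
have [S2 d2] := to_rep dN dX' (rX _ gN) ns ngd2 d1'.
have d2' : dl X S2 = [set d'; cls_rep g; cls_rep d] by rewrite d2; apply/setP => w; rewrite !inE; do 3!case: (w == _).
have [S3 d3] := to_rep dN' (rX _ gN) (rX _ dN) ngd2' (nr _ _ ns') d2'.
have dR : dl rest S3 = set0.
  rewrite (dlI (subsetDl X cls_reps) d3); apply/setP => w; rewrite !inE.
  apply/negP => /andP[/orP[/orP[]|] /eqP -> /andP[]]; by rewrite imset_f.
have onlyg y : y \in cls_reps -> y \in Y1 :|: Y2 -> cr y S3 -> y = cls_rep g.
  move=> yM yY cy; have yX := subsetP cls_reps_X _ yM.
  move: cy; rewrite (dl_cr d3 yX) !in_setU !in_set1 => /orP[/orP[]|] /eqP ye //.
    by move: fd'; rewrite -ye yY.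
  by move: fd; rewrite -ye yY.
have [y1 y1Y c1] : exists2 y, y \in Y1 & cr y S3.
  apply: (hitsP hY1 dR); apply/set0Pn; exists (cls_rep g); rewrite d3 !inE eqxx.
  by rewrite !orbT.
have e1 : y1 = cls_rep g by apply: onlyg; rewrite // ?(subsetP Y1s) // in_setU y1Y.
have rdM : cls_rep d \in cls_reps by apply: imset_f.
have [y2 y2Y c2] : exists2 y, y \in Y2 & cr y S3.
  apply: (hitsP hY2 dR); apply/set0Pn; exists (cls_rep d).
  rewrite in_dl in_setD rdM andbT; apply/andP; split; last first.
    by rewrite (dl_cr d3 (rX _ dN)) !inE eqxx !orbT.
  by move: fd; rewrite in_setU negb_or => /andP[].
have y2M := subsetP Y2s _ y2Y; rewrite in_setD in y2M; have /andP[n1 m2] := y2M.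
have e2 : y2 = cls_rep g by apply: onlyg; rewrite // in_setU y2Y orbT.
by move: n1; rewrite e2 -e1 y1Y.
Qed.

Definition is_unit s : bool := small s && (cls_rep s \notin Y1 :|: Y2).

(** An edge of [O] is charged to at most one unit, since [no_frozen] excludes the three-edge cuts
    that would permit more. *)
Lemma units_bound : \sum_(s in blk_reps | is_unit s) #|blk s| <= #|O :\: Q|.
Proof.
apply: (@leq_trans (\sum_(s in blk_reps | is_unit s) #|crossers s|)).
  apply: leq_sum => s /andP[/blk_repsP[sN _] /andP[us _]].
  rewrite in_nonbridges in sN; exact: (crossers_ge_blk fF optF iX nb_cut fO Qc Q2 sN us).
have CrO s : crossers s \subset O :\: Q by apply/subsetP => p; rewrite inE => /andP[].
have cE s : #|crossers s| = \sum_(p in O :\: Q) (p \in crossers s).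
  rewrite -sum1_card big_mkcond [RHS]big_mkcond; apply: eq_bigr => p _.
  by case: (boolP (p \in crossers s)) => [/(subsetP (CrO s))->|_] //; case: ifP.
rewrite (eq_bigr _ (fun s _ => cE s)) exchange_big /= -sum1_card; apply: leq_sum => p _.
rewrite -big_mkcondr sum1_card; apply/card_le1_eqP => s s'.
rewrite unfold_in => /andP[/andP[sM /andP[us fs]] pC].
rewrite unfold_in => /andP[/andP[sM' /andP[us' fs']] pC']; apply/esym.
have [sN rs] := blk_repsP sM; have [sN' rs'] := blk_repsP sM'.
have ns : nonb s by rewrite -in_nonbridges.
have ns' : nonb s' by rewrite -in_nonbridges.
rewrite -rs -rs'; apply: rep_eq => //.
apply: (crossers_disj fF optF iX nb_cut Qc Q2 ns ns' us us' pC pC') => nse d d' g S sd_ sd' gX gd.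
apply: no_frozen => //.
- by rewrite in_nonbridges (nsim ns sd_).
- by rewrite in_nonbridges (nsim ns' sd').
- apply: contra nse => h; apply: (sX_trans sd_); apply: (sX_trans h).
  by rewrite sX_sym.
- by rewrite /cls_rep -(rep_eq sX_refl sX_sym sX_trans sd_).
- by rewrite /cls_rep -(rep_eq sX_refl sX_sym sX_trans sd').
Qed.

Definition blks_in r : {set E} := [set s in blk_reps | cls_rep s == r].

Lemma sum_blk r : r \in cls_reps -> \sum_(s in blks_in r) #|blk s| = #|cls r|.
Proof.
move=> rM; have [rN rr] := cls_repsP rM; have nr : nonb r by rewrite -in_nonbridges.
rewrite -[RHS]sum1_card [RHS](partition_big blk_rep (mem (blks_in r))) /=; last first.
  move=> a; rewrite inE => sa; have na := nsim nr sa.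
  rewrite inE imset_f ?in_nonbridges //=; apply/eqP.
  rewrite -rr; apply/esym/rep_eq => //; apply: (sX_trans sa); apply: nsimFs na _.
  exact: simrq.
apply: eq_bigr => s; rewrite inE => /andP[sM /eqP rs]; rewrite -sum1_card.
have [sN rqs] := blk_repsP sM; have ns : nonb s by rewrite -in_nonbridges.
apply: eq_bigl => a; rewrite !inE.
have -> : (blk_rep a == s) = sim Fs s a by rewrite -{1}rqs repE // sF_sym.
case: (boolP (sim Fs s a)) => h; rewrite ?andbF ?andbT //.
apply/esym; apply: (sX_trans _ (nsimFs ns h)); rewrite sX_sym -rs; exact: simrp.
Qed.

(** With [s] elements and [j] blocks, [2 * j <= s] gives [10 + 5 * j <= 4 * s] except possibly for
    [s = 3], or for [s = 4] and [s = 6] with all blocks pairs. There either all blocks are units and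
    contribute [s], or the class is frozen and contributes 4. This fixes the threshold 6 in [small];
    equality is attained already for [s = 3]. *)
Lemma class_ineq r : r \in cls_reps -> 10 + 5 * #|blks_in r| <=
  4 * #|cls r| + (\sum_(s in blks_in r | is_unit s) #|blk s|) + 4 * (r \in Y1 :|: Y2).
Proof.
move=> rM; have [rN rr] := cls_repsP rM; have nr : nonb r by rewrite -in_nonbridges.
have /andP[rX nbr] := nr; have c3 := class3 rX nbr; have sE := sum_blk rM.
have bs s : s \in blks_in r -> 1 < #|blk s|.
  rewrite inE => /andP[/blk_repsP[]]; rewrite in_nonbridges => /andP[sX ns] _ _.
  exact: (blk_ge2 nb_cut Qc sX ns).
have cs s : s \in blks_in r -> cls s = cls r.
  by rewrite inE => /andP[_ /eqP rs]; apply/esym; rewrite -rs; apply/esym/esym/cls_eq/simrp.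
have J2 : #|blks_in r| * 2 <= #|cls r|.
  by rewrite -sE -sum_nat_const; apply: leq_sum.
case: (boolP (r \in Y1 :|: Y2)) => fr.
  by move: c3 J2; rewrite muln1; clear; lia.
rewrite muln0 addn0.
have uE s : s \in blks_in r -> is_unit s = small s.
  by rewrite inE => /andP[_ /eqP rs]; rewrite /is_unit rs fr andbT.
have full : (forall s, s \in blks_in r -> small s) -> \sum_(s in blks_in r | is_unit s) #|blk s| = #|cls r|.
  move=> h; rewrite -sE; apply: eq_bigl => s; case: (boolP (s \in blks_in r)) => // sJ.
  by rewrite uE // h.
case: (eqVneq #|cls r| 3) => [c3'|nc3].
  rewrite full; first by rewrite c3' in J2 *; move: J2; clear; lia.
  by move=> s sJ; rewrite /small (cs _ sJ) c3'.
case: (boolP ((#|blks_in r| * 2 == #|cls r|) && (#|cls r| <= 6))) => [/andP[/eqP Jc c6]|].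
  rewrite full; first by move: c3 nc3 J2 Jc c6; clear; lia.
  move=> s sJ; rewrite /small (cs _ sJ) c6 andbT; apply/orP; right.
  rewrite eqn_leq bs // andbT leqNgt; apply/negP => gt2.
  suff : #|blks_in r| * 2 < #|cls r| by rewrite Jc ltnn.
  rewrite -sE (bigD1 s) //= -sum_nat_const (bigD1 s) //= -addSn.
  by apply: leq_add => //; apply: leq_sum => t /andP[tJ _]; apply: bs.
rewrite negb_and -ltnNge => H; apply: leq_trans (leq_addr _ _).
by move: c3 nc3 J2 H; clear; lia.
Qed.

Lemma classes_ineq : 10 * #|cls_reps| + 5 * #|blk_reps| <=
  4 * #|X| + (\sum_(s in blk_reps | is_unit s) #|blk s|) + 4 * (#|Y1| + #|Y2|).
Proof.
have rpM2 s : s \in blk_reps -> cls_rep s \in cls_reps by move=> /blk_repsP[sN _]; apply: imset_f.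
have e1 : #|blk_reps| = \sum_(r in cls_reps) #|blks_in r|.
  rewrite -sum1_card (partition_big cls_rep (mem cls_reps)) //=; apply: eq_bigr => r _.
  by rewrite -sum1_card; apply: eq_bigl => s; rewrite !inE.
have e2 : \sum_(s in blk_reps | is_unit s) #|blk s| =
    \sum_(r in cls_reps) \sum_(s in blks_in r | is_unit s) #|blk s|.
  rewrite (partition_big cls_rep (mem cls_reps)) //=; last by move=> s /andP[/rpM2].
  by apply: eq_bigr => r _; apply: eq_bigl => s; rewrite !inE andbAC.
have e3 : #|nonbridges| = \sum_(r in cls_reps) #|cls r|.
  rewrite -sum1_card (partition_big cls_rep (mem cls_reps)) /=; last by move=> s sN; apply: imset_f.
  apply: eq_bigr => r rM; have [rN rr] := cls_repsP rM; rewrite -sum1_card.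
  apply: eq_bigl => a; rewrite -{1}rr [cls_rep a == _]eq_sym repE // [RHS]in_set.
  by case: (boolP (sim X r a)) => h; rewrite ?andbF // andbT in_nonbridges (nsim _ h) // -in_nonbridges.
have e4 : \sum_(r in cls_reps) (r \in Y1 :|: Y2) <= #|Y1| + #|Y2|.
  apply: (@leq_trans #|Y1 :|: Y2|); last by apply: leq_card_setU.
  rewrite -sum1_card big_mkcond [X in _ <= X]big_mkcond; apply: leq_sum => r _.
  by case: (r \in cls_reps); case: (r \in Y1 :|: Y2).
have NX : #|nonbridges| <= #|X| by apply/subset_leq_card/subsetP => e; rewrite in_nonbridges => /andP[].
have S : \sum_(r in cls_reps) (10 + 5 * #|blks_in r|) <= \sum_(r in cls_reps)
  (4 * #|cls r| + (\sum_(s in blks_in r | is_unit s) #|blk s|) + 4 * (r \in Y1 :|: Y2)).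
  by apply: leq_sum => r /class_ineq.
have SL : \sum_(r in cls_reps) (10 + 5 * #|blks_in r|) = 10 * #|cls_reps| + 5 * #|blk_reps|.
  by rewrite big_split sum_nat_const mulnC e1 [in RHS]big_distrr.
have SR : \sum_(r in cls_reps)
    (4 * #|cls r| + (\sum_(s in blks_in r | is_unit s) #|blk s|) + 4 * (r \in Y1 :|: Y2)) =
    4 * #|nonbridges| + (\sum_(s in blk_reps | is_unit s) #|blk s|) + 4 * \sum_(r in cls_reps) (r \in Y1 :|: Y2).
  by rewrite e2 e3 !big_distrr -!big_split.
rewrite SL SR in S; apply: leq_trans S _.
by apply: leq_add; [rewrite leq_add2r|]; rewrite leq_mul2l.
Qed.

End Frozen.

(** Of the ten copies of the rank bound, four are taken with [Y1], four with [Y2] and two with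
    [rest] alone. Together with the other bounds and [classes_ineq] this pays for [15 - 4 = 11]
    times [#|X|]. The [2 * k] edges of [F] outside [X] are paid by [10 * k] from the ranks and
    [6 * #|Q|], at least [12 * k]. *)
Lemma swap_opt_ratio : 11 * #|F| <= 16 * #|O|.
Proof.
have [k ck cF] := inv_card iX.
have [Y1 [Y1s hY1 Y1d]] := min_hits cls_reps_hit.
have [Y2 [Y2s hY2 Y2d]] : exists Y, [/\ Y \subset cls_reps :\: Y1, hits (cls_reps :\: Y1) Y &
    forall y, y \in Y -> exists2 S, dl rest S = set0 & dl Y S = [set y]].
  by apply: min_hits; apply/forallP => S; apply/implyP => /andP[].
have r1 := rank_bound ck Y1s Y1d.
have r2 := rank_bound ck (subset_trans Y2s (subsetDl _ _)) Y2d.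
have u := units_bound Y2s hY1 hY2 Y1s.
have s := classes_ineq Y1 Y2.
have cX : #|rest| + #|cls_reps| = #|X|.
  by have := cardsID cls_reps X; rewrite (setIidPr cls_reps_X) -/rest addnC.
have lb1 : #|V| <= #|O|.+1.
  have := @cut_count O set0 v0 fO.
  have -> : [set S | dl set0 S == set0] = powerset [set: V].
    by apply/setP => S; rewrite !inE subsetT; apply/eqP/setP => z; rewrite !inE.
  by rewrite card_powerset cardsT setD0 leq_exp2l.
(* All edges of [X] but one per block have dual cuts avoiding [Q], bridges by [br_cut]. The two
   trivial sets balance the extra factor 2 of [cut_count]. *)
have lb2 : #|X :\: blk_reps| <= #|O :\: Q|.
  have := @cut_count O Q v0 fO.
  have Psd S T : dl Q S == set0 -> dl Q T == set0 -> dl Q (sd S T) == set0.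
    by move=> /eqP h /eqP h'; rewrite dlD h h' sdxx.
  have d : forall e, e \in X :\: blk_reps -> exists2 S, dl Q S == set0 &
      forall a, a \in X :\: blk_reps -> cr a S = (a == e).
    move=> e; rewrite in_setD => /andP[eM eX]; case: (boolP (bridge X e)) => [be|nb].
      have [S dS] := br_cut be; exists S.
        apply/eqP; rewrite (dlI _ dS); last exact: subset_trans Qc (subsetUr _ _).
        apply/setP => z; rewrite !inE; apply/negP => /andP[/eqP -> eQ].
        by have := QX Qc eQ; rewrite eX.
      move=> a; rewrite in_setD => /andP[_ aX].
      have aX' : a \in X :|: cross X by rewrite in_setU aX.
      by rewrite (dl_cr dS aX') in_set1.
    have eN : e \in nonbridges by rewrite in_nonbridges eX.
    have er : e != blk_rep e by apply: contraNneq eM => ->; apply: imset_f.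
    have [S dS] := sim_cut (simrq e) er; exists S.
      apply/eqP; rewrite (dlI (subsetUr X Q) dS).
      have rX : blk_rep e \in X by apply: (subsetP blk_reps_X); apply: imset_f.
      apply/setP => z; rewrite !inE; apply/negP => /andP[zz zQ].
      by case/orP: zz => /eqP ze; have := QX Qc zQ; rewrite ze ?eX ?rX.
    move=> a; rewrite in_setD => /andP[aM aX].
    have aF : a \in Fs by rewrite in_setU aX.
    rewrite (dl_cr dS aF) in_set2.
    by have -> : (a == blk_rep e) = false by [apply: contraNF aM => /eqP->; apply: imset_f]; rewrite orbF.
  have := @dual_cuts_count (fun S => dl Q S == set0) _ Psd d.
  move=> h1 h2; have h3 := leq_trans h1 h2.
  rewrite -ltnS -(@leq_exp2l 2) // expnSr; apply: leq_trans h3.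
  rewrite leq_mul2l; apply/orP; right.
  apply: (@leq_trans #|[set set0; [set: V]]|).
    rewrite cards2; have -> // : set0 != [set: V].
    by apply/eqP => /setP/(_ v0); rewrite !inE.
  apply/subset_leq_card/subsetP => S; rewrite !inE => /orP[]/eqP ->;
    by apply/andP; split; apply/eqP/setP => z; rewrite !inE /cr !inE andbF.
have cM2 : #|X :\: blk_reps| + #|blk_reps| = #|X|.
  by have := cardsID blk_reps X; rewrite (setIidPr blk_reps_X) addnC.
have cQ : k.*2 <= #|Q|.
  have -> : k.*2 = #|F :\: X|.
    by rewrite cardsD (setIidPr (inv_sub iX)) cF addKn.
  apply: (@class_leq _ (par X)); [exact: par_refl|exact: par_sym|exact: par_trans|].
  move=> a; rewrite in_setD => /andP[aX aF]; have ac := inv_diff iX aF aX.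
  rewrite Q2 // -(inv_two iX ac); apply/subset_leq_card/subsetP => z; rewrite !inE.
  by case/andP => /andP[_ ->] ->.
have cO : #|Q| + #|O :\: Q| = #|O|.
  by have := cardsID Q O; rewrite (setIidPr QO).
move: r1 r2 u s cX lb1 lb2 cM2 cQ cO cF; clear; lia.
Qed.

End Ratio.

Theorem local_opt_ratio F X O : 0 < #|V| -> feas F -> reach F X ->
  swap_opt F ->
  (forall e, e \in X -> exists Y,
    [/\ X :\ e \subset Y, Y \subset (X :\ e) :|: cross X,
      feas ((X :\ e) :|: cross X) -> feas Y,
      forall f, f \in Y -> f \in cross X -> ~~ feas (Y :\ f) &
      feas Y -> mu F <= mu Y]) ->
  (forall e1 e2, ~~ split_ok X e1 e2) ->
  feas O -> 11 * #|F| <= 16 * #|O|.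
Proof.
move=> V0 fF rX optF H1 H2 fO; have iX := reach_Inv fF optF V0 rX.
have [v0 _] := card_gt0P V0.
have [Q [QO Qc Q2]] := class_pairs_ex iX fO.
apply: (@swap_opt_ratio F X O Q v0 fF optF iX (local_opt_paired fF iX H1) fO QO Qc Q2).
- exact: bridge_cross fF optF iX.
- exact: class3 fF iX H1 H2.
Qed.

End Cuts.

(** * A loop language and its compiler *)

Inductive expr :=
| EConst of nat
| EVar of nat
| EArr of nat & expr
| EIn of expr
| EAdd of expr & expr
| ESub of expr & expr
| EIf of expr & expr & expr
| ESum of nat & expr.

Inductive cmd :=
| Skip
| Put of nat & expr & expr
| Seq of cmd & cmd
| If of expr & cmd & cmd
| For of nat & cmd.

Definition store := nat -> nat -> nat.

Definition put (st : store) j i v : store :=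
  fun j' => if j' == j then upd (st j) i v else st j'.

Section Semantics.

Variables (N B : nat) (inp : nat -> nat).
Implicit Types (env : nat -> nat) (st : store).

Fixpoint eval e env st : nat :=
  match e with
  | EConst c => c
  | EVar x => env x
  | EArr j a => st j (eval a env st)
  (* From address [B] on the memory holds arrays, so reading the input stops there; the compiled
     code makes the same test. *)
  | EIn a => let k := eval a env st in if k < B then inp k else 0
  | EAdd a b => eval a env st + eval b env st
  | ESub a b => eval a env st - eval b env st
  | EIf a b c => if eval a env st != 0 then eval b env st else eval c env st
  | ESum x a => \sum_(i <- iota 0 N) eval a (upd env x i) st
  end.

Fixpoint sem c env st : store :=
  match c with
  | Skip => st
  | Put j a e => put st j (eval a env st) (eval e env st)
  | Seq c1 c2 => sem c2 env (sem c1 env st)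
  | If e c1 c2 => if eval e env st != 0 then sem c1 env st else sem c2 env st
  | For x c => foldl (fun s i => sem c (upd env x i) s) st (iota 0 N)
  end.

End Semantics.

(* Registers 0..3 hold 0, 1, N and the address B of the array area; loop
   variables and temporaries alternate above 8.  Cell i of array j < 16 is
   stored at address B + 16 i + j. *)
Definition vreg x := x.*2 + 8.
Definition treg d := d.*2 + 9.

Fixpoint compile_expr e d p : program :=
  match e with
  | EConst c => [:: IConst (treg d) c]
  | EVar x => [:: IAdd (treg d) (vreg x) 0]
  | EArr j a => compile_expr a d p ++
      (* Four doublings multiply the index by 16. *)
      [:: IAdd (treg d) (treg d) (treg d); IAdd (treg d) (treg d) (treg d);
          IAdd (treg d) (treg d) (treg d); IAdd (treg d) (treg d) (treg d);
          IAdd (treg d) (treg d) 3; IConst (treg d.+1) j;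
          IAdd (treg d) (treg d) (treg d.+1); ILoad (treg d) (treg d)]
  | EIn a => let ca := compile_expr a d p in let q := p + size ca in
      (* Register 0 holds 0, so [IJz 0] is an unconditional jump. *)
      ca ++ [:: ISub (treg d.+1) 3 (treg d); IJz (treg d.+1) (q + 4);
                ILoad (treg d) (treg d); IJz 0 (q + 5); IConst (treg d) 0]
  | EAdd a b => let ca := compile_expr a d p in
      ca ++ compile_expr b d.+1 (p + size ca) ++ [:: IAdd (treg d) (treg d) (treg d.+1)]
  | ESub a b => let ca := compile_expr a d p in
      ca ++ compile_expr b d.+1 (p + size ca) ++ [:: ISub (treg d) (treg d) (treg d.+1)]
  | EIf a b c => let ca := compile_expr a d p in let cb := compile_expr b d (p + size ca + 1) in
      let q := p + size ca + 1 + size cb + 1 in let ck := compile_expr c d q in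
      ca ++ [:: IJz (treg d) q] ++ cb ++ [:: IJz 0 (q + size ck)] ++ ck
  | ESum x a => let ca := compile_expr a d.+1 (p + 4) in
      [:: IConst (vreg x) 0; IConst (treg d) 0; ISub (treg d.+1) 2 (vreg x);
          IJz (treg d.+1) (p + 7 + size ca)] ++ ca ++
      [:: IAdd (treg d) (treg d) (treg d.+1); IAdd (vreg x) (vreg x) 1; IJz 0 (p + 2)]
  end.

Fixpoint compile_cmd c p : program :=
  match c with
  | Skip => [::]
  | Put j a e => let ca := compile_expr a 0 p in
      let q := p + size ca + 7 in
      ca ++ [:: IAdd (treg 0) (treg 0) (treg 0); IAdd (treg 0) (treg 0) (treg 0);
          IAdd (treg 0) (treg 0) (treg 0); IAdd (treg 0) (treg 0) (treg 0);
          IAdd (treg 0) (treg 0) 3; IConst (treg 1) j;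
          IAdd (treg 0) (treg 0) (treg 1)] ++ compile_expr e 1 q ++ [:: IStore (treg 0) (treg 1)]
  | Seq c1 c2 => let k1 := compile_cmd c1 p in k1 ++ compile_cmd c2 (p + size k1)
  | If e c1 c2 => let ca := compile_expr e 0 p in let k1 := compile_cmd c1 (p + size ca + 1) in
      let q := p + size ca + 1 + size k1 + 1 in let k2 := compile_cmd c2 q in
      ca ++ [:: IJz (treg 0) q] ++ k1 ++ [:: IJz 0 (q + size k2)] ++ k2
  | For x c => let k := compile_cmd c (p + 3) in
      [:: IConst (vreg x) 0; ISub (treg 0) 2 (vreg x); IJz (treg 0) (p + 5 + size k)] ++
      k ++ [:: IAdd (vreg x) (vreg x) 1; IJz 0 (p + 1)]
  end.

(** A bound variable must not be in scope already, since it would share its register; array numbers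
    stay below the stride 16. *)
Fixpoint wf_expr (sc : seq nat) e : bool :=
  match e with
  | EConst _ => true
  | EVar x => x \in sc
  | EArr j a => (j < 16) && wf_expr sc a
  | EIn a => wf_expr sc a
  | EAdd a b | ESub a b => wf_expr sc a && wf_expr sc b
  | EIf a b c => [&& wf_expr sc a, wf_expr sc b & wf_expr sc c]
  | ESum x a => (x \notin sc) && wf_expr (x :: sc) a
  end.

Fixpoint wf_cmd (sc : seq nat) c : bool :=
  match c with
  | Skip => true
  | Put j a e => [&& j < 16, wf_expr sc a & wf_expr sc e]
  | Seq c1 c2 => wf_cmd sc c1 && wf_cmd sc c2
  | If e c1 c2 => [&& wf_expr sc e, wf_cmd sc c1 & wf_cmd sc c2]
  | For x c => (x \notin sc) && wf_cmd (x :: sc) c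
  end.

(** An upper bound that charges both branches of a conditional, so that it depends on syntax and [N]
    only. *)
Fixpoint expr_cost N e : nat :=
  match e with
  | EConst _ | EVar _ => 1
  | EArr _ a => expr_cost N a + 8
  | EIn a => expr_cost N a + 5
  | EAdd a b | ESub a b => expr_cost N a + expr_cost N b + 1
  | EIf a b c => expr_cost N a + expr_cost N b + expr_cost N c + 2
  | ESum _ a => N * (expr_cost N a + 5) + 4
  end.

Fixpoint cmd_cost N c : nat :=
  match c with
  | Skip => 0
  | Put _ a e => expr_cost N a + expr_cost N e + 8
  | Seq c1 c2 => cmd_cost N c1 + cmd_cost N c2
  | If e c1 c2 => expr_cost N e + cmd_cost N c1 + cmd_cost N c2 + 2
  | For _ c => N * (cmd_cost N c + 4) + 3
  end.

(** * Correctness of the compiled code *)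

Definition exec (P : program) k s (Q : config -> Prop) :=
  exists2 t, t <= k & Q (iter t (step P) s).

Lemma exec_le P k k' s Q : k <= k' -> exec P k s Q -> exec P k' s Q.
Proof. by move=> le [t lt q]; exists t => //; apply: leq_trans le. Qed.

Lemma exec_stop P k s (Q : config -> Prop) : Q s -> exec P k s Q.
Proof. by move=> q; exists 0. Qed.

Lemma exec_bind P k1 k2 k s (Q1 Q2 : config -> Prop) : exec P k1 s Q1 ->
  (forall s', Q1 s' -> exec P k2 s' Q2) -> k1 + k2 <= k -> exec P k s Q2.
Proof.
move=> [t1 lt1 q1] h le; have [t2 lt2 q2] := h _ q1; exists (t2 + t1).
  by apply: leq_trans le; rewrite addnC leq_add.
by rewrite iterD.
Qed.

Lemma exec_step P k p r m i Q : onth P p = Some i ->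
  exec P k (exec_instr i (Config p r m)) Q -> exec P k.+1 (Config p r m) Q.
Proof.
move=> e [t lt q]; exists t.+1 => //.
by rewrite iterSr /step /= e.
Qed.

Fixpoint code_at (P : program) p (c : program) : Prop :=
  if c is i :: c' then onth P p = Some i /\ code_at P p.+1 c' else True.

Lemma at_cat P p a b : code_at P p (a ++ b) <-> code_at P p a /\ code_at P (p + size a) b.
Proof.
elim: a p => [|i a IH] p /=; first by rewrite addn0; tauto.
by rewrite IH addSnnS; tauto.
Qed.

Lemma at_self P pre post : code_at (pre ++ P ++ post) (size pre) P.
Proof.
elim: P pre => [//|i P IH] pre; split.
  by rewrite onth_cat ltnn subnn.
have := IH (rcons pre i); rewrite size_rcons cat_rcons; exact.
Qed.

Section Simulation.

Variables (N B : nat) (inp : nat -> nat) (P : program).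
Implicit Types (r m : nat -> nat) (env : nat -> nat) (st : store).

Definition mem_rel m st := (forall a, a < B -> m a = inp a) /\
  (forall i j, j < 16 -> m (B + 16 * i + j) = st j i).

Definition reg_rel (sc : seq nat) env r := [/\ r 0 = 0, r 1 = 1, r 2 = N, r 3 = B &
  forall x, x \in sc -> r (vreg x) = env x].

(** What code working at depth [d] must not disturb; the temporaries from [d] on and the variables
    out of scope are free. *)
Definition keep (sc : seq nat) d r r' := [/\ forall a, a < 8 -> r' a = r a,
  forall x, x \in sc -> r' (vreg x) = r (vreg x) &
  forall d', d' < d -> r' (treg d') = r (treg d')].

Lemma keep_refl sc d r : keep sc d r r. Proof. by []. Qed.

Lemma keep_trans sc d d' r r' r'' : d <= d' -> keep sc d r r' -> keep sc d' r' r'' -> keep sc d r r''.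
Proof.
move=> le [h1 h2 h3] [g1 g2 g3]; split.
- by move=> a la; rewrite g1 ?h1.
- by move=> x sx; rewrite g2 ?h2.
- by move=> x sx; rewrite g3 ?h3 //; apply: leq_trans le.
Qed.

Lemma keep_upd sc d r r' v : keep sc d r r' -> keep sc d r (upd r' (treg d) v).
Proof.
move=> [h1 h2 h3]; split.
- by move=> a la; rewrite /upd /treg; case: eqP => [|_]; [lia|apply: h1].
- by move=> a la; rewrite /upd /treg /vreg; case: eqP => [|_]; [lia|apply: h2].
- by move=> a la; rewrite /upd /treg; case: eqP => [|_]; [lia|apply: h3].
Qed.

Lemma keep_updS sc d r r' v : keep sc d r r' -> keep sc d r (upd r' (treg d.+1) v).
Proof.
move=> [h1 h2 h3]; split.
- by move=> a la; rewrite /upd /treg; case: eqP => [|_]; [lia|apply: h1].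
- by move=> a la; rewrite /upd /treg /vreg; case: eqP => [|_]; [lia|apply: h2].
- by move=> a la; rewrite /upd /treg; case: eqP => [|_]; [lia|apply: h3].
Qed.

Lemma keep_updv sc d r r' x v : x \notin sc -> keep sc d r r' -> keep sc d r (upd r' (vreg x) v).
Proof.
move=> nx [h1 h2 h3]; split.
- by move=> a la; rewrite /upd /vreg; case: eqP => [|_]; [lia|apply: h1].
- move=> a la; rewrite /upd /vreg; case: eqP => [e|_]; last exact: h2.
  by have xa : a = x by [lia]; rewrite xa (negbTE nx) in la.
- by move=> a la; rewrite /upd /treg /vreg; case: eqP => [|_]; [lia|apply: h3].
Qed.

Lemma keep_rrel sc d env r r' : keep sc d r r' -> reg_rel sc env r -> reg_rel sc env r'.
Proof.
move=> [h1 h2 h3] [g0 g1 g2 g3 gx]; split; rewrite ?h1 //.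
by move=> x sx; rewrite h2 ?gx.
Qed.

Lemma upd_eq f x v : upd f x v x = v. Proof. by rewrite /upd eqxx. Qed.
Lemma upd_tS f d v : upd f (treg d.+1) v (treg d) = f (treg d).
Proof. by rewrite /upd /treg; case: eqP => //; lia. Qed.
Lemma upd_St f d v : upd f (treg d) v (treg d.+1) = f (treg d.+1).
Proof. by rewrite /upd /treg; case: eqP => //; lia. Qed.
Lemma upd_t8 f d v a : a < 8 -> upd f (treg d) v a = f a.
Proof. by move=> la; rewrite /upd /treg; case: eqP => //; lia. Qed.
Lemma upd_v8 f x v a : a < 8 -> upd f (vreg x) v a = f a.
Proof. by move=> la; rewrite /upd /vreg; case: eqP => //; lia. Qed.
Lemma upd_vt f x v d : upd f (vreg x) v (treg d) = f (treg d).
Proof. by rewrite /upd /treg /vreg; case: eqP => //; lia. Qed.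
Lemma upd_tv f x v d : upd f (treg d) v (vreg x) = f (vreg x).
Proof. by rewrite /upd /treg /vreg; case: eqP => //; lia. Qed.

Definition updE := (upd_eq, upd_tS, upd_St, upd_vt, upd_tv).

Definition expr_post e sc d p env st r m s' := exists r', [/\
  s' = Config (p + size (compile_expr e d p)) r' m, r' (treg d) = eval N B inp e env st &
  keep sc d r r'].

Ltac stp h := eapply exec_step; [exact: h|]; rewrite /=.

Lemma compile_expr_ok e : forall sc d p env st r m, code_at P p (compile_expr e d p) -> wf_expr sc e ->
  reg_rel sc env r -> mem_rel m st ->
  exec P (expr_cost N e) (Config p r m) (expr_post e sc d p env st r m).
Proof.
elim: e => [c|x|j a IHa|a IHa|a IHa b IHb|a IHa b IHb|a IHa b IHb c IHc|x a IHa]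
    sc d p env st r m /=.
- move=> [h _] _ rr mm; stp h; apply: exec_stop; eexists; split; first by rewrite /= addn1.
    by rewrite upd_eq.
  exact/keep_upd/keep_refl.
- move=> [h _] sx rr mm; stp h; apply: exec_stop; eexists; split; first by rewrite /= addn1.
    by case: rr => [h0 _ _ _ /(_ _ sx) hx]; rewrite upd_eq h0 hx addn0.
  exact/keep_upd/keep_refl.
- move=> /at_cat[ha [h1 [h2 [h3 [h4 [h5 [h6 [h7 [h8 _]]]]]]]]] /andP[j16 wa] rr mm.
  apply: exec_bind (IHa _ _ _ _ _ _ _ ha wa rr mm) _ (leqnn _) => s' [r' [-> ra k]].
  have [r0 r1 r2 r3 rx] := keep_rrel k rr.
  stp h1; stp h2; stp h3; stp h4; stp h5; stp h6; stp h7; stp h8; apply: exec_stop.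
  eexists; split; first by rewrite size_cat /= !addnS addn0.
    rewrite !(updE, upd_t8) // ra r3 [RHS]/=; case: mm => _ /(_ (eval N B inp a env st) j j16) <-.
    by congr (m _); lia.
  do 2!apply: keep_upd; apply: keep_updS; by do 5!apply: keep_upd.
- move=> /at_cat[ha [h1 [h2 [h3 [h4 [h5 _]]]]]] wa rr mm.
  apply: exec_bind (IHa _ _ _ _ _ _ _ ha wa rr mm) _ (leqnn _) => s' [r' [-> ra k]].
  have [r0 r1 r2 r3 rx] := keep_rrel k rr.
  stp h1; stp h2; rewrite !(updE, upd_t8) // r3 ra; case: (ltnP (eval N B inp a env st) B) => lt.
    have -> : (B - eval N B inp a env st == 0) = false by apply/eqP; lia.
    stp h3; stp h4; rewrite !(updE, upd_t8) // r0 eqxx; apply: exec_stop.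
    eexists; split; first by rewrite size_cat /= addnA.
      by rewrite !(updE, upd_t8) // ra /= lt; case: mm => /(_ _ lt) ->.
    by apply: keep_upd; apply: keep_updS.
  have -> : (B - eval N B inp a env st == 0) by apply/eqP; lia.
  have h5' : onth P (p + size (compile_expr a d p) + 4) = Some (IConst (treg d) 0) by rewrite !addnS addn0.
  stp h5'; apply: exec_stop.
  eexists; split; first by rewrite /= size_cat /= addnA -addnS.
    by rewrite !(updE, upd_t8) //= ltnNge lt.
  by apply: keep_upd; apply: keep_updS.
- move=> /at_cat[ha /at_cat[hb [h1 _]]] /andP[wa wb] rr mm.
  apply: exec_bind (IHa _ _ _ _ _ _ _ ha wa rr mm) _ _ => [s' [r' [-> ra k]]|]; last first.
    by rewrite -addnA; apply: leqnn.
  apply: exec_bind (IHb _ _ _ _ _ _ _ hb wb (keep_rrel k rr) mm) _ (leqnn _) => s'' [r'' [-> rb k']].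
  stp h1; apply: exec_stop; eexists; split; first by rewrite !size_cat /= !addnA addn1.
    by rewrite updE rb; case: k' => _ _ ->; rewrite ?ra.
  by apply: keep_upd; apply: keep_trans k k'.
- move=> /at_cat[ha /at_cat[hb [h1 _]]] /andP[wa wb] rr mm.
  apply: exec_bind (IHa _ _ _ _ _ _ _ ha wa rr mm) _ _ => [s' [r' [-> ra k]]|]; last first.
    by rewrite -addnA; apply: leqnn.
  apply: exec_bind (IHb _ _ _ _ _ _ _ hb wb (keep_rrel k rr) mm) _ (leqnn _) => s'' [r'' [-> rb k']].
  stp h1; apply: exec_stop; eexists; split; first by rewrite !size_cat /= !addnA addn1.
    by rewrite updE rb; case: k' => _ _ ->; rewrite ?ra.
  by apply: keep_upd; apply: keep_trans k k'.
- set ca := compile_expr a d p; set cb := compile_expr b d _; set q := p + size ca + 1 + size cb + 1; set c' := compile_expr c d q.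
  move=> /at_cat[ha [h1 /at_cat[hb [h2 hc]]]] /and3P[wa wb wc] rr mm.
  apply: exec_bind (IHa _ _ _ _ _ _ _ ha wa rr mm) _ (_ : _ + (expr_cost N b + expr_cost N c + 2) <= _) => [s' [r' [-> ra k]]|]; last by lia.
  rewrite addnS; apply: exec_le (leqnn _) _; stp h1.
  have rr' := keep_rrel k rr.
  have pq : (p + size ca).+1 = p + size ca + 1 by rewrite addn1.
  rewrite ra; case: eqP => /= e0.
    have hc' : code_at P q c' by move: hc; rewrite /q !addn1 !addSn.
    apply: exec_bind (IHc _ _ _ _ _ _ _ hc' wc rr' mm) _ (_ : _ + 0 <= _) => [s'' [r'' [-> rc k']]|]; last by lia.
    apply: exec_stop; eexists; split; last by apply: keep_trans k k'.
      by congr Config; rewrite /= !size_cat /= !size_cat /= -/ca -/cb -/q -/c' /q; lia.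
    by rewrite /= e0.
  have hb' : code_at P (p + size ca + 1) cb by rewrite -pq.
  rewrite pq; apply: exec_bind (IHb _ _ _ _ _ _ _ hb' wb rr' mm) _ (_ : _ + 1 <= _) => [s'' [r'' [-> rb k']]|]; last by lia.
  rewrite -/cb -pq; stp h2.
  have -> : r'' 0 = 0 by have [-> ] := keep_rrel k' rr'.
  apply: exec_stop; eexists; split; last by apply: keep_trans k k'.
    by congr Config; rewrite /= !size_cat /= !size_cat /= -/ca -/cb -/q -/c' /q; lia.
  by rewrite /=; case: eqP e0.
- set ca := compile_expr a d.+1 (p + 4).
  move=> [h1 [h2 [h3 [h4 /at_cat[ha [h5 [h6 [h7 _]]]]]]]] /andP[nx wa] rr mm.
  have ha' : code_at P (p + 4) ca by rewrite !addnS addn0.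
  rewrite addnC -[4]/(2 + 2) -addnA 2!addSn; stp h1; stp h2; rewrite add0n.
  set r1 := upd (upd r (vreg x) 0) (treg d) 0.
  have k0 : keep sc d r r1 by apply/keep_upd/keep_updv.
  have v0 : r1 (vreg x) = 0 by rewrite /r1 !updE.
  have t0 : r1 (treg d) = \sum_(i <- iota 0 0) eval N B inp a (upd env x i) st.
    by rewrite /r1 !updE big_nil.
  suff loop n : forall i r1, keep sc d r r1 -> r1 (vreg x) = i ->
      r1 (treg d) = \sum_(i <- iota 0 i) eval N B inp a (upd env x i) st -> i + n = N ->
      exec P (2 + n * (expr_cost N a + 5)) (Config p.+2 r1 m) (expr_post (ESum x a) sc d p env st r m).
    exact: loop k0 v0 t0 (add0n N).
  clear r1 k0 v0 t0; elim: n => [|n IHn] i r1 k vx accept iN.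
    have [z0 z1 z2 z3 zx] := keep_rrel k rr.
    stp h3; stp h4; rewrite !(updE, upd_t8) // z2 vx.
    have -> : (N - i == 0) by apply/eqP; lia.
    apply: exec_stop; eexists; split; first by congr Config; rewrite /= size_cat /= -/ca; lia.
      by rewrite updE accept; have -> : N = i by lia.
    exact: keep_updS.
  have [z0 z1 z2 z3 zx] := keep_rrel k rr.
  have -> : 2 + n.+1 * (expr_cost N a + 5) = (2 + n * (expr_cost N a + 5)).+2 + (expr_cost N a + 3) by lia.
  rewrite 2!addSn; stp h3; stp h4; rewrite !(updE, upd_t8) // z2 vx.
  have -> : (N - i == 0) = false by apply/eqP; lia.
  have rr' : reg_rel (x :: sc) (upd env x i) (upd r1 (treg d.+1) (N - i)).
    split; rewrite ?upd_t8 // => y; rewrite inE; case: eqP => /= [-> _|ne sy].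
      by rewrite !updE.
    by rewrite !updE zx // /upd; case: eqP.
  have -> : p.+4 = p + 4 by lia.
  apply: exec_bind (IHa _ _ _ _ _ _ _ ha' wa rr' mm) _ (_ : _ + (3 + (2 + n * (expr_cost N a + 5))) <= _) => [s' [r2 [-> ra k2]]|]; last by lia.
  have e4 : p + 4 + size ca = p.+4 + size ca by lia.
  rewrite -/ca e4 3!addSn; stp h5; stp h6; stp h7; rewrite add0n.
  case: (k2) => k21 k22 k23.
  have r20 : r2 0 = 0 by rewrite k21 // upd_t8.
  have r21 : r2 1 = 1 by rewrite k21 // upd_t8.
  rewrite !(updE, upd_t8, upd_v8) // r20 eqxx.
  have -> : p + 2 = p.+2 by lia.
  apply: (IHn i.+1) => //; last by lia.
  - apply: keep_updv => //; apply: keep_upd; apply: (@keep_trans sc d d r (upd r1 (treg d.+1) (N - i)) r2) => //.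
      exact: keep_updS k.
    split; first exact: k21.
      by move=> y sy; apply: k22; rewrite inE sy orbT.
    by move=> y sy; apply: k23; apply: leqW.
  - rewrite !updE k22 ?mem_head // updE vx r21 ?addn1 //.
  - rewrite !updE ra k23 // updE accept -[in RHS]addn1 iotaD big_cat /= add0n big_cons big_nil addn0.
    by [].
Qed.

Definition cmd_post c sc p env st r s' := exists r' m', [/\
  s' = Config (p + size (compile_cmd c p)) r' m', mem_rel m' (sem N B inp c env st) &
  keep sc 0 r r'].

Lemma mem_rel_put m st j i v : j < 16 -> mem_rel m st ->
  mem_rel (upd m (B + 16 * i + j) v) (put st j i v).
Proof.
move=> j16 [h1 h2]; split => [a la|i' j' j16'].
  by rewrite /upd; case: eqP => [|_]; [lia|apply: h1].
rewrite /put /upd; case: (j' =P j) => [->|nj].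
  case: (i' =P i) => [->|ni]; first by rewrite eqxx.
  by case: eqP => [|_]; [lia|apply: h2].
by case: eqP => [|_]; [lia|apply: h2].
Qed.

Lemma compile_cmd_ok c : forall sc p env st r m, code_at P p (compile_cmd c p) -> wf_cmd sc c ->
  reg_rel sc env r -> mem_rel m st ->
  exec P (cmd_cost N c) (Config p r m) (cmd_post c sc p env st r).
Proof.
elim: c => [|j a e|c1 IH1 c2 IH2|e c1 IH1 c2 IH2|x c IH] sc p env st r m /=.
- by move=> _ _ rr mm; apply: exec_stop; exists r, m; rewrite addn0.
- set ca := compile_expr a 0 p; set q := p + size ca + 7.
  move=> /at_cat[ha [h1 [h2 [h3 [h4 [h5 [h6 [h7 /at_cat[he [h8 _]]]]]]]]]] /and3P[j16 wa we] rr mm.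
  apply: exec_bind (compile_expr_ok ha wa rr mm) _ (_ : _ + (expr_cost N e + 8) <= _) => [s' [r' [-> ra k]]|]; last by lia.
  have [r0 r1 r2 r3 rx] := keep_rrel k rr.
  rewrite [expr_cost N e + 8]addnC; stp h1; stp h2; stp h3; stp h4; stp h5; stp h6; stp h7.
  set r2' := upd _ (treg 0) _.
  have k2 : keep sc 0 r r2'.
    apply: keep_upd; apply: keep_updS; by do 5!apply: keep_upd.
  have a2 : r2' (treg 0) = B + 16 * eval N B inp a env st + j.
    by rewrite /r2' !(updE, upd_t8) // ra r3; lia.
  have pq : (p + size ca).+3.+4 = q by rewrite /q !addnS addn0.
  rewrite -/ca pq.
  have he' : code_at P q (compile_expr e 1 q) by rewrite -{1}pq.
  apply: exec_bind (compile_expr_ok he' we (keep_rrel k2 rr) mm) _ (_ : _ + 1 <= _) => [s'' [r3' [-> re k3]]|]; last by lia.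
  have h8' : onth P (q + size (compile_expr e 1 q)) = Some (IStore (treg 0) (treg 1)).
    by rewrite -{1}pq.
  stp h8'; apply: exec_stop; eexists; eexists; split; first by congr Config; rewrite /= !size_cat /= !size_cat /= -/ca -/q /q; lia.
    case: (k3) => _ _ k33; rewrite re k33 // a2; exact: mem_rel_put.
  apply: (keep_trans (d' := 0)) k2 _ => //; case: k3 => z1 z2 z3; split => //.
- move=> /at_cat[h1 h2] /andP[w1 w2] rr mm.
  apply: exec_bind (IH1 _ _ _ _ _ _ h1 w1 rr mm) _ (leqnn _) => s' [r' [m' [-> mm' k]]].
  have [t lt [r'' [m'' [e mm'' k']]]] := IH2 _ _ _ _ _ _ h2 w2 (keep_rrel k rr) mm'.
  exists t => //; exists r'', m''; split => //; first by rewrite e size_cat addnA.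
  exact: keep_trans k k'.
- set ca := compile_expr e 0 p; set k1 := compile_cmd c1 _; set q := p + size ca + 1 + size k1 + 1; set k2 := compile_cmd c2 q.
  move=> /at_cat[ha [h1 /at_cat[hb [h2 hc]]]] /and3P[wa wb wc] rr mm.
  apply: exec_bind (compile_expr_ok ha wa rr mm) _ (_ : _ + (cmd_cost N c1 + cmd_cost N c2 + 2) <= _) => [s' [r' [-> ra k]]|]; last by lia.
  rewrite addnS; stp h1.
  have rr' := keep_rrel k rr.
  have pq : (p + size ca).+1 = p + size ca + 1 by rewrite addn1.
  rewrite ra; case: (eval N B inp e env st =P 0) => /= e0.
    have hc' : code_at P q k2 by move: hc; rewrite /q !addn1 !addSn.
    apply: exec_bind (IH2 _ _ _ _ _ _ hc' wc rr' mm) _ (_ : _ + 0 <= _) => [s'' [r'' [m'' [-> mm'' k']]]|]; last by lia.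
    apply: exec_stop; exists r'', m''; split; last by apply: keep_trans k k'.
      by congr Config; rewrite /= !size_cat /= !size_cat /= -/ca -/k1 -/q -/k2 /q; lia.
    by rewrite /= e0.
  have hb' : code_at P (p + size ca + 1) k1 by rewrite -pq.
  rewrite pq; apply: exec_bind (IH1 _ _ _ _ _ _ hb' wb rr' mm) _ (_ : _ + 1 <= _) => [s'' [r'' [m'' [-> mm'' k']]]|]; last by lia.
  rewrite -/k1 -pq; stp h2.
  have -> : r'' 0 = 0 by have [-> ] := keep_rrel k' rr'.
  apply: exec_stop; exists r'', m''; split; last by apply: keep_trans k k'.
    by congr Config; rewrite /= !size_cat /= !size_cat /= -/ca -/k1 -/q -/k2 /q; lia.
  by rewrite /=; case: eqP e0.
- set kc := compile_cmd c (p + 3).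
  move=> [h1 [h2 [h3 /at_cat[ha [h5 [h6 _]]]]]] /andP[nx wa] rr mm.
  have ha' : code_at P (p + 3) kc by rewrite !addnS addn0.
  rewrite addnS; stp h1.
  set r1 := upd r (vreg x) 0.
  have k1 : keep sc 0 r r1 by apply/keep_updv.
  have v1 : r1 (vreg x) = 0 by rewrite /r1 !updE.
  suff loop n : forall i r1 st' m, keep sc 0 r r1 -> r1 (vreg x) = i -> mem_rel m st' ->
      i + n = N -> exec P (n * (cmd_cost N c + 4) + 2) (Config p.+1 r1 m)
      (fun s' => exists r' m', [/\ s' = Config (p + 5 + size kc) r' m',
        mem_rel m' (foldl (fun s i => sem N B inp c (upd env x i) s) st' (iota i n)) &
        keep sc 0 r r']).
    have [t lt [r' [m' [e1 e2 e3]]]] := loop N 0 r1 st m k1 v1 mm (add0n N).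
    exists t => //; exists r', m'; split => //.
    by rewrite e1 /= -/kc size_cat /=; congr Config; lia.
  clear r1 k1 v1 st m mm; elim: n => [|n IHn] i r1 st m k vx mm iN.
    have [z0 z1 z2 z3 zx] := keep_rrel k rr.
    stp h2; stp h3; rewrite !(updE, upd_t8) // z2 vx.
    have -> : (N - i == 0) by apply/eqP; lia.
    apply: exec_stop; exists (upd r1 (treg 0) (N - i)), m; split => //; exact: keep_upd.
  have [z0 z1 z2 z3 zx] := keep_rrel k rr.
  have -> : n.+1 * (cmd_cost N c + 4) + 2 = (n * (cmd_cost N c + 4) + 4 + cmd_cost N c).+2 by lia.
  stp h2; stp h3; rewrite !(updE, upd_t8) // z2 vx.
  have -> : (N - i == 0) = false by apply/eqP; lia.
  have rr' : reg_rel (x :: sc) (upd env x i) (upd r1 (treg 0) (N - i)).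
    split; rewrite ?upd_t8 // => y; rewrite inE; case: eqP => /= [-> _|ne sy].
      by rewrite !updE.
    by rewrite !updE zx // /upd; case: eqP.
  have -> : p.+3 = p + 3 by lia.
  apply: exec_bind (IH _ _ _ _ _ _ ha' wa rr' mm) _ (_ : _ + (2 + (n * (cmd_cost N c + 4) + 2)) <= _) => [s' [r2 [m2 [-> mm2 k2]]]|]; last by lia.
  have e4 : p + 3 + size kc = p.+3 + size kc by lia.
  rewrite -/kc e4 2!addSn; stp h5; stp h6; rewrite add0n.
  case: (k2) => k21 k22 k23.
  have r20 : r2 0 = 0 by rewrite k21 // upd_t8.
  have r21 : r2 1 = 1 by rewrite k21 // upd_t8.
  rewrite !(updE, upd_t8, upd_v8) // r20 eqxx.
  have -> : p + 1 = p.+1 by lia.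
  apply: (IHn i.+1) => //.
  - apply: keep_updv => //; apply: (@keep_trans sc 0 0 r (upd r1 (treg 0) (N - i)) r2) => //.
      exact: keep_upd k.
    split; first exact: k21.
      by move=> y sy; apply: k22; rewrite inE sy orbT.
    by [].
  - rewrite !updE k22 ?mem_head // updE vx r21 ?addn1 //.
  - by lia.
Qed.

End Simulation.

(** Sets [N] to the number of vertices plus edges and [B] to three times the number of edges plus 2,
    the length of the encoding. *)
Definition prologue : program :=
  [:: IConst 1 1; ILoad 4 0; ILoad 5 1; IAdd 2 4 5; IAdd 3 5 5; IAdd 3 3 5;
      IAdd 3 3 1; IAdd 3 3 1].

(** The copy overwrites the input only: its targets are below [B] and the array lies from [B] on. *)
Definition epilogue j q : program :=
  [:: IConst 4 0; IConst 6 j; IAdd 6 6 3; ISub 7 5 4; IJz 7 (q + 11); ILoad 7 6;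
      IStore 4 7; IAdd 4 4 1; IConst 7 16; IAdd 6 6 7; IJz 0 (q + 3)].

Definition compile j c : program :=
  let k := compile_cmd c 8 in prologue ++ k ++ epilogue j (8 + size k).

Section Whole.

Variables (n m j : nat) (input : seq nat) (c : cmd).
Hypothesis sin : size input = 2 + 3 * m.
Hypothesis in0 : nth 0 input 0 = n.
Hypothesis in1 : nth 0 input 1 = m.
Hypothesis wc : wf_cmd [::] c.
Hypothesis j16 : j < 16.
Let N := n + m.
Let B := 2 + 3 * m.
Let P := compile j c.
Let fin := sem N B (nth 0 input) c (fun=> 0) (fun _ _ => 0).

(** Besides the command, the prologue takes eight steps, the epilogue three to start, eight per cell
    and two for the last test. *)
Lemma compile_ok : exec P (cmd_cost N c + 8 * m + 13) (initial input)
  (fun s => halted P s /\ forall i, i < m -> memory s i = fin j i).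
Proof.
have hp : code_at P 0 prologue by have := at_self prologue [::] (compile_cmd c 8 ++ epilogue j (8 + size (compile_cmd c 8))).
have hc : code_at P 8 (compile_cmd c 8) by have := at_self (compile_cmd c 8) prologue (epilogue j (8 + size (compile_cmd c 8))).
have he : code_at P (8 + size (compile_cmd c 8)) (epilogue j (8 + size (compile_cmd c 8))).
  have := at_self (epilogue j (8 + size (compile_cmd c 8))) (prologue ++ compile_cmd c 8) [::].
  by rewrite cats0 size_cat /P /compile catA.
move: hp => [p1 [p2 [p3 [p4 [p5 [p6 [p7 [p8 _]]]]]]]].
have -> : cmd_cost N c + 8 * m + 13 = (cmd_cost N c + 8 * m + 5).+4.+4 by lia.
rewrite /initial.
eapply exec_step; [exact: p1|]; eapply exec_step; [exact: p2|]; eapply exec_step; [exact: p3|].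
eapply exec_step; [exact: p4|]; eapply exec_step; [exact: p5|]; eapply exec_step; [exact: p6|].
eapply exec_step; [exact: p7|]; eapply exec_step; [exact: p8|]; rewrite /=.
set r := upd _ 3 _.
have r0 : r 0 = 0 by [].
have r1 : r 1 = 1 by [].
have r5 : r 5 = m by rewrite /r /upd /= in1.
have r2 : r 2 = N by rewrite /r /upd /= in1 in0.
have r3 : r 3 = B by rewrite /r /upd /= in1 /B; lia.
have rr : reg_rel N B [::] (fun=> 0) r by [].
have mm : mem_rel B (nth 0 input) (nth 0 input) (fun _ _ => 0).
  by split => // i j' _; rewrite nth_default // sin /B; lia.
have E : fin = sem N B (nth 0 input) c (fun=> 0) (fun _ _ => 0) by [].
apply: exec_bind (compile_cmd_ok hc wc rr mm) _ (_ : _ + (8 * m + 5) <= _) => [s [r' [m' [-> mm' k]]]|]; last by lia.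
rewrite -E in mm'; case: k => k1 _ _.
set q := 8 + size (compile_cmd c 8); rewrite -/q in he *.
move: he => [h1 [h2 [h3 [h4 [h5 [h6 [h7 [h8 [h9 [h10 [h11 _]]]]]]]]]]].
have sP : size P = q + 11 by rewrite /P /compile !size_cat /= -/q addnA.
have -> : 8 * m + 5 = (8 * m + 2).+3 by lia.
eapply exec_step; [exact: h1|]; eapply exec_step; [exact: h2|]; eapply exec_step; [exact: h3|]; rewrite /=.
set r4 := upd _ 6 _.
have q0 : r4 0 = 0 by rewrite /r4 /upd /= k1.
have q1 : r4 1 = 1 by rewrite /r4 /upd /= k1.
have q5 : r4 5 = m by rewrite /r4 /upd /= k1.
have q4 : r4 4 = 0 by [].
have q6 : r4 6 = B + 16 * 0 + j by rewrite /r4 /upd /= k1 // r3; lia.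
case: mm' => _ mm'.
have a0 i : m' (B + 16 * i + j) = fin j i by apply: mm'.
suff loop k : forall i r4 m', r4 0 = 0 -> r4 1 = 1 -> r4 5 = m -> r4 4 = i ->
    r4 6 = B + 16 * i + j -> (forall i', i' < i -> m' i' = fin j i') ->
    (forall i', m' (B + 16 * i' + j) = fin j i') -> i + k = m ->
    exec P (8 * k + 2) (Config q.+3 r4 m')
      (fun s => halted P s /\ forall i, i < m -> memory s i = fin j i).
  exact: (loop m 0 r4 m').
clear r4 q0 q1 q5 q4 q6 a0 mm' m' k1.
elim: k => [|k IH] i r4 m' q0 q1 q5 q4 q6 hi a0 e0.
  eapply exec_step; [exact: h4|]; eapply exec_step; [exact: h5|]; rewrite /=.
  rewrite /upd /= q5 q4; have -> : (m - i == 0) by apply/eqP; lia.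
  by apply: exec_stop; split; [rewrite /halted sP /=|move=> i' li; apply: hi; lia].
have -> : 8 * k.+1 + 2 = (8 * k + 2).+4.+4 by lia.
eapply exec_step; [exact: h4|]; eapply exec_step; [exact: h5|]; rewrite /=.
rewrite {1}/upd /= q5 q4; have -> : (m - i == 0) = false by apply/eqP; lia.
eapply exec_step; [exact: h6|]; eapply exec_step; [exact: h7|]; eapply exec_step; [exact: h8|].
eapply exec_step; [exact: h9|]; eapply exec_step; [exact: h10|]; eapply exec_step; [exact: h11|].
rewrite /=; set r5' := upd _ 6 _; set m2 := upd m' _ _.
have -> : r5' 0 == 0 by rewrite /r5' /upd /= q0.
have -> : q + 3 = q.+3 by rewrite !addnS addn0.
have m2E : m2 = upd m' i (fin j i) by rewrite /m2 /upd /= q4 q6 a0.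
apply: (IH i.+1) => //.
- by rewrite /r5' /upd /= q4 q1 addn1.
- by rewrite /r5' /upd /= q6; lia.
- move=> i' li; rewrite m2E /upd; case: eqP => [->//|ne]; apply: hi; lia.
- move=> i'; rewrite m2E /upd; case: eqP => [|_]; [rewrite /B; lia|exact: a0].
- by lia.
Qed.

End Whole.

(** * Polynomial bounds on the running time *)

Definition poly (f : nat -> nat) := exists C k, forall N, f N <= C * N.+1 ^ k.

Lemma poly_const c : poly (fun=> c).
Proof. by exists c, 0 => N; rewrite muln1. Qed.

(** The base [N.+1] is positive, so both exponents may be raised to their sum. *)
Lemma poly_add f g : poly f -> poly g -> poly (fun N => f N + g N).
Proof.
move=> [C [k hf]] [D [l hg]]; exists (C + D), (k + l) => N; rewrite mulnDl.
have p a : 0 < N.+1 ^ a by rewrite expn_gt0.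
apply: leq_add; [apply: leq_trans (hf N) _|apply: leq_trans (hg N) _]; rewrite leq_mul2l expnD.
  by rewrite leq_pmulr ?orbT.
by rewrite leq_pmull ?orbT.
Qed.

Lemma poly_mulN f : poly f -> poly (fun N => N * f N).
Proof.
move=> [C [k hf]]; exists C, k.+1 => N; rewrite expnS mulnCA.
by apply: leq_mul.
Qed.

Lemma poly_expr_cost e : poly (expr_cost^~ e).
Proof.
elim: e => [c|x|j a ha|a ha|a ha b hb|a ha b hb|a ha b hb c hc|x a ha] /=;
  rewrite /poly_const; do ?[apply: poly_const | apply: poly_add => // | apply: poly_mulN].
Qed.

Lemma poly_cmd_cost c : poly (cmd_cost^~ c).
Proof.
elim: c => [|j a e|c1 h1 c2 h2|e c1 h1 c2 h2|x c h] /=;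
  do ?[apply: poly_const | apply: poly_expr_cost | apply: poly_add => // | apply: poly_mulN].
Qed.

(** * Connectivity and cuts of the instance *)

Section GraphCuts.

Variable I : fgc.
Local Notation V := 'I_(nverts I).
Local Notation E := 'I_(nedges I).
Local Notation en := (@ends I).
Local Notation dl := (dl en).
Local Notation cr := (cr en).
Implicit Types (X : {set E}) (S : {set V}) (u v : V).

Lemma adj_sym X : symmetric (adj X).
Proof. by move=> u v; apply: eq_existsb => e; rewrite orbC. Qed.

Lemma adjP X u v : reflect (exists2 e, e \in X & en e = (u, v) \/ en e = (v, u)) (adj X u v).
Proof.
apply: (iffP exists_inP) => -[e eX h]; exists e => //.
  by case/orP: h => /eqP ->; [left|right].
by case: h => ->; rewrite eqxx ?orbT.
Qed.

Lemma closed_adj X S u v : dl X S = set0 -> adj X u v -> (u \in S) = (v \in S).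
Proof.
move=> d /adjP[e eX h]; have := closed_cr d eX; rewrite /cr.
by case: h => -> /=; do 2!case: (_ \in S).
Qed.

(** A set not crossed by [X] is closed under adjacency; conversely, the set reachable from [u] is
    not crossed. *)
Lemma connect_cut X u v :
  connect (adj X) u v = [forall S, (dl X S == set0) ==> (u \in S) ==> (v \in S)].
Proof.
apply/idP/forallP => [/connectP[p pth ->] S|h].
  apply/implyP => /eqP d; elim: p u pth => [|w p IH] u /=; first by rewrite implybb.
  by case/andP => /(closed_adj d) -> /IH.
have /implyP := h [set w | connect (adj X) u w]; rewrite !inE connect0 /=; apply.
apply/eqP/setP => e; rewrite !inE /cr !inE; apply/negP => /andP[eX].
have a12 : adj X (en e).1 (en e).2.
  by apply/adjP; exists e => //; left; case: (en e).
suff -> : connect (adj X) u (en e).1 = connect (adj X) u (en e).2 by rewrite addbb.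
apply/idP/idP => c; apply: connect_trans c (connect1 _) => //.
by rewrite adj_sym.
Qed.

Lemma spans_cut X : reflect (forall S, dl X S = set0 -> triv S) (spans_connected X).
Proof.
apply: (iffP forallP) => [h S d|h u].
  case: (set_0Vmem S) => [->|[u uS]]; first by rewrite /triv eqxx.
  suff -> : S = setT by rewrite /triv eqxx orbT.
  apply/setP => v; rewrite inE; have /forallP/(_ v) := h u.
  by rewrite connect_cut => /forallP/(_ S); rewrite d eqxx uS.
apply/forallP => v; rewrite connect_cut; apply/forallP => S; apply/implyP => /eqP/h.
by case/orP => /eqP ->; rewrite !inE.
Qed.

Lemma feasible_feas X : feasible X = feas en (safe I) X.
Proof.
apply/andP/idP => [[/spans_cut c1 /forall_inP c2]|fX].
  apply/feasP => S /badE[/c1//|[g gs d]].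
  have gX : g \in X by have := dl_sub d; rewrite sub1set.
  have /spans_cut : spans_connected (X :\ g) by apply: c2; rewrite !inE gX.
  apply; rewrite (dlI (subD1set X g) d); apply/setP => z; rewrite !inE.
  by case: (z == g).
split; first by apply/spans_cut => S d; apply: (feasP _ _ _ fX); apply: bad0.
apply/forall_inP => e; rewrite !inE => /andP[eX es]; apply/spans_cut => S d.
apply: (feasP _ _ _ fX); apply/badP.
have h z : z \in X -> cr z S -> z = e.
  move=> zX cz; apply/eqP; apply: contraTT cz => ze.
  by rewrite (closed_cr d) // !inE ze.
by split=> [a b aX bX ca cb|a aX ca]; [rewrite (h a aX ca) (h b bX cb)|rewrite (h a aX ca)].
Qed.

Lemma connect_ends X e : ~~ connect (adj X) (en e).1 (en e).2 = (e \in cross en X).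
Proof.
rewrite connect_cut; apply/forallPn/crossP => [[S]|[S d c]].
  rewrite !negb_imply => /and3P[/eqP d h1 h2]; exists S => //.
  by rewrite /cr h1 (negbTE h2).
move: c; rewrite /cr; case h1: ((en e).1 \in S) => /= h2.
  by exists S; rewrite !negb_imply d eqxx h1 (negbTE h2).
by exists (~: S); rewrite !negb_imply dlC d eqxx !inE h1 h2.
Qed.

(** With [connect_ends], one graph search per edge decides both [bridge] and [cross]. *)
Lemma bridge_cross_D1 X e : bridge en X e = (e \in X) && (e \in cross en (X :\ e)).
Proof.
apply/bridgeP/andP => [[S d]|[eX /crossP[S d c]]].
  have [eX c] := dl_crT d (set11 e); split => //; apply/crossP; exists S => //.
  rewrite (dlI (subD1set X e) d); apply/setP => z; rewrite !inE.
  by case: (z == e).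
exists S; apply/setP => z; rewrite !inE; case: (eqVneq z e) => [->|ze]; first by rewrite eX.
by apply/negP => /andP[zX]; rewrite (closed_cr d) // !inE ze.
Qed.

Definition grow X (A : {set V}) : {set V} := A :|: [set v | [exists u in A, adj X u v]].

(** A path without repeated vertices has fewer edges than the graph has vertices, so that many
    rounds of breadth-first search suffice. *)
Lemma grow_connect X u k v : nverts I <= k -> (v \in iter k (grow X) [set u]) = connect (adj X) u v.
Proof.
move=> nk; apply/idP/idP.
  elim: k v {nk} => [|k IH] v /=; first by rewrite inE => /eqP ->.
  rewrite !inE => /orP[/IH//|/exists_inP[w /IH c a]].
  by apply: connect_trans c (connect1 a).
move=> /connectP[p0 /shortenP[p pth up _] ->].
have sp : size p <= k.
  have := max_card (mem (u :: p)); rewrite (card_uniqP up) card_ord /= => lt.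
  by apply: leq_trans nk; apply: ltnW.
have mono (A : {set V}) j : A \subset iter j (grow X) A.
  by elim: j => [//|j IH] /=; apply: subset_trans IH (subsetUl _ _).
rewrite -(subnK sp) iterD; apply: (subsetP (mono _ _)).
elim/last_ind: p pth {sp up} => [|p w IH]; first by rewrite /= inE.
rewrite rcons_path last_rcons size_rcons => /andP[pth a] /=.
by rewrite !inE; apply/orP; right; apply/exists_inP; exists (last u p) => //; apply: IH.
Qed.

Lemma nth_triples (T : Type) (a b c : T -> nat) (s : seq T) x0 i : i < size s ->
  let l := flatten [seq [:: a x; b x; c x] | x <- s] in
  [/\ nth 0 l (3 * i) = a (nth x0 s i), nth 0 l (3 * i + 1) = b (nth x0 s i) &
      nth 0 l (3 * i + 2) = c (nth x0 s i)].
Proof.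
elim: s i => // x s IH [|i] lt //; have [h1 h2 h3] := IH i lt.
have e3 : 3 * i.+1 = (3 * i).+3 by lia.
by rewrite e3 !addSn /= -h1 -h2 -h3.
Qed.

Lemma size_encode : size (encode I) = 2 + 3 * nedges I.
Proof.
rewrite /encode size_cat /=; congr (_ + _).
rewrite -[in RHS](size_enum_ord (nedges I)); elim: (enum _) => //= x s ->.
by lia.
Qed.

Lemma encode_edge (e : E) : [/\ nth 0 (encode I) (2 + 3 * e) = (en e).1,
  nth 0 (encode I) (3 + 3 * e) = (en e).2 & nth 0 (encode I) (4 + 3 * e) = (e \in safe I)].
Proof.
have lt : e < size (enum 'I_(nedges I)) by rewrite size_enum_ord.
have [h1 h2 h3] := nth_triples (fun e => nat_of_ord (en e).1) (fun e => nat_of_ord (en e).2)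
  (fun e => nat_of_bool (e \in safe I)) e lt.
rewrite nth_ord_enum in h1 h2 h3; rewrite -h1 -h2 -h3 /encode !nth_cat /=.
by split; congr (nth 0 _ _); lia.
Qed.

End GraphCuts.

(** * Reasoning about loop programs *)

Section Frames.

Variables (N B : nat) (inp : nat -> nat).
Local Notation eval := (eval N B inp).
Local Notation sem := (sem N B inp).
Implicit Types (env : nat -> nat) (st : store) (c : cmd).

Fixpoint reads j e : bool :=
  match e with
  | EConst _ | EVar _ => false
  | EArr j' a => (j' == j) || reads j a
  | EIn a => reads j a
  | EAdd a b | ESub a b => reads j a || reads j b
  | EIf a b c => [|| reads j a, reads j b | reads j c]
  | ESum _ a => reads j a
  end.

Fixpoint writes j c : bool :=
  match c with
  | Skip => false
  | Put j' _ _ => j' == j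
  | Seq c1 c2 | If _ c1 c2 => writes j c1 || writes j c2
  | For _ c => writes j c
  end.

Lemma eval_ext j e env st st' : (forall j', j' != j -> st j' =1 st' j') ->
  ~~ reads j e -> eval e env st = eval e env st'.
Proof.
move=> h; elim: e env => [c|x|j' a IHa|a IHa|a IHa b IHb|a IHa b IHb|a IHa b IHb c IHc|x a IHa] env //=.
- by rewrite negb_or => /andP[nj /IHa ->]; rewrite h.
- by move=> /IHa ->.
- by rewrite negb_or => /andP[/IHa -> /IHb ->].
- by rewrite negb_or => /andP[/IHa -> /IHb ->].
- by rewrite !negb_or => /and3P[/IHa -> /IHb -> /IHc ->].
- by move=> nr; apply: eq_bigr => i _; apply: IHa.
Qed.

Lemma sem_frame j c env st : ~~ writes j c -> sem c env st j = st j.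
Proof.
elim: c env st => [|j' a e|c1 IH1 c2 IH2|e c1 IH1 c2 IH2|x c IH] env st //=.
- by rewrite /put eq_sym => /negbTE ->.
- by rewrite negb_or => /andP[w1 w2]; rewrite IH2 // IH1.
- by rewrite negb_or => /andP[w1 w2]; case: ifP => _; [apply: IH1|apply: IH2].
- by move=> w; elim: (iota 0 N) st => //= i s IHs st; rewrite IHs IH.
Qed.

Lemma for_ind (Q : nat -> store -> Prop) x c env st : Q 0 st ->
  (forall i s, i < N -> Q i s -> Q i.+1 (sem c (upd env x i) s)) ->
  Q N (sem (For x c) env st).
Proof.
move=> q0 h /=; have := leqnn N; rewrite -{1}[N]add0n.
suff : forall k i s, i + k <= N -> Q i s ->
    Q (i + k) (foldl (fun s i => sem c (upd env x i) s) s (iota i k)).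
  by move=> g le; have := g N 0 st le q0; rewrite add0n.
elim=> [|k IH] i s le q /=; first by rewrite addn0.
by rewrite addnS -addSn; apply: IH; [lia|apply: h => //; lia].
Qed.

Lemma sem_Seq c1 c2 env st : sem (Seq c1 c2) env st = sem c2 env (sem c1 env st).
Proof. by []. Qed.

Lemma sem_Skip env st : sem Skip env st = st.
Proof. by []. Qed.

Lemma sem_If e c1 c2 env st : sem (If e c1 c2) env st =
  if eval e env st != 0 then sem c1 env st else sem c2 env st.
Proof. by []. Qed.

Lemma sem_Put j a e env st : sem (Put j a e) env st = put st j (eval a env st) (eval e env st).
Proof. by []. Qed.

Lemma put_ne st j i v j' : j' != j -> put st j i v j' = st j'.
Proof. by rewrite /put => /negbTE ->. Qed.

Lemma put_at st j i v : put st j i v j = upd (st j) i v.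
Proof. by rewrite /put eqxx. Qed.

Definition Asg j x e := For x (Put j (EVar x) e).

(** As [e] does not read [j], the rounds do not influence each other and amount to one simultaneous
    assignment. *)
Lemma sem_Asg j x e env st : ~~ reads j e ->
  forall j' i, sem (Asg j x e) env st j' i =
    if (j' == j) && (i < N) then eval e (upd env x i) st else st j' i.
Proof.
move=> nr; apply: (@for_ind (fun k s => forall j' i, s j' i =
  if (j' == j) && (i < k) then eval e (upd env x i) st else st j' i)) => [j' i|k s lt h j' i].
  by rewrite andbF.
rewrite /= /put upd_eq; case: (eqVneq j' j) => [->|nj] /=; last by rewrite h (negbTE nj).
rewrite /upd; case: (eqVneq i k) => [->|ik].
  rewrite ltnSn; apply: (eval_ext (j := j)) => // j1 nj i1; rewrite h (negbTE nj).
  by [].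
have e1 : (i < k.+1) = (i < k) by rewrite ltnS leq_eqVlt (negbTE ik).
by rewrite h eqxx e1.
Qed.

Lemma sem_Asg_in j x e env st i : ~~ reads j e -> i < N ->
  sem (Asg j x e) env st j i = eval e (upd env x i) st.
Proof. by move=> nr lt; rewrite sem_Asg // eqxx lt. Qed.

(** Every nonzero number counts as true, so disjunction is addition and [a < b] is the truncated
    difference [b - a]. *)
Definition ENot a := EIf a (EConst 0) (EConst 1).
Definition EAnd a b := EIf a b (EConst 0).
Definition EOr a b := EAdd a b.
Definition EEq a b := ENot (EAdd (ESub a b) (ESub b a)).
Definition ELt a b := ESub b a.

Lemma ev_not a env st : (eval (ENot a) env st != 0) = ~~ (eval a env st != 0).
Proof. by rewrite /=; case: (eval a env st != 0). Qed.

Lemma ev_and a b env st :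
  (eval (EAnd a b) env st != 0) = (eval a env st != 0) && (eval b env st != 0).
Proof. by rewrite /=; case: (eval a env st != 0). Qed.

Lemma ev_or a b env st :
  (eval (EOr a b) env st != 0) = (eval a env st != 0) || (eval b env st != 0).
Proof. by rewrite /= addn_eq0 negb_and. Qed.

Lemma ev_eq a b env st : (eval (EEq a b) env st != 0) = (eval a env st == eval b env st).
Proof. by rewrite ev_not /= addn_eq0 !subn_eq0 negbK -eqn_leq. Qed.

Lemma ev_lt a b env st : (eval (ELt a b) env st != 0) = (eval a env st < eval b env st).
Proof. by rewrite /= subn_eq0 -ltnNge. Qed.

Lemma ev_sum x a env st : reflect (exists2 i, i < N & eval a (upd env x i) st != 0)
  (eval (ESum x a) env st != 0).
Proof.
rewrite /= sum_nat_seq_neq0; apply: (iffP hasP) => [[i]|[i lt h]]; last by exists i; rewrite ?mem_iota.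
by rewrite mem_iota => /= lt h; exists i.
Qed.

Lemma ev_sumE x a env st :
  eval (ESum x a) env st = \sum_(i <- iota 0 N) eval a (upd env x i) st.
Proof. by []. Qed.

Lemma ev_add a b env st : eval (EAdd a b) env st = eval a env st + eval b env st.
Proof. by []. Qed.

Lemma ev_const k env st : eval (EConst k) env st = k.
Proof. by []. Qed.

Lemma ev_if a b d env st : eval (EIf a b d) env st =
  if eval a env st != 0 then eval b env st else eval d env st.
Proof. by []. Qed.

Definition evE := (ev_not, ev_and, ev_or, ev_eq, ev_lt).

End Frames.

Arguments eval : simpl never.
Arguments sem : simpl never.

(** * The local search *)

(* Arrays: 1 and 2 hold [F] and [X], 3 the edges and 4, 5 the vertices of a graph
   search, 6 the outcome of a feasibility test, 7 a candidate solution. *)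
Definition eN := EIn (EConst 0).
Definition eM := EIn (EConst 1).
Definition trip x := EAdd x (EAdd x x).
Definition eU x := EIn (EAdd (EConst 2) (trip x)).
Definition eV x := EIn (EAdd (EConst 3) (trip x)).
Definition eS x := EIn (EAdd (EConst 4) (trip x)).

Definition v0 := EVar 0.
Definition v2 := EVar 2.
Definition v3 := EVar 3.
Definition v4 := EVar 4.
Definition v5 := EVar 5.
Definition cell j := EArr j (EConst 0).

Definition reach_round := EOr (EArr 4 v0) (ESum 2 (EAnd (ELt v2 eM) (EAnd (EArr 3 v2)
  (EOr (EAnd (EEq (eU v2) v0) (EArr 4 (eV v2))) (EAnd (EEq (eV v2) v0) (EArr 4 (eU v2))))))).

(** Each round is computed into array 5 and then copied, because an assignment must not read its own
    target. *)
Definition reachc src := Seq (Asg 4 0 (EEq v0 src))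
  (For 1 (Seq (Asg 5 0 reach_round) (Asg 4 0 (EArr 5 v0)))).

Definition connE := ENot (ESum 2 (EAnd (ELt v2 eN) (ENot (EArr 4 v2)))).

(* The rounds of the loop with index at least [nedges] delete no edge, so plain
   connectivity is tested as well. *)
Definition feasc j := Seq (Put 6 (EConst 0) (EConst 1)) (For 3 (Seq
  (Asg 3 0 (EAnd (EArr j v0) (ENot (EAnd (EEq v0 v3) (ENot (eS v3))))))
  (Seq (reachc (EConst 0)) (Put 6 (EConst 0) (EAnd (cell 6) connE))))).

Definition bridgec j d := For 3 (Seq
  (Asg 3 0 (EAnd (EArr j v0) (ENot (EEq v0 v3))))
  (Seq (reachc (eU v3))
     (Put d v3 (EAnd (ELt v3 eM) (EAnd (EArr j v3) (ENot (EArr 4 (eV v3)))))))).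

Definition crossc j d := Seq (Asg 3 0 (EArr j v0)) (For 3 (Seq (reachc (eU v3))
  (Put d v3 (EAnd (ELt v3 eM) (ENot (EArr 4 (eV v3))))))).

Definition muE j b := EAdd
  (ESum 2 (EIf (EAnd (ELt v2 eM) (EArr j v2)) (EAdd eM (EConst 1)) (EConst 0)))
  (ESum 2 (EIf (EAnd (ELt v2 eM) (EArr b v2)) (EConst 1) (EConst 0))).

(** Accepting a candidate also resets [X] to it and so undoes all splits. *)
Definition acceptc := Seq (feasc 7) (Seq (bridgec 7 8) (Seq (Put 9 (EConst 0) (muE 7 8))
  (Seq (bridgec 1 8) (Seq (Put 10 (EConst 0) (muE 1 8))
  (If (EAnd (cell 6) (ELt (cell 9) (cell 10)))
     (Seq (Asg 1 0 (EArr 7 v0)) (Asg 2 0 (EArr 7 v0))) Skip))))).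

(** * Correctness of the graph routines *)

Section Procedures.

Variable I : fgc.
Local Notation n := (nverts I).
Local Notation m := (nedges I).
Local Notation V := 'I_n.
Local Notation E := 'I_m.
Local Notation en := (@ends I).
Local Notation sf := (safe I).
Local Notation N := (n + m).
Local Notation eval := (eval N (2 + 3 * m) (nth 0 (encode I))).
Local Notation sem := (sem N (2 + 3 * m) (nth 0 (encode I))).
Implicit Types (env : nat -> nat) (st : store) (X : {set E}) (e f : E) (u v : V).

Definition setof (f : nat -> nat) : {set E} := [set e : E | f e != 0].

Lemma in_setof (f : nat -> nat) e : (e \in setof f) = (f e != 0).
Proof. by rewrite inE. Qed.

Lemma ev_N env st : eval eN env st = n.
Proof. by []. Qed.

Lemma ev_M env st : eval eM env st = m.
Proof. by []. Qed.

Lemma ltE e : e < N. Proof. by apply: leq_trans (ltn_ord e) (leq_addl _ _). Qed.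
Lemma ltV v : v < N. Proof. by apply: leq_trans (ltn_ord v) (leq_addr _ _). Qed.

Lemma ev_in a env st k : eval a env st = k ->
  eval (EIn a) env st = if k < 2 + 3 * m then nth 0 (encode I) k else 0.
Proof. by move=> <-. Qed.

Lemma ev_trip c x env st k : eval x env st = k ->
  eval (EAdd (EConst c) (trip x)) env st = c + 3 * k.
Proof. by move=> h; rewrite !ev_add ev_const h; lia. Qed.

Lemma ev_arr j a env st : eval (EArr j a) env st = st j (eval a env st).
Proof. by []. Qed.

Lemma ev_U x e env st : eval x env st = e -> eval (eU x) env st = (en e).1.
Proof.
move=> h; rewrite (ev_in (ev_trip 2 h)); have [-> _ _] := encode_edge e.
by have lt := ltn_ord e; have -> : 2 + 3 * e < 2 + 3 * m by lia.
Qed.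

Lemma ev_V x e env st : eval x env st = e -> eval (eV x) env st = (en e).2.
Proof.
move=> h; rewrite (ev_in (ev_trip 3 h)); have [_ -> _] := encode_edge e.
by have lt := ltn_ord e; have -> : 3 + 3 * e < 2 + 3 * m by lia.
Qed.

Lemma ev_S x e env st : eval x env st = e -> (eval (eS x) env st != 0) = (e \in sf).
Proof.
move=> h; rewrite (ev_in (ev_trip 4 h)); have [_ _ ->] := encode_edge e.
have lt := ltn_ord e; have -> : 4 + 3 * e < 2 + 3 * m by lia.
by case: (e \in sf).
Qed.

Definition vert0 : V := Ordinal (nverts_gt0 I).

(** An index that is no edge points past the input and reads 0, the first vertex, so idle rounds
    still search from a vertex. *)
Lemma ev_U_out x env st : m <= eval x env st -> eval (eU x) env st = vert0.
Proof.
move=> h; rewrite (ev_in (ev_trip 2 erefl)).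
by have -> : (2 + 3 * eval x env st < 2 + 3 * m) = false by lia.
Qed.

Lemma nat_edge i : i < m -> exists e : E, i = e.
Proof. by move=> lt; exists (Ordinal lt). Qed.

Lemma reach_round_ok env st v : (eval reach_round (upd env 0 v) st != 0) =
  (st 4 v != 0) || [exists u : V, (st 4 u != 0) && adj (setof (st 3)) u v].
Proof.
rewrite ev_or; congr (_ || _); apply/ev_sum/existsP.
  move=> [i lt]; rewrite !evE ev_M => /andP[].
  have e2 : eval v2 (upd (upd env 0 v) 2 i) st = i by [].
  rewrite e2 => /nat_edge[e ie]; subst i => /andP[We] /orP[] /andP[/eqP h1 h2].
  - exists (en e).2; rewrite (ev_U (e := e)) // in h1.
    have -> : st 4 (en e).2 != 0 by move: h2; rewrite ev_arr (ev_V (e := e)).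
    apply/adjP; exists e; first by rewrite inE.
    by right; rewrite [en e]surjective_pairing; congr pair; apply: val_inj; rewrite /= h1.
  - exists (en e).1; rewrite (ev_V (e := e)) // in h1.
    have -> : st 4 (en e).1 != 0 by move: h2; rewrite ev_arr (ev_U (e := e)).
    apply/adjP; exists e; first by rewrite inE.
    by left; rewrite [en e]surjective_pairing; congr pair; apply: val_inj; rewrite /= h1.
move=> [u /andP[ru /adjP[e]]]; rewrite in_setof => We h; exists e; first exact: ltE.
rewrite !evE ev_M (ev_U (e := e)) // (ev_V (e := e)) //.
have -> : eval v2 (upd (upd env 0 v) 2 e) st < m by apply: ltn_ord.
have -> : eval (EArr 3 v2) (upd (upd env 0 v) 2 e) st != 0 by [].
have -> : eval v0 (upd (upd env 0 v) 2 e) st = v by [].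
rewrite !ev_arr (ev_U (e := e)) // (ev_V (e := e)) //.
by case: h => -> /=; rewrite eqxx ru ?orbT.
Qed.

Lemma reach_ok src env st u : (forall i, eval src (upd env 0 i) st = u) -> ~~ reads 4 src ->
  forall v, (sem (reachc src) env st 4 v != 0) = connect (adj (setof (st 3))) u v.
Proof.
move=> hs nr v; set X := setof (st 3).
rewrite -(@grow_connect _ _ _ N) ?leq_addr //.
set st1 := sem (Asg 4 0 (EEq v0 src)) env st.
have h1 (w : V) : (st1 4 w != 0) = (w \in [set u]).
  rewrite /st1 sem_Asg_in ?ltV //; last by rewrite /= !orbF (negbTE nr).
  by rewrite ev_eq hs inE.
have h3 : st1 3 = st 3 by apply: sem_frame.
have : (fun k s => s 3 = st 3 /\ forall w : V, (s 4 w != 0) = (w \in iter k (grow X) [set u])) N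
    (sem (For 1 (Seq (Asg 5 0 reach_round) (Asg 4 0 (EArr 5 v0)))) env st1).
  apply: (@for_ind _ _ _ (fun k s => s 3 = st 3 /\ forall w : V, (s 4 w != 0) = (w \in iter k (grow X) [set u]))) => //.
  move=> k s lt [e3 e4]; split; first by rewrite sem_frame.
  move=> w; rewrite sem_Seq; set s1 := sem (Asg 5 0 reach_round) _ s.
  rewrite sem_Asg_in ?ltV // ev_arr.
  have -> : eval v0 (upd (upd env 1 k) 0 w) s1 = w by [].
  rewrite /s1 sem_Asg_in ?ltV // reach_round_ok e3 e4 !inE; congr (_ || _).
  by apply: eq_existsb => x; rewrite e4.
by case=> _ ->.
Qed.

Lemma ev_ar j i env st : eval (EArr j (EVar i)) env st = st j (env i).
Proof. by []. Qed.

Lemma conn_ok env st : (forall v, (st 4 v != 0) = connect (adj (setof (st 3))) vert0 v) ->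
  (eval connE env st != 0) = spans_connected (setof (st 3)).
Proof.
move=> h; rewrite ev_not; apply/negP/forallP => [nh u|hc].
  have r w : connect (adj (setof (st 3))) vert0 w.
    rewrite -h; apply: contra_notT nh => nw; apply/ev_sum; exists w; first exact: ltV.
    by rewrite !evE ev_ar upd_eq ev_N nw andbT; apply: ltn_ord.
  apply/forallP => w; apply: connect_trans (r w); by rewrite (sym_connect_sym (@adj_sym I _)).
move/ev_sum => [i lt]; rewrite !evE ev_ar upd_eq ev_N => /andP[].
rewrite {1}/eval /= upd_eq => li; rewrite (h (Ordinal li)).
by have /forallP -> := hc vert0.
Qed.

Lemma setof_Asg j x a env st : ~~ reads j a ->
  setof (sem (Asg j x a) env st j) = [set e : E | eval a (upd env x e) st != 0].
Proof. by move=> nr; apply/setP => e; rewrite !inE sem_Asg_in ?ltE. Qed.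

(** The set tested in round [z]; an index of a safe edge or of no edge deletes nothing. *)
Definition without X z : {set E} := [set e in X | ~~ ((e == z :> nat) && (e \notin sf))].

Lemma feas_without X :
  all (fun z => spans_connected (without X z)) (iota 0 N) = feas en sf X.
Proof.
rewrite -feasible_feas; apply/allP/andP => [h|[h1 /forall_inP h2] z _].
  split.
    have -> : X = without X m.
      by apply/setP => e; rewrite !inE ltn_eqF ?andbT.
    by apply: h; rewrite mem_iota /= -[X in X < _]add0n ltn_add2r nverts_gt0.
  apply/forall_inP => e; rewrite !inE => /andP[eX es].
  have -> : X :\ e = without X e.
    apply/setP => z; rewrite !inE andbC; case: (eqVneq z e) => [->|ne]; first by rewrite eqxx es.
    by rewrite (negbTE (_ : (z : nat) != e)).
  by apply: h; rewrite mem_iota ltE.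
case: (ltnP z m) => [/nat_edge[e ->]|le].
  case: (boolP ((e \in X) && (e \notin sf))) => [eXs|ne].
    have -> : without X e = X :\ e.
      apply/setP => w; rewrite !inE andbC; case: (eqVneq w e) => [->|nw].
        by rewrite eqxx /= (andP eXs).2.
      by rewrite (negbTE (_ : (w : nat) != e)).
    by apply: h2; rewrite !inE.
  have -> // : without X e = X.
  apply/setP => w; rewrite !inE; case: (boolP (w \in X)) => //= wX.
  by apply: contra ne => /andP[/eqP/val_inj <- ws]; rewrite wX.
have -> // : without X z = X.
by apply/setP => e; rewrite !inE ltn_eqF ?andbT // (leq_trans (ltn_ord e)).
Qed.

Lemma feasc_ok j env st : j \notin [:: 3; 4; 5; 6] ->
  (sem (feasc j) env st 6 0 != 0) = feas en sf (setof (st j)).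
Proof.
move=> jn; set X := setof (st j); rewrite -feas_without.
move: jn; rewrite !inE !negb_or => /and4P[j3 j4 j5 j6].
pose Q k (s : store) := s j = st j /\
  (s 6 0 != 0) = all (fun z => spans_connected (without X z)) (iota 0 k).
suff [] : Q N (sem (feasc j) env st) by [].
rewrite /feasc sem_Seq sem_Put; apply: (@for_ind _ _ _ Q).
  by split; [rewrite put_ne|rewrite put_at].
move=> k s lt [h1 h2]; set env' := upd env 3 k.
rewrite 2!sem_Seq sem_Put.
set a3 := EAnd (EArr j v0) _; set s1 := sem (Asg 3 0 a3) env' s.
set s2 := sem (reachc (EConst 0)) env' s1.
have nr : ~~ reads 3 a3 by rewrite /= !orbF.
have W : setof (s1 3) = without X k.
  rewrite /s1 setof_Asg //; apply/setP => e; rewrite [LHS]in_set [RHS]in_set /a3 !evE ev_arr.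
  have -> : eval v0 (upd env' 0 e) s = e by [].
  have -> : eval v3 (upd env' 0 e) s = k by [].
  rewrite h1 /X in_setof; congr (_ && ~~ _); case: (eqVneq (e : nat) k) => //= ek.
  by rewrite (ev_S (e := e)) // -ek.
have s23 : s2 3 = s1 3 by apply: sem_frame.
have r : forall v, (s2 4 v != 0) = connect (adj (setof (s2 3))) vert0 v.
  by move=> v; rewrite s23; apply: reach_ok.
have s26 : s2 6 = s 6 by rewrite /s2 sem_frame // /s1 sem_frame.
have s2j : s2 j = st j.
  rewrite /s2 sem_frame; last by rewrite /= ![_ == j]eq_sym (negbTE j4) (negbTE j5).
  by rewrite /s1 sem_frame // /= eq_sym.
split; first by rewrite put_ne.
rewrite put_at upd_eq ev_and conn_ok // ev_arr s26.
rewrite -[k.+1]addn1 iotaD all_cat /= andbT add0n -h2 s23 W.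
by [].
Qed.

Lemma ev_source env s k : exists u : V, (forall i, eval (eU v3) (upd (upd env 3 k) 0 i) s = u) /\
  (forall e, k = e -> u = (en e).1).
Proof.
case: (ltnP k m) => [/nat_edge[e ->]|le].
  exists (en e).1; split => [i|e' /val_inj -> //]; exact: ev_U.
exists vert0; split => [i|e ke]; first exact: ev_U_out.
by move: le; rewrite ke leqNgt ltn_ord.
Qed.

Lemma bridgec_ok j d env st : j \notin [:: 3; 4; 5] -> d \notin [:: 3; 4; 5; j] ->
  forall e, (sem (bridgec j d) env st d e != 0) = bridge en (setof (st j)) e.
Proof.
rewrite !inE !negb_or => /and3P[j3 j4 j5] /and4P[d3 d4 d5 dj]; set X := setof (st j).
pose Q k (s : store) := s j = st j /\ forall e, e < k -> (s d e != 0) = bridge en X e.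
suff [_ h] : Q N (sem (bridgec j d) env st) by move=> e; apply: h; apply: ltE.
apply: (@for_ind _ _ _ Q) => // k s lt [h1 h2]; set env' := upd env 3 k.
rewrite 2!sem_Seq sem_Put.
set a3 := EAnd (EArr j v0) _; set s1 := sem (Asg 3 0 a3) env' s.
set s2 := sem (reachc (eU v3)) env' s1.
have nr : ~~ reads 3 a3 by rewrite /= !orbF.
have W : setof (s1 3) = [set e in X | (e : nat) != k].
  rewrite /s1 setof_Asg //; apply/setP => e; rewrite [LHS]in_set [RHS]in_set /a3 !evE ev_arr.
  have -> : eval v0 (upd env' 0 e) s = e by [].
  have -> : eval v3 (upd env' 0 e) s = k by [].
  by rewrite h1 /X in_setof.
have s2j : s2 j = st j.
  rewrite /s2 sem_frame; last by rewrite /= ![_ == j]eq_sym (negbTE j4) (negbTE j5).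
  by rewrite /s1 sem_frame // /= eq_sym.
have s2d : s2 d = s d.
  rewrite /s2 sem_frame; last by rewrite /= ![_ == d]eq_sym (negbTE d4) (negbTE d5).
  by rewrite /s1 sem_frame // /= eq_sym.
split; first by rewrite put_ne // eq_sym.
move=> e ek; rewrite put_at.
case: (eqVneq (e : nat) k) => [ke|ne]; last first.
  by rewrite /upd (negbTE ne) s2d; apply: h2; move: ek; rewrite ltnS leq_eqVlt (negbTE ne).
have [u [hu hu']] := ev_source env s1 k.
have ue := hu' _ (esym ke).
rewrite ke upd_eq !evE.
have -> : eval v3 env' s2 = k by [].
rewrite ev_M -{1}ke ltn_ord /= !ev_arr (ev_V (e := e)) // s2j /s2 (reach_ok hu) // ue.
have -> : eval v3 env' (sem (reachc (eU v3)) env' s1) = e by rewrite ke.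
rewrite W connect_ends bridge_cross_D1 /X in_setof.
congr (_ && (_ \in cross _ _)); apply/setP => z; rewrite !inE andbC; congr (_ && _).
by rewrite -ke.
Qed.

Lemma crossc_ok j d env st : d \notin [:: 3; 4; 5] -> j != 3 ->
  forall e, (sem (crossc j d) env st d e != 0) = (e \in cross en (setof (st j))).
Proof.
rewrite !inE !negb_or => /and3P[d3 d4 d5] j3; set X := setof (st j).
pose Q k (s : store) := setof (s 3) = X /\ forall e, e < k -> (s d e != 0) = (e \in cross en X).
suff [_ h] : Q N (sem (crossc j d) env st) by move=> e; apply: h; apply: ltE.
rewrite /crossc sem_Seq; apply: (@for_ind _ _ _ Q) => [|k s lt [h1 h2]].
  split => //; rewrite setof_Asg; last by rewrite /= orbF.
  by apply/setP => e; rewrite !inE.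
set env' := upd env 3 k.
rewrite sem_Seq sem_Put; set s2 := sem (reachc (eU v3)) env' s.
have s23 : s2 3 = s 3 by apply: sem_frame.
have s2d : s2 d = s d.
  by rewrite /s2 sem_frame //= ![_ == d]eq_sym (negbTE d4) (negbTE d5).
split; first by rewrite put_ne ?s23 // eq_sym.
move=> e ek; rewrite put_at.
case: (eqVneq (e : nat) k) => [ke|ne]; last first.
  by rewrite /upd (negbTE ne) s2d; apply: h2; move: ek; rewrite ltnS leq_eqVlt (negbTE ne).
have [u [hu hu']] := ev_source env s k.
have ue := hu' _ (esym ke).
rewrite ke upd_eq !evE.
have -> : eval v3 env' s2 = k by [].
rewrite ev_M -{1}ke ltn_ord /= !ev_arr (ev_V (e := e)) // /s2 (reach_ok hu) // ue h1.
by rewrite connect_ends.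
Qed.

Lemma sum_setof (f : nat -> nat) c :
  \sum_(i <- iota 0 N) (if (i < m) && (f i != 0) then c else 0) = #|setof f| * c.
Proof.
rewrite addnC iotaD big_cat /= [X in _ + X]big_seq [X in _ + X]big1 ?addn0; last first.
  by move=> i; rewrite mem_iota add0n => /andP[le _]; rewrite ltnNge le.
have -> : iota 0 m = index_iota 0 m by rewrite /index_iota subn0.
rewrite -sum_nat_const big_mkord [RHS]big_mkcond /=.
by apply: eq_bigr => i _; rewrite inE ltn_ord.
Qed.

Lemma mu_ok j b env st :
  (forall e, (st b e != 0) = bridge en (setof (st j)) e) ->
  eval (muE j b) env st = mu en (setof (st j)).
Proof.
move=> h; rewrite /mu /nbridges card_ord.
have -> : #|[set e | bridge en (setof (st j)) e]| = #|setof (st b)|.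
  by apply: eq_card => e; rewrite !inE h.
rewrite -[#|setof (st b)|]muln1 -!sum_setof.
have sumE j' a : eval (ESum 2 (EIf (EAnd (ELt v2 eM) (EArr j' v2)) a (EConst 0))) env st =
    \sum_(i <- iota 0 N) (if (i < m) && (st j' i != 0) then eval a (upd env 2 i) st else 0).
  by rewrite ev_sumE; apply: eq_bigr => i _; rewrite ev_if !evE.
rewrite ev_add !sumE.
by congr (_ + _); apply: eq_bigr => i _; rewrite ?ev_add ?ev_const ?ev_M ?addn1.
Qed.

Definition state_of st : {set E} * {set E} := (setof (st 1), setof (st 2)).

Definition accept Y (a : {set E} * {set E}) :=
  if feas en sf Y && (mu en Y < mu en a.1) then (Y, Y) else a.

Lemma acceptc_ok env st : state_of (sem acceptc env st) = accept (setof (st 7)) (state_of st).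
Proof.
rewrite /acceptc.
set c1 := feasc 7; set c2 := bridgec 7 8; set c3 := Put 9 _ _; set c4 := bridgec 1 8.
set c5 := Put 10 _ _; set c6 := If _ _ _.
pose s1 := sem c1 env st; pose s2 := sem c2 env s1; pose s3 := sem c3 env s2.
pose s4 := sem c4 env s3; pose s5 := sem c5 env s4.
rewrite -[sem _ env st]/(sem c6 env s5).
have f1 j : j \in [:: 1; 2; 7] -> s5 j = st j.
  rewrite !inE => hj; have [w1 w2 w3 w4 w5] : [/\ ~~ writes j c1, ~~ writes j c2, ~~ writes j c3, ~~ writes j c4 & ~~ writes j c5].
    by case/or3P: hj => /eqP ->.
  by rewrite /s5 sem_frame // /s4 sem_frame // /s3 sem_frame // /s2 sem_frame // /s1 sem_frame.
have e1 : s1 7 = st 7 by apply: sem_frame.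
have e2 : s2 7 = st 7 by rewrite /s2 sem_frame.
have e3 : s3 1 = st 1 by rewrite /s3 sem_frame // /s2 sem_frame // /s1 sem_frame.
have e4 : s4 1 = st 1 by rewrite /s4 sem_frame.
have h6 : (s5 6 0 != 0) = feas en sf (setof (st 7)).
  by rewrite /s5 sem_frame // /s4 sem_frame // /s3 sem_frame // /s2 sem_frame // feasc_ok.
have h9 : s5 9 0 = mu en (setof (st 7)).
  rewrite /s5 sem_frame // /s4 sem_frame // /s3 /c3 sem_Put put_at upd_eq.
  rewrite mu_ok ?e2 // => e.
  by rewrite /s2 bridgec_ok // e1.
have h10 : s5 10 0 = mu en (setof (st 1)).
  rewrite /s5 /c5 sem_Put put_at upd_eq mu_ok ?e4 // => e.
  by rewrite /s4 bridgec_ok // e3.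
have cond : (eval (EAnd (cell 6) (ELt (cell 9) (cell 10))) env s5 != 0) =
    feas en sf (setof (st 7)) && (mu en (setof (st 7)) < mu en (setof (st 1))).
  by rewrite ev_and ev_lt !ev_arr -h6 -h9 -h10.
rewrite /accept /state_of [(_, _).1]/= -cond /c6 sem_If.
case: ifP => _; last by rewrite sem_Skip !f1.
rewrite sem_Seq.
set s6 := sem (Asg 1 0 (EArr 7 v0)) env s5.
have a1 : setof (s6 1) = setof (st 7).
  by rewrite setof_Asg //; apply/setP => e; rewrite !inE ev_arr f1.
congr pair; first by rewrite sem_frame.
rewrite setof_Asg //; apply/setP => e.
by rewrite !inE ev_arr /s6 sem_frame // f1.
Qed.

End Procedures.

Definition memE xs := foldr (fun x a => EOr (EEq v0 (EVar x)) a) (EConst 0) xs.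
Definition nest xs c := foldr For c xs.
(* A variable whose value is not the index of an edge selects none, so 20
   variables range over all sets of at most 20 edges. *)
Definition addv := iota 10 20.
Definition delv := iota 30 20.

Definition swapc := Seq
  (Asg 7 0 (EAnd (EOr (EArr 1 v0) (memE addv)) (ENot (memE delv)))) acceptc.

Definition prune_step := If (EAnd (ELt v5 eM) (EArr 12 v5))
  (Seq (Asg 13 0 (EAnd (EArr 7 v0) (ENot (EEq v0 v5)))) (Seq (feasc 13)
     (If (cell 6) (Asg 7 0 (EArr 13 v0)) Skip))) Skip.

Definition prunec := If (EAnd (ELt v4 eM) (EArr 2 v4))
  (Seq (crossc 2 12)
  (Seq (Asg 7 0 (EOr (EAnd (EArr 2 v0) (ENot (EEq v0 v4))) (EArr 12 v0)))
  (Seq (For 5 prune_step) acceptc))) Skip.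

(** Cell 0 of array 9 records whether the ends of the first edge become separated; arrays 8 and 11
    hold the bridges after and before the deletion. *)
Definition splitc := If (EAnd (EAnd (EAnd (ELt v4 eM) (ELt v5 eM)) (EAnd (EArr 2 v4) (EArr 2 v5)))
    (EAnd (ENot (EEq v4 v5)) (EAnd (ENot (eS v4)) (ENot (eS v5)))))
  (Seq (Asg 7 0 (EAnd (EArr 2 v0) (EAnd (ENot (EEq v0 v4)) (ENot (EEq v0 v5)))))
  (Seq (Asg 3 0 (EArr 7 v0))
  (Seq (reachc (eU v4))
  (Seq (Put 9 (EConst 0) (ENot (EArr 4 (eV v4))))
  (Seq (bridgec 7 8)
  (Seq (bridgec 2 11)
  (If (EAnd (cell 9) (ENot (ESum 2 (EAnd (ELt v2 eM) (EAnd (EArr 8 v2)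
         (ENot (EAnd (eS v2) (EArr 11 v2))))))))
     (Asg 2 0 (EArr 7 v0)) Skip)))))))
  Skip.

Definition passc := Seq (nest (addv ++ delv) swapc)
  (Seq (For 4 prunec) (For 4 (For 5 splitc))).

(* Every pass before the first idle one lowers the potential, which is initially
   below the number of passes. *)
Definition mainc := Seq (Asg 1 0 (EConst 1)) (Seq (Asg 2 0 (EConst 1))
  (For 6 (For 7 (For 8 passc)))).

Lemma wf_mainc : wf_cmd [::] mainc.
Proof. by vm_compute. Qed.

Definition envs (xs vs : seq nat) (env : nat -> nat) : nat -> nat :=
  foldl (fun en xv => upd en xv.1 xv.2) env (zip xs vs).

Lemma envs_notin xs vs env y : y \notin xs -> envs xs vs env y = env y.
Proof.
rewrite /envs; elim: xs vs env => [|x xs IH] [|v vs] env //=.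
by rewrite inE negb_or => /andP[yx /IH ->]; rewrite /upd (negbTE yx).
Qed.

Lemma envs_map xs vs env : uniq xs -> size xs = size vs -> map (envs xs vs env) xs = vs.
Proof.
elim: xs vs env => [|x xs IH] [|v vs] env //= /andP[nx ux] [sz].
congr (_ :: _); last exact: IH.
by rewrite /envs /= -/(envs xs vs (upd env x v)) envs_notin // upd_eq.
Qed.

Lemma iota0S k : iota 0 k.+1 = iota 0 k ++ [:: k].
Proof. by rewrite -addn1 iotaD. Qed.

(** * Termination and correctness of the local search *)

Section Main.

Variable I : fgc.
Local Notation n := (nverts I).
Local Notation m := (nedges I).
Local Notation V := 'I_n.
Local Notation E := 'I_m.
Local Notation en := (@ends I).
Local Notation sf := (safe I).
Local Notation N := (n + m).
Local Notation eval := (eval N (2 + 3 * m) (nth 0 (encode I))).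
Local Notation sem := (sem N (2 + 3 * m) (nth 0 (encode I))).
Local Notation state_of := (@state_of I).
Local Notation accept := (@accept I).
Local Notation feas := (feas en sf).
Local Notation mu := (mu en).
Local Notation cross := (cross en).
Local Notation split_ok := (split_ok en sf).
Local Notation state := ({set E} * {set E})%type.
Implicit Types (env : nat -> nat) (st : store) (X Y A D : {set E}) (e f : E) (a : state).

(** Lexicographic: a smaller [mu] outweighs the growth of [X], which has at most [m] edges. *)
Definition potential a := mu a.1 * m.+1 + #|a.2|.
Definition good_state a := feas a.1 /\ reach en sf a.1 a.2.

(** The command acts on the pair of sets as a function that is idle or lowers the potential, and [K]
    describes when it is idle. An idle pass thus certifies all conditions of a local optimum at
    once. *)
Definition Good c env (K : state -> Prop) := exists g : state -> state,
  [/\ forall st, state_of (sem c env st) = g (state_of st), forall a, g a = a \/ potential (g a) < potential a,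
      forall a, good_state a -> good_state (g a) & forall a, g a = a <-> K a].

Lemma Good_ext c env (K K' : state -> Prop) : (forall a, K a <-> K' a) ->
  Good c env K -> Good c env K'.
Proof. by move=> h [g [g1 g2 g3 g4]]; exists g; split=> // a; rewrite g4 h. Qed.

(** A lowered potential is never raised again, so a composition is idle only if both parts are. *)
Lemma potential_comp (g h : state -> state) :
  (forall a, g a = a \/ potential (g a) < potential a) -> (forall a, h a = a \/ potential (h a) < potential a) ->
  forall a, [/\ h (g a) = a \/ potential (h (g a)) < potential a & h (g a) = a <-> g a = a /\ h a = a].
Proof.
move=> dg dh a; case: (dg a) => [->|lt1].
  by split; [exact: dh|split=> [->//|[]]].
case: (dh (g a)) => [->|lt2].
  split; first by right.
  split=> [eq|[eq]]; by move: lt1; rewrite eq ltnn.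
split; first by right; apply: ltn_trans lt1.
split=> [eq|[eq]]; first by move: (ltn_trans lt2 lt1); rewrite eq ltnn.
by move: lt1; rewrite eq ltnn.
Qed.

Lemma Good_Seq c1 c2 env K1 K2 : Good c1 env K1 -> Good c2 env K2 ->
  Good (Seq c1 c2) env (fun a => K1 a /\ K2 a).
Proof.
move=> [g [g1 g2 g3 g4]] [h [h1 h2 h3 h4]]; exists (fun a => h (g a)); split.
- by move=> st; rewrite sem_Seq h1 g1.
- by move=> a; have [] := potential_comp g2 h2 a.
- by move=> a /g3/h3.
- by move=> a; have [_ ->] := potential_comp g2 h2 a; rewrite g4 h4.
Qed.

Lemma Good_For x c env (K : nat -> state -> Prop) :
  (forall i, i < N -> Good c (upd env x i) (K i)) ->
  Good (For x c) env (fun a => forall i, i < N -> K i a).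
Proof.
move=> h; suff: forall k, k <= N -> exists g : state -> state,
    [/\ forall st, state_of (foldl (fun s i => sem c (upd env x i) s) st (iota 0 k)) = g (state_of st),
      forall a, g a = a \/ potential (g a) < potential a,
      forall a, good_state a -> good_state (g a) &
      forall a, g a = a <-> forall i, i < k -> K i a].
  by move=> /(_ N (leqnn N)).
elim=> [|k IH] le; first by exists id; split=> // a; left.
have [g [g1 g2 g3 g4]] := IH (ltnW le); have [h' [h1 h2 h3 h4]] := h _ le.
exists (fun a => h' (g a)); split.
- by move=> st; rewrite iota0S foldl_cat /= h1 g1.
- by move=> a; have [] := potential_comp g2 h2 a.
- by move=> a /g3/h3.
- move=> a; have [_ ->] := potential_comp g2 h2 a; rewrite g4 h4; split.
    by move=> [ha hb] i; rewrite ltnS leq_eqVlt => /orP[/eqP->//|]; apply: ha.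
  by move=> ha; split=> [i lt|]; apply: ha => //; apply: ltnW.
Qed.

Lemma Good_nest xs c env (K : (nat -> nat) -> state -> Prop) :
  (forall env, Good c env (K env)) ->
  Good (nest xs c) env (fun a => forall vs, size vs = size xs -> all (fun v => v < N) vs ->
    K (envs xs vs env) a).
Proof.
move=> h; elim: xs env => [|x xs IH] env.
  have [g [g1 g2 g3 g4]] := h env; exists g; split=> // a; rewrite g4.
  by split=> [k [|//] _ _|/(_ [::] erefl isT)].
have [g [g1 g2 g3 g4]] := Good_For (x := x) (env := env) (fun i _ => IH (upd env x i)).
exists g; split=> // a; rewrite g4; split.
  by move=> k [//|v vs] [sz] /= /andP[lt al]; apply: k.
by move=> k i lt vs sz al; apply: (k (i :: vs)) => /=; rewrite ?sz ?lt.
Qed.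

Lemma card_E (A : {set E}) : #|A| <= m.
Proof. by rewrite -[X in _ <= X](card_ord m); apply: max_card. Qed.

Lemma Good_acc c env (Y : state -> {set E}) :
  (forall st, state_of (sem c env st) = accept (Y (state_of st)) (state_of st)) ->
  Good c env (fun a => accept (Y a) a = a).
Proof.
move=> h; exists (fun a => accept (Y a) a); split=> // a.
  rewrite /accept; case: ifP => [/andP[_ lt]|_]; [right|by left].
  rewrite /potential /=; have := card_E (Y a); have := leq_mul lt (leqnn m.+1).
  rewrite mulSn => h1 h2; apply: leq_trans (leq_addr _ _); apply: leq_trans h1.
  by rewrite addnC ltn_add2r ltnS.
rewrite /accept; case: ifP => [/andP[fY _] _|//]; split => //=; exact: reach0.
Qed.

Definition pickset env xs : {set E} := [set e : E | has (fun x => (e : nat) == env x) xs].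

Lemma ev_mem xs env st : (eval (memE xs) env st != 0) = has (fun x => env 0 == env x) xs.
Proof. by elim: xs => //= x xs IH; rewrite ev_or ev_eq IH. Qed.

Lemma Good_swap env : Good swapc env
  (fun a => accept ((a.1 :|: pickset env addv) :\: pickset env delv) a = a).
Proof.
apply: (@Good_acc swapc env (fun a => (a.1 :|: pickset env addv) :\: pickset env delv)) => st.
rewrite /swapc sem_Seq acceptc_ok; set s1 := sem (Asg _ _ _) env st.
have -> : state_of s1 = state_of st by rewrite /state_of /s1 !sem_frame.
congr (accept _ _); rewrite /s1 setof_Asg //; apply/setP => e.
rewrite [LHS]in_set ev_and ev_or ev_not !ev_mem ev_arr !inE andbC; congr (~~ _ && (_ || _)).
Qed.

Definition del Y (i : nat) : {set E} := [set e in Y | (e : nat) != i].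
Definition prune1 (C : {set E}) Y (i : nat) : {set E} :=
  if has (fun f => (f : nat) == i) (enum C) && feas (del Y i) then del Y i else Y.
Definition prune X e : {set E} := foldl (prune1 (cross X)) ((X :\ e) :|: cross X) (iota 0 N).

Lemma has_C (C : {set E}) i : has (fun f => (f : nat) == i) (enum C) =
  (if insub i is Some f then f \in C else false).
Proof.
case: insubP => [f lt fi|ge].
  apply/hasP/idP => [[f']|fC]; last by exists f; rewrite ?mem_enum // fi.
  by rewrite mem_enum => fC /eqP h; have -> : f = f' by apply: val_inj; rewrite /= fi h.
by apply/hasP => -[f _ /eqP h]; move: ge; rewrite -h ltn_ord.
Qed.

Lemma del_E Y f : del Y f = Y :\ f.
Proof. by apply/setP => e; rewrite !inE andbC. Qed.

(** One sweep gives minimality: an edge that could not be deleted earlier cannot be deleted from the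
    smaller final set, as feasibility passes to supersets. *)
Lemma prune_props X e : let Y := prune X e in
  [/\ X :\ e \subset Y, Y \subset (X :\ e) :|: cross X,
      feas ((X :\ e) :|: cross X) -> feas Y &
      forall f, f \in Y -> f \in cross X -> ~~ feas (Y :\ f)].
Proof.
set Z := (X :\ e) :|: cross X; rewrite /prune -/Z.
suff h k : let Y := foldl (prune1 (cross X)) Z (iota 0 k) in
  [/\ X :\ e \subset Y, Y \subset Z, feas Z -> feas Y &
      forall f, f < k -> f \in Y -> f \in cross X -> ~~ feas (Y :\ f)].
  by have [h1 h2 h3 h4] := h N; split => // f; apply: h4; apply: ltE.
elim: k => [|k IH]; first by split=> //; apply: subsetUl.
rewrite iota0S foldl_cat /=; set Y := foldl _ _ _ in IH *.
have [h1 h2 h3 h4] := IH; rewrite /prune1; case: ifP => [/andP[hC fD]|nC].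
  rewrite has_C in hC; case: insubP hC => // f lt fk fC.
  have kE : k = f by rewrite -fk.
  rewrite kE del_E in fD *; split => //.
  - apply/subsetP => z zX; rewrite !inE (subsetP h1 _ zX) andbT.
    apply: contraTneq zX => ->; rewrite !inE negb_and; apply/orP; right.
    by apply: contraTN fC => /(crossN en).
  - exact: subset_trans (subD1set _ _) h2.
  - move=> f'; rewrite ltnS leq_eqVlt => /orP[/eqP/val_inj->|lt']; first by rewrite !inE eqxx.
    rewrite !inE => /andP[_ fY] fc; apply: contra (h4 f' _ fY fc) => [|]; last by rewrite kE.
    apply: feas_sub; apply: setSD; exact: subD1set.
split => // f; rewrite ltnS leq_eqVlt => /orP[/eqP fk|lt']; last exact: h4.
move=> fY fc; apply: contraFN nC => fD; rewrite has_C -fk valK fc /=.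
by rewrite del_E.
Qed.

Lemma pstep_ok env st : let st' := sem prune_step env st in
  setof I (st' 7) = prune1 (setof I (st 12)) (setof I (st 7)) (env 5).
Proof.
rewrite /prune_step sem_If ev_and ev_lt ev_arr ev_M /prune1 has_C.
have -> : eval v5 env st = env 5 by [].
case: insubP => [f lt fi|ge]; last by rewrite (negbTE ge).
rewrite lt /= in_setof -fi; case: ifP => _ //=.
rewrite 2!sem_Seq sem_If; set a13 := EAnd _ _; set s1 := sem (Asg 13 0 a13) env st.
set s2 := sem (feasc 13) env s1.
have d13 : setof I (s1 13) = del (setof I (st 7)) f.
  rewrite /s1 setof_Asg //; apply/setP => e; rewrite [LHS]in_set [RHS]in_set /a13 !evE ev_arr in_setof.
  have -> : eval v0 (upd env 0 e) st = e by [].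
  by have -> : eval v5 (upd env 0 e) st = f by rewrite fi.
rewrite ev_arr ev_const feasc_ok // d13; case: ifP => _.
  rewrite setof_Asg //; apply/setP => e; rewrite [LHS]in_set ev_arr -d13 in_setof.
  by rewrite /s2 sem_frame.
by rewrite sem_Skip /s2 sem_frame // /s1 sem_frame.
Qed.

Lemma Good_prune env : Good prunec env
  (fun a => (if insub (env 4) is Some e then (if e \in a.2 then accept (prune a.2 e) a else a) else a) = a).
Proof.
apply: (@Good_ext _ _ (fun a => accept (if insub (env 4) is Some e then
      (if e \in a.2 then prune a.2 e else a.1) else a.1) a = a)).
  move=> a; case: insub => [e|]; last by rewrite /accept ltnn andbF.
  by case: ifP => //; rewrite /accept ltnn andbF.
apply: (@Good_acc prunec env (fun a => if insub (env 4) is Some e then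
      (if e \in a.2 then prune a.2 e else a.1) else a.1)) => st.
have idacc a : accept a.1 a = a by rewrite /accept ltnn andbF.
rewrite /prunec sem_If ev_and ev_lt ev_arr ev_M.
have -> : eval v4 env st = env 4 by [].
case: insubP => [e lt ei|ge]; last by rewrite (negbTE ge) andFb sem_Skip idacc.
rewrite lt /= -ei -in_setof -/(setof I (st 2)).
case: ifP => eX; last by rewrite sem_Skip; exact: (esym (idacc (state_of st))).
rewrite 3!sem_Seq; set s1 := sem (crossc 2 12) env st; set a7 := EOr _ _.
set s2 := sem (Asg 7 0 a7) env s1; set s3 := sem (For 5 prune_step) env s2.
have f3 j : j \in [:: 1; 2] -> s3 j = st j.
  rewrite !inE => hj; have [w1 w2 w3] : [/\ ~~ writes j (crossc 2 12), ~~ writes j (Asg 7 0 a7) & ~~ writes j (For 5 prune_step)].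
    by case/orP: hj => /eqP ->.
  by rewrite /s3 sem_frame // /s2 sem_frame // /s1 sem_frame.
rewrite acceptc_ok.
have -> : state_of s3 = state_of st by rewrite /state_of !f3.
congr (accept _ _).
have c12 : setof I (s1 12) = cross (setof I (st 2)).
  by apply/setP => f; rewrite in_setof crossc_ok.
have d7 : setof I (s2 7) = (setof I (st 2) :\ e) :|: cross (setof I (st 2)).
  rewrite /s2 setof_Asg //; apply/setP => f; rewrite [LHS]in_set /a7 !evE !ev_arr.
  have -> : eval v0 (upd env 0 f) s1 = f by [].
  have -> : eval v4 (upd env 0 f) s1 = e by rewrite ei.
  rewrite in_setU in_setD1 -c12 !in_setof /s1 sem_frame // andbC; congr (_ && _ || _).
pose Q k (s : store) := setof I (s 12) = cross (setof I (st 2)) /\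
  setof I (s 7) = foldl (prune1 (cross (setof I (st 2)))) ((setof I (st 2) :\ e) :|: cross (setof I (st 2))) (iota 0 k).
suff [] : Q N s3 by [].
apply: (@for_ind _ _ _ Q).
  by split; rewrite // /s2 sem_frame.
move=> k s lt' [h1 h2]; split; first by rewrite sem_frame.
by rewrite pstep_ok h1 h2 upd_eq iota0S foldl_cat.
Qed.

Definition split_step env (a : state) : state :=
  if insub (env 4) is Some e1 then if insub (env 5) is Some e2 then
    if split_ok a.2 e1 e2 then (a.1, a.2 :\: [set e1; e2]) else a else a else a.

Lemma split_okE X e1 e2 : split_ok X e1 e2 =
  [&& (e1 \in X) && (e2 \in X), e1 != e2 & (e1 \notin sf) && (e2 \notin sf)] &&
  ((e1 \in cross (X :\: [set e1; e2])) &&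
  [forall e, bridge en (X :\: [set e1; e2]) e ==> ((e \in sf) && bridge en X e)]).
Proof.
rewrite /split_ok; have -> : [exists S, (dl en (X :\: [set e1; e2]) S == set0) && cr en e1 S] =
    (e1 \in cross (X :\: [set e1; e2])).
  apply/existsP/crossP => [[S /andP[/eqP d c]]|[S d c]]; exists S => //.
  by rewrite d eqxx.
by case: (e1 \in X); case: (e2 \in X); case: (e1 \in sf); case: (e2 \in sf); case: (e1 != e2).
Qed.

Lemma splitc_ok env st : state_of (sem splitc env st) = split_step env (state_of st).
Proof.
rewrite /splitc sem_If /split_step.
set cond := eval _ env st != 0.
have condE : cond = [&& (env 4 < m) && (env 5 < m), (st 2 (env 4) != 0) && (st 2 (env 5) != 0) &
    (env 4 != env 5) && (~~ (eval (eS v4) env st != 0) && ~~ (eval (eS v5) env st != 0))].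
  by rewrite /cond !evE -!andbA.
case: insubP => [e1 lt1 i1|ge]; last by rewrite condE (negbTE ge) /= sem_Skip.
case: insubP => [e2 lt2 i2|ge]; last by rewrite condE (negbTE ge) andbF /= sem_Skip.
have E1 st' : eval v4 env st' = e1 by rewrite i1.
have E2 st' : eval v5 env st' = e2 by rewrite i2.
set X := (state_of st).2; set X' := X :\: [set e1; e2].
have cE : cond = [&& (e1 \in X) && (e2 \in X), e1 != e2 & (e1 \notin sf) && (e2 \notin sf)].
  by rewrite condE lt1 lt2 /= -i1 -i2 !in_setof (ev_S (e := e1)) // (ev_S (e := e2)).
rewrite split_okE -cE; case: cond {condE cE} => /=; last by rewrite sem_Skip.
rewrite 6!sem_Seq; set a7 := EAnd (EArr 2 v0) _.
set s1 := sem (Asg 7 0 a7) env st; set s2 := sem (Asg 3 0 _) env s1.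
set s3 := sem (reachc _) env s2; set s4 := sem (Put _ _ _) env s3.
set s5 := sem (bridgec 7 8) env s4; set s6 := sem (bridgec 2 11) env s5.
have d7 : setof I (s1 7) = X'.
  rewrite /s1 setof_Asg //; apply/setP => e; rewrite [LHS]in_set /a7 !evE ev_arr.
  have -> : eval v0 (upd env 0 e) st = e by [].
  have -> : eval v4 (upd env 0 e) st = e1 by rewrite i1.
  have -> : eval v5 (upd env 0 e) st = e2 by rewrite i2.
  by rewrite in_setD in_set2 negb_or in_setof andbC.
have d3 : setof I (s2 3) = X'.
  by rewrite /s2 setof_Asg //; apply/setP => e; rewrite [LHS]in_set ev_arr -d7 in_setof.
have f7 : s4 7 = s1 7 by rewrite /s4 sem_frame // /s3 sem_frame // /s2 sem_frame.
have f72 : s6 7 = s1 7 by rewrite /s6 sem_frame // /s5 sem_frame.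
have f2 : s5 2 = st 2.
  by rewrite /s5 sem_frame // /s4 sem_frame // /s3 sem_frame // /s2 sem_frame // /s1 sem_frame.
have f1 j : j \in [:: 1; 2] -> s6 j = st j.
  rewrite !inE => /orP[]/eqP->; last by rewrite /s6 sem_frame.
  by rewrite /s6 sem_frame // /s5 sem_frame // /s4 sem_frame // /s3 sem_frame // /s2 sem_frame // /s1 sem_frame.
have h9 : (s6 9 0 != 0) = (e1 \in cross X').
  rewrite /s6 sem_frame // /s5 sem_frame // /s4 sem_Put put_at upd_eq ev_not ev_arr.
  have hu i : eval (eU v4) (upd env 0 i) s2 = (en e1).1 by apply: ev_U; exact: (esym i1).
  by rewrite (ev_V (e := e1)) // /s3 (reach_ok hu) // d3 connect_ends.
have h8 e : (s6 8 e != 0) = bridge en X' e.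
  by rewrite /s6 sem_frame // /s5 bridgec_ok // f7 d7.
have h11 e : (s6 11 e != 0) = bridge en X e by rewrite /s6 bridgec_ok // f2.
rewrite sem_If ev_and ev_arr ev_const h9 ev_not.
have -> : ~~ (eval (ESum 2 (EAnd (ELt v2 eM) (EAnd (EArr 8 v2) (ENot (EAnd (eS v2) (EArr 11 v2)))))) env s6 != 0)
   = [forall e, bridge en X' e ==> ((e \in sf) && bridge en X e)].
  apply/negP/forallP => [nh e|h /ev_sum[i lt]].
    apply/implyP => be; apply: contra_notT nh => nb; apply/ev_sum; exists e; first exact: ltE.
    rewrite !evE !ev_arr (ev_S (e := e)) // ev_M.
    have -> : eval v2 (upd env 2 e) s6 = e by [].
    by rewrite ltn_ord h8 be h11.
  rewrite !evE !ev_arr ev_M; have -> : eval v2 (upd env 2 i) s6 = i by [].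
  move=> /andP[/nat_edge[e ie]]; subst i; rewrite h8 h11 (ev_S (e := e)) // => /andP[be].
  by have := h e; rewrite be /= => ->.
case: ifP => _; last by rewrite sem_Skip /state_of !f1.
rewrite /state_of; congr pair; first by rewrite sem_frame // f1.
by rewrite setof_Asg //; apply/setP => e; rewrite [LHS]in_set ev_arr f72 -d7 in_setof.
Qed.

Lemma Good_split env : Good splitc env (fun a => split_step env a = a).
Proof.
exists (split_step env); split=> // [st|a|a]; first exact: splitc_ok.
  rewrite /split_step; case: insub => [e1|]; last by left.
  case: insub => [e2|]; last by left.
  case: ifP => [ok|_]; [right|by left]; rewrite /potential /= ltn_add2l; apply: proper_card.
  apply/properP; split; first exact: subsetDl.
  by exists e1; [case/and5P: ok|rewrite !inE eqxx].
rewrite /split_step; case: insub => [e1|//]; case: insub => [e2|//]; case: ifP => // ok [fa ra].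
by split => //; apply: reachS.
Qed.

Definition stable (a : state) := [/\ forall A D, #|A| <= 20 -> #|D| <= 20 ->
    accept ((a.1 :|: A) :\: D) a = a,
  forall e, e \in a.2 -> accept (prune a.2 e) a = a & forall e1 e2, ~~ split_ok a.2 e1 e2].

Lemma card_pickset env xs : #|pickset env xs| <= size xs.
Proof.
apply: (@leq_trans #|(pmap insub (map env xs) : seq E)|).
  apply/subset_leq_card/subsetP => e; rewrite inE => /hasP[x xs_ /eqP ex].
  by rewrite mem_pmap_sub; apply/mapP; exists x.
apply: leq_trans (card_size _) _.
by rewrite size_pmap (leq_trans (count_size _ _)) // size_map.
Qed.

(** Surplus variables get the value [m], the index of no edge, which is below [N] because there is a
    vertex. *)
Lemma code_set A : #|A| <= 20 -> exists vs, [/\ size vs = 20, all (fun v => v < N) vs &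
  forall e, (e \in A) = ((e : nat) \in vs)].
Proof.
move=> cA; exists (map val (enum A) ++ nseq (20 - #|A|) m); split.
- by rewrite size_cat size_map -cardE size_nseq subnKC.
- rewrite all_cat all_nseq; apply/andP; split; last first.
    by rewrite -[X in X < _]add0n ltn_add2r nverts_gt0 orbT.
  by apply/allP => v /mapP[e _ ->]; apply: ltE.
move=> e; rewrite mem_cat mem_nseq (ltn_eqF (ltn_ord e)) andbF orbF.
by rewrite (mem_map val_inj) mem_enum.
Qed.

Lemma picksetE env xs vs e : map env xs = vs -> (e \in pickset env xs) = ((e : nat) \in vs).
Proof.
move=> <-; rewrite inE; apply/hasP/mapP => [[x xx /eqP ex]|[x xx ex]]; exists x => //.
by rewrite ex.
Qed.

Lemma Good_pass env : Good passc env stable.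
Proof.
have := Good_Seq (Good_nest (addv ++ delv) env Good_swap)
  (Good_Seq (Good_For (x := 4) (env := env) (fun i _ => Good_prune (upd env 4 i)))
    (Good_For (x := 4) (env := env) (fun i _ =>
      Good_For (x := 5) (env := upd env 4 i) (fun j _ => Good_split (upd (upd env 4 i) 5 j))))).
apply: Good_ext => a; split=> [[h1 [h2 h3]]|[h1 h2 h3]].
  split=> [A D cA cD|e eX|e1 e2].
  - have [va [sa aa ha]] := code_set cA; have [vd [sd_ ad hd]] := code_set cD.
    have := h1 (va ++ vd); rewrite size_cat sa sd_ all_cat aa ad => /(_ erefl isT).
    set env' := envs _ _ _.
    have mE : map env' (addv ++ delv) = va ++ vd by apply: envs_map => //; rewrite size_cat sa sd_.
    move: mE; rewrite map_cat => /eqP; rewrite eqseq_cat ?size_map ?sa // => /andP[/eqP ma /eqP md].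
    have -> : pickset env' addv = A by apply/setP => e; rewrite (picksetE _ ma) ha.
    by have -> : pickset env' delv = D by apply/setP => e; rewrite (picksetE _ md) hd.
  - by have := h2 e (ltE e); rewrite upd_eq valK eX.
  - have := h3 e1 (ltE e1) e2 (ltE e2); rewrite /split_step upd_eq.
    have -> : upd (upd env 4 e1) 5 e2 4 = e1 by [].
    rewrite !valK; case: ifP => // ok; have e1X : e1 \in a.2 by case/and5P: ok.
    by move=> /(congr1 (fun b : state => e1 \in b.2)); rewrite /= e1X !inE eqxx.
split=> [vs _ _|]; first by apply: h1; apply: card_pickset.
split=> [i _|i _ j _]; first by case: insubP => // e _ _; case: ifP => // /h2.
by rewrite /split_step; case: insub => // e1; case: insub => // e2; rewrite (negbTE (h3 _ _)).
Qed.

(** Iterating such commands adds up the drops [k] until a stable pair is reached, which is then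
    never left. *)
Definition Drive c env k := forall st, good_state (state_of st) ->
  let a' := state_of (sem c env st) in
  [/\ good_state a', stable a' \/ potential a' + k <= potential (state_of st) & stable (state_of st) -> a' = state_of st].

Lemma Drive_pass env : Drive passc env 1.
Proof.
have [g [g1 g2 g3 g4]] := Good_pass env; move=> st ga; rewrite /= g1; split.
- exact: g3.
- case: (g2 (state_of st)) => [eq|lt]; [left|by right; rewrite addn1].
  by rewrite eq; apply/g4.
- by move=> /g4.
Qed.

Lemma Drive_For x c env k : (forall i, Drive c (upd env x i) k) -> Drive (For x c) env (N * k).
Proof.
move=> h st ga; pose Q i s := [/\ good_state (state_of s), stable (state_of s) \/ potential (state_of s) + i * k <= potential (state_of st)
  & stable (state_of st) -> state_of s = state_of st].
suff : Q N (sem (For x c) env st) by [].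
apply: (@for_ind _ _ _ Q) => [|i s lt [h1 h2 h3]]; first by split=> //; right; rewrite mul0n addn0.
have [k1 k2 k3] := h i s h1; split => //.
  case: h2 => [ks|le]; first by left; rewrite k3.
  case: k2 => [kp|le2]; [by left|right].
  apply: leq_trans le; rewrite [i.+1 * k]mulSn.
  by apply: leq_trans (leq_add le2 (leqnn (i * k))); rewrite -[X in _ <= X]addnA.
by move=> ks; rewrite k3 ?h3 //; rewrite h3.
Qed.

Lemma main_ok : feasible_instance I ->
  let F := setof I (sem mainc (fun=> 0) (fun _ _ => 0) 1) in
  @feasible I F /\ forall O, @feasible I O -> 11 * #|F| <= 16 * #|O|.
Proof.
move=> [O0]; rewrite feasible_feas => f0.
have fT : feas [set: E] by apply: feas_sub f0; apply: subsetT.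
rewrite /mainc 2!sem_Seq; set s1 := sem (Asg 1 _ _) _ _; set s2 := sem (Asg 2 _ _) _ _.
have a2 : state_of s2 = ([set: E], [set: E]).
  rewrite /state_of; congr pair; last by rewrite /s2 setof_Asg //; apply/setP => e; rewrite !inE.
  by rewrite /s2 sem_frame // /s1 setof_Asg //; apply/setP => e; rewrite !inE.
have g2 : good_state (state_of s2) by rewrite a2; split => //; apply: reach0.
have D : Drive (For 6 (For 7 (For 8 passc))) (fun=> 0) (N * (N * (N * 1))).
  by do 3![apply: Drive_For => ?]; apply: Drive_pass.
have [] := D s2 g2; set st := sem _ _ s2; rewrite -/(state_of st) => -[fF rF] [kp|le] _; last first.
  (* [mu] is initially at most [(m + 1) ^ 2 - 1], so the potential is at most [(m + 1) ^ 3 - 1],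
     less than the [N ^ 3] passes of three nested loops. *)
  exfalso; move: le; rewrite a2 /potential /mu /= cardsT !card_ord.
  have := nbridges_le en [set: E]; rewrite cardsT card_ord => b1.
  have n0 := nverts_gt0 I; have c1 := leq_mul b1 (leqnn m.+1).
  have N1 : m.+1 <= N by rewrite -[m.+1]add1n leq_add2r.
  have N2 := leq_mul N1 N1; have N3 := leq_mul N1 N2; rewrite muln1 => le.
  have : m.+1 * (m.+1 * m.+1) <= (m * m.+1 + nbridges en [set: E]) * m.+1 + m.
    by apply: leq_trans N3 _; apply: leq_trans (leq_addl _ _) le.
  by move: c1; clear; rewrite mulnDl; nia.
case: kp => k0 k1 k2; rewrite feasible_feas; split; first exact: fF.
have accK Y : accept Y (state_of st) = state_of st -> feas Y -> mu (state_of st).1 <= mu Y.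
  rewrite /accept => + fY; rewrite fY leqNgt /=; case: ltnP => // lt eq.
  by move: lt; have /= <- := congr1 fst eq; rewrite ltnn.
move=> O; rewrite feasible_feas => fO.
apply: (@local_opt_ratio V E en sf _ (state_of st).2 O) => //.
- by rewrite card_ord nverts_gt0.
- by move=> A D' cA cD; apply: accK; apply: k0.
- move=> e eX; exists (prune (state_of st).2 e); have [p1 p2 p3 p4] := prune_props (state_of st).2 e.
  by split=> //; apply: accK; apply: k1.
Qed.

End Main.

(** The default value of the minimum is the size of the full edge set, which is feasible as well. *)
Lemma opt_ratio (I : fgc) (F : {set 'I_(nedges I)}) : feasible_instance I ->
  (forall O, @feasible I O -> 11 * #|F| <= 16 * #|O|) -> 11 * #|F| <= 16 * opt I.
Proof.
move=> [O0 f0] h; apply: (@big_ind _ (fun x => 11 * #|F| <= 16 * x)) => //.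
  have fT : @feasible I setT.
    by move: f0; rewrite !feasible_feas; apply: feas_sub; apply: subsetT.
  by have := h _ fT; rewrite cardsT card_ord.
by move=> x y hx hy; rewrite /minn; case: ifP.
Qed.

Theorem theorem6 :
  exists (P : program) (c k : nat),
  forall I : fgc, feasible_instance I ->
  exists t : nat,
    let F := output_edges I (run P (encode I) t) in
    [/\ t <= c * instance_size I ^ k,
        halted P (run P (encode I) t),
        feasible F &
        (#|F|%:R <= (16%:R / 11%:R) * (opt I)%:R :> rat)%R].
Proof.
have [C [k hC]] := poly_cmd_cost mainc.
(* [2 ^ k] passes from the base [N.+1] to [N]; 21 covers eight steps per output cell and thirteen
   others, and the larger exponent absorbs the linear term. *)
exists (compile 1 mainc), (C * 2 ^ k + 21), k.+1 => I fI.
have := @compile_ok (nverts I) (nedges I) 1 (encode I) mainc (size_encode I) erefl erefl wf_mainc isT.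
move=> [t lt [hP out]]; exists t; rewrite -/(run _ _ t) in hP out.
have -> : output_edges I (run (compile 1 mainc) (encode I) t) =
    setof I (sem (nverts I + nedges I) (2 + 3 * nedges I) (nth 0 (encode I)) mainc (fun=> 0) (fun _ _ => 0) 1).
  by apply/setP => e; rewrite in_set in_setof out.
have [fF ratio] := main_ok fI; split => //.
  apply: leq_trans lt _; rewrite /instance_size.
  have := hC (nverts I + nedges I); move: (cmd_cost _ _) (leq_addl (nverts I) (nedges I)) => cost.
  have : 0 < nverts I + nedges I by rewrite addn_gt0 nverts_gt0.
  move: (nedges I) (nverts I + nedges I) => m N N1 mN costN.
  have h1 : N.+1 ^ k <= 2 ^ k * N ^ k.
    rewrite -expnMn; have NN : N.+1 <= 2 * N by rewrite mul2n -addnn -addn1 leq_add2l.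
    by case: (k) => // k'; rewrite leq_exp2r.
  have h2 : N ^ k <= N ^ k.+1 by rewrite expnS leq_pmull.
  have h3 : N <= N ^ k.+1 by rewrite expnS leq_pmulr // expn_gt0 N1.
  rewrite mulnDl -mulnA; have : cost <= C * (2 ^ k * N ^ k.+1).
    apply: leq_trans costN _; rewrite leq_mul2l; apply/orP; right.
    by apply: leq_trans h1 _; rewrite leq_mul2l h2 orbT.
  by move: (C * _) h3 N1 mN; clear; lia.
have := opt_ratio fI ratio; set f := #|_|; set o := opt I => le.
rewrite mulrAC ler_pdivlMr ?ltr0n // -!natrM ler_nat mulnC.
exact: le.
Qed.
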